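(* 1) For the complex quadratic system $$\dot x=x-a_{10}x^2-a_{01}xy-a_{-12}y^2,\qquad \dot y=-(y-b_{10}xy-b_{01}y^2-b_{2,-1}x^2),$$ the first three focus quantities $g_{11},g_{22},g_{33}$ generate the ideal $\langle g_{11},g_{22},\dots\rangle$ of all focus quantities, and the same holds for the real quadratic system $i\dot x=x-a_{10}x^2-a_{01}x\bar x-a_{-12}\bar x^2$. 2) For the complex cubic system $$\dot x=x-a_{20}x^3-a_{11}x^2y-a_{02}xy^2-a_{-13}y^3,\qquad \dot y=-(y-b_{02}y^3-b_{11}xy^2-b_{20}x^2y-b_{3,-1}x^3),$$ the first five focus quantities $g_{11},\dots,g_{55}$ generate the ideal $\langle g_{11},g_{22},\dots\rangle$ of all focus quantities, and the same holds for the real cubic system $i\dot x=x-a_{20}x^3-a_{11}x^2\bar x-a_{02}x\bar x^2-a_{-13}\bar x^3$.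
   Context: Consider a system $\dot x=P(x,y)$, $\dot y=Q(x,y)$ of one of the two complex forms, and let $\mathbb{C}[a,b]$ be the polynomial ring in its coefficients ($a_{10},a_{01},a_{-12},b_{2,-1},b_{10},b_{01}$ in the quadratic case; $a_{20},a_{11},a_{02},a_{-13},b_{3,-1},b_{20},b_{11},b_{02}$ in the cubic case). There is a formal power series $\Psi(x,y)=xy+\sum_{s=3}^\infty\sum_{j=0}^s v_{j,s-j}x^jy^{s-j}$ with $v_{j,s-j}\in\mathbb{C}[a,b]$ such that $$\frac{\partial\Psi}{\partial x}P+\frac{\partial\Psi}{\partial y}Q=g_{11}\,(xy)^2+g_{22}\,(xy)^3+g_{33}\,(xy)^4+\cdots$$ with $g_{kk}\in\mathbb{C}[a,b]$; fix such a $\Psi$. The polynomials $g_{kk}$ are called the focus quantities, and the ideal of focus quantities is $\langle g_{11},g_{22},\dots\rangle\subset\mathbb{C}[a,b]$. A real system in the plane $x=u+iv$, written in the complex form $i\dot x=x-a_{10}x^2-a_{01}x\bar x-a_{-12}\bar x^2$ (quadratic case) or $i\dot x=x-a_{20}x^3-a_{11}x^2\bar x-a_{02}x\bar x^2-a_{-13}\bar x^3$ (cubic case), corresponds to the complex system of the same degree under $y=\bar x$, $b_{qp}=\overline{a_{pq}}$ (and a change of time $i\,d\tau=dt$); its focus quantities are obtained from those of the complex system by the substitution $b_{qp}=\overline{a_{pq}}$, and are viewed as elements of the polynomial ring over $\mathbb{C}$ in the $a_{pq}$ and $\overline{a_{pq}}$. *)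

(* Defs.v *)
From mathcomp Require Export all_boot all_order all_algebra.
From mathcomp Require Export boolp classical_sets reals.
From mathcomp.real_closed Require Export complex.
From mathcomp.multinomials Require Export mpoly.

Set Implicit Arguments.
Unset Strict Implicit.
Unset Printing Implicit Defensive.

Import GRing.Theory.

Local Open Scope classical_set_scope.
Local Open Scope ring_scope.

Section FocusQuantities.
Variable A : comNzRingType.

(* F i j is the coefficient of x^i y^j. *)
Definition bips := nat -> nat -> A.

Definition bips_add (F G : bips) : bips := fun i j => F i j + G i j.

Definition bips_mul (F G : bips) : bips := fun i j =>
  \sum_(k < i.+1) \sum_(l < j.+1) F k l * G (i - k)%N (j - l)%N.

Definition bips_dx (F : bips) : bips := fun i j => F i.+1 j *+ i.+1.
Definition bips_dy (F : bips) : bips := fun i j => F i j.+1 *+ j.+1.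

(* In {poly {poly A}} the outer variable 'X is x and the inner one 'Y is y,
   as in polyXY. *)
Definition bips_of_poly (p : {poly {poly A}}) : bips := fun i j => p`_i`_j.

Definition starts_with_xy (Psi : bips) : Prop :=
  forall i j, (i + j < 3)%N -> Psi i j = ((i == 1%N) && (j == 1%N))%:R.

(* The series g_11 (x y)^2 + g_22 (x y)^3 + ..., where g k stands for g_kk, k >= 1;
   g 0 is not used. *)
Definition focus_series (g : nat -> A) : bips := fun i j =>
  if (i == j) && (2 <= i)%N then g i.-1 else 0.

Definition is_focus_quantities (P Q : {poly {poly A}}) (Psi : bips)
    (g : nat -> A) : Prop :=
  starts_with_xy Psi /\
  forall i j,
    bips_add (bips_mul (bips_dx Psi) (bips_of_poly P))
             (bips_mul (bips_dy Psi) (bips_of_poly Q)) i j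
    = focus_series g i j.

Definition ideal_gen (S : set A) : set A :=
  [set h | exists (n : nat) (c s : 'I_n -> A),
     (forall i, S (s i)) /\ h = \sum_(i < n) c i * s i].

Definition first_generate (m : nat) (g : nat -> A) : Prop :=
  ideal_gen [set g k | k in [set k : nat | (1 <= k <= m)%N]]
  = ideal_gen [set g k | k in [set k : nat | (1 <= k)%N]].

End FocusQuantities.

Notation "c %:PP" := (c%:P%:P) (at level 1, left associativity, only parsing)
  : ring_scope.

Section Systems.
Variable A : comNzRingType.

Definition quad_x (a10 a01 am12 : A) : {poly {poly A}} :=
  'X - a10%:PP * 'X ^+ 2 - a01%:PP * 'X * 'Y - am12%:PP * 'Y ^+ 2.

Definition quad_y (b2m1 b10 b01 : A) : {poly {poly A}} :=
  - ('Y - b10%:PP * 'X * 'Y - b01%:PP * 'Y ^+ 2 - b2m1%:PP * 'X ^+ 2).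

Definition cub_x (a20 a11 a02 am13 : A) : {poly {poly A}} :=
  'X - a20%:PP * 'X ^+ 3 - a11%:PP * 'X ^+ 2 * 'Y - a02%:PP * 'X * 'Y ^+ 2
  - am13%:PP * 'Y ^+ 3.

Definition cub_y (b3m1 b20 b11 b02 : A) : {poly {poly A}} :=
  - ('Y - b02%:PP * 'Y ^+ 3 - b11%:PP * 'X * 'Y ^+ 2 - b20%:PP * 'X ^+ 2 * 'Y
     - b3m1%:PP * 'X ^+ 3).

End Systems.

Section Quadratic.
Variable R : realType.

Definition quad_ring : comNzRingType := {mpoly R[i][6]}.

Definition qX (k : nat) (lt_k : (k < 6)%N) : quad_ring := 'X_(Ordinal lt_k).

Definition q_a10 := @qX 0 isT.
Definition q_a01 := @qX 1 isT.
Definition q_am12 := @qX 2 isT. (* a_{-1,2} *)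
Definition q_b2m1 := @qX 3 isT. (* b_{2,-1} *)
Definition q_b10 := @qX 4 isT.
Definition q_b01 := @qX 5 isT.

Definition quad_P := quad_x q_a10 q_a01 q_am12.
Definition quad_Q := quad_y q_b2m1 q_b10 q_b01.

(* C[a_pq, conj a_pq]; as a_pq and conj a_pq are algebraically independent
   over C, the conjugates are indeterminates too. *)
Definition quad_real_ring : comNzRingType := {mpoly R[i][6]}.

Definition qrX (k : nat) (lt_k : (k < 6)%N) : quad_real_ring :=
  'X_(Ordinal lt_k).

Definition qr_a10 := @qrX 0 isT.
Definition qr_a01 := @qrX 1 isT.
Definition qr_am12 := @qrX 2 isT.
Definition qr_a10c := @qrX 3 isT. (* conj a_10 *)
Definition qr_a01c := @qrX 4 isT. (* conj a_01 *)
Definition qr_am12c := @qrX 5 isT. (* conj a_{-1,2} *)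

(* b_qp := conj a_pq, that is b_{2,-1} := conj a_{-1,2}, b_10 := conj a_01 and
   b_01 := conj a_10. *)
Definition quad_to_real (p : quad_ring) : quad_real_ring :=
  p \mPo [tuple qr_a10; qr_a01; qr_am12; qr_am12c; qr_a01c; qr_a10c].

End Quadratic.

Section Cubic.
Variable R : realType.

Definition cub_ring : comNzRingType := {mpoly R[i][8]}.

Definition cX (k : nat) (lt_k : (k < 8)%N) : cub_ring := 'X_(Ordinal lt_k).

Definition c_a20 := @cX 0 isT.
Definition c_a11 := @cX 1 isT.
Definition c_a02 := @cX 2 isT.
Definition c_am13 := @cX 3 isT. (* a_{-1,3} *)
Definition c_b3m1 := @cX 4 isT. (* b_{3,-1} *)
Definition c_b20 := @cX 5 isT.
Definition c_b11 := @cX 6 isT.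
Definition c_b02 := @cX 7 isT.

Definition cub_P := cub_x c_a20 c_a11 c_a02 c_am13.
Definition cub_Q := cub_y c_b3m1 c_b20 c_b11 c_b02.

Definition cub_real_ring : comNzRingType := {mpoly R[i][8]}.

Definition crX (k : nat) (lt_k : (k < 8)%N) : cub_real_ring :=
  'X_(Ordinal lt_k).

Definition cr_a20 := @crX 0 isT.
Definition cr_a11 := @crX 1 isT.
Definition cr_a02 := @crX 2 isT.
Definition cr_am13 := @crX 3 isT.
Definition cr_a20c := @crX 4 isT. (* conj a_20 *)
Definition cr_a11c := @crX 5 isT. (* conj a_11 *)
Definition cr_a02c := @crX 6 isT. (* conj a_02 *)
Definition cr_am13c := @crX 7 isT. (* conj a_{-1,3} *)

(* b_{3,-1} := conj a_{-1,3}, b_20 := conj a_02, b_11 := conj a_11 and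
   b_02 := conj a_20. *)
Definition cub_to_real (p : cub_ring) : cub_real_ring :=
  p \mPo [tuple cr_a20; cr_a11; cr_a02; cr_am13;
                cr_am13c; cr_a02c; cr_a11c; cr_a20c].

End Cubic.

(* Main.v *)
From Stdlib Require Import ZArith.
From HB Require Import structures.
From mathcomp Require Import zify ssrZ ring fraction.
Require Import Defs.
From mathcomp Require Import ssrcomplements.

Set Implicit Arguments.
Unset Strict Implicit.
Unset Printing Implicit Defensive.

Import Order.TTheory GRing.Theory Num.Theory.
Local Open Scope ring_scope.

(** The proof compares the ideal of all focus quantities with an explicit ideal
    spanned by homogeneous polynomials [H_1, ..., H_r] ([quad_gens] with
    [r = 3], [cub_gens] with [r = 5]), and shows that the first [r] focus
    quantities already span that ideal.

    The tool used at every step is that a focus quantity is determined by the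
    system modulo the preceding ones ([focus_unique]).  So a single normalized
    first integral forces all focus quantities, for every choice of the series,
    to vanish; and the spans of [g_11, ..., g_kk] do not depend on the series,
    which may therefore be replaced by a quasi-homogeneous one.

    Every focus quantity lies in [<H_1, ..., H_r>].  It vanishes on each family
    of centers: the time-reversible systems ([center_of_reversible]), and the
    Hamiltonian, Lotka-Volterra (quadratic case) and Darboux integrable systems,
    which have an inverse integrating factor
    ([center_of_inverse_integrating_factor]).  Vanishing on these sets is turned
    into membership without any radicality argument, by the monomial
    substitution [a10 = al m, a01 = be n, b10 = be m, b01 = al n, a_{-12} = X,
    b_{2,-1} = Y] of the quadratic system, and [a20 = al m, a02 = be n,
    b20 = be m, b02 = al n, a_{-13} = X, b_{3,-1} = Y, a11 = b11 = c] of the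
    cubic one.  The kernel of this substitution is spanned by the generators
    that cut out its image, [a10 a01 - b10 b01], respectively [a11 - b11] and
    [a20 a02 - b20 b02].  In the new coordinates the first families become
    hypersurfaces: [X m^e = Y n^e] (with [e = 3] or [2]) for the reversible
    systems, [be = 2 al] or [be = 3 al] for the Hamiltonian ones and [be = 0]
    for the Lotka-Volterra ones, so the image of a focus quantity is divisible by
    the product of their equations.  The image has the same degree in [(al, be)]
    as in [(m, n)], whereas that product has one degree less in [(al, be)] than in
    [(m, n)]; so the cofactor vanishes at [al = be = 0].  It also vanishes on the
    Darboux family [al = - l be, c = 0, X Y = k^2 be^2 m n].  These two facts write the image as a
    combination of the images of the remaining generators ([quad_decompose],
    [cub_decompose]), and the combination is pulled back to the original ring by
    a linear section of the monomial map ([toric_descent]).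

    Conversely, every [H_k] lies in the span of the first [r] focus quantities.
    For the quasi-homogeneous series, [g_kk] is homogeneous of the degree of
    [H_k], and the degrees increase with [k], so its expression through the
    generators is triangular, [g_kk = c_k H_k + (combination of the H_i, i < k)]
    with [c_k] constant ([triangular]).  One integral point at which
    [H_1, ..., H_{k-1}] vanish and [g_kk] does not shows that [c_k] is not zero
    ([quad_separate], [cub_separate]).

    The real systems are images of the complex ones under a ring morphism, and
    the contraction of an ideal along a morphism is an ideal. *)

(** * Formal power series *)

Definition ser (A : Type) := nat -> A.

HB.instance Definition _ (A : Type) := gen_eqMixin (ser A).
HB.instance Definition _ (A : Type) := gen_choiceMixin (ser A).

Section SeriesRing.
Variable A : comNzRingType.
Implicit Types f g h : ser A.

Definition ser_add f g : ser A := fun n => f n + g n.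
Definition ser_opp f : ser A := fun n => - f n.
Definition ser_mul f g : ser A := fun n => \sum_(k < n.+1) f k * g (n - k)%N.
Definition ser_cst (a : A) : ser A := fun n => if n is 0%N then a else 0.

Fact ser_addA : associative ser_add.
Proof. by move=> f g h; apply/funext => n; apply: addrA. Qed.
Fact ser_addC : commutative ser_add.
Proof. by move=> f g; apply/funext => n; apply: addrC. Qed.
Fact ser_add0 : left_id (fun=> 0 : A) ser_add.
Proof. by move=> f; apply/funext => n; apply: add0r. Qed.
Fact ser_addN : left_inverse (fun=> 0 : A) ser_opp ser_add.
Proof. by move=> f; apply/funext => n; apply: addNr. Qed.

HB.instance Definition _ :=
  GRing.isZmodule.Build (ser A) ser_addA ser_addC ser_add0 ser_addN.

(** A coefficient of a product only depends on the coefficients of the factors of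
    at most the same degree; truncation thus reduces the ring axioms and the
    Leibniz rule for series to those of polynomials. *)
Definition trunc N f : {poly A} := \poly_(i < N) f i.

Lemma ser_mul_trunc N n (p q : {poly A}) f g : (n < N)%N ->
  (forall i, (i < N)%N -> p`_i = f i) -> (forall i, (i < N)%N -> q`_i = g i) ->
  (p * q)`_n = ser_mul f g n.
Proof.
move=> ltnN pf qg; rewrite coefM; apply: eq_bigr => k _.
by rewrite pf ?qg //; have := ltn_ord k; lia.
Qed.

Lemma coef_trunc N f i : (i < N)%N -> (trunc N f)`_i = f i.
Proof. by move=> ltiN; rewrite coef_poly ltiN. Qed.

Lemma coef_truncM N f g i : (i < N)%N ->
  (trunc N f * trunc N g)`_i = ser_mul f g i.
Proof. by move=> ltiN; apply: ser_mul_trunc ltiN _ _; apply: coef_trunc. Qed.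

Fact ser_mulA : associative ser_mul.
Proof.
move=> f g h; apply/funext => n.
have tr := @coef_trunc n.+1.
rewrite -(ser_mul_trunc (ltnSn n) (tr f) (@coef_truncM n.+1 g h)).
by rewrite -(ser_mul_trunc (ltnSn n) (@coef_truncM n.+1 f g) (tr h)) mulrA.
Qed.
Fact ser_mulC : commutative ser_mul.
Proof.
by move=> f g; apply/funext => n; rewrite -!(@coef_truncM n.+1) // mulrC.
Qed.
Fact ser_mul1 : left_id (ser_cst 1) ser_mul.
Proof.
move=> f; apply/funext => n; rewrite /ser_mul big_ord_recl /= mul1r subn0.
by rewrite big1 ?addr0 // => i _; rewrite mul0r.
Qed.
Fact ser_mulDl : left_distributive ser_mul +%R.
Proof.
move=> f g h; apply/funext => n.
by rewrite -[RHS]big_split; apply: eq_bigr => k _; apply: mulrDl.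
Qed.
Fact ser_1neq0 : ser_cst 1 != 0.
Proof. by apply/eqP => /(congr1 (@^~ 0%N)) /eqP; apply/negP/oner_neq0. Qed.

HB.instance Definition _ := GRing.Zmodule_isComNzRing.Build (ser A)
  ser_mulA ser_mulC ser_mul1 ser_mulDl ser_1neq0.

Lemma serD f g n : (f + g) n = f n + g n. Proof. by []. Qed.
Lemma serN f n : (- f) n = - f n. Proof. by []. Qed.
Lemma ser1 n : (1 : ser A) n = (n == 0%N)%:R. Proof. by case: n. Qed.
Lemma serM f g n : (f * g) n = \sum_(k < n.+1) f k * g (n - k)%N.
Proof. by []. Qed.
Lemma serMn f m n : (f *+ m) n = f n *+ m.
Proof. by elim: m => // m IHm; rewrite !mulrS serD IHm. Qed.
Lemma ser_sum I (r : seq I) (P : pred I) (F : I -> ser A) n :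
  (\sum_(i <- r | P i) F i) n = \sum_(i <- r | P i) F i n.
Proof. exact: (big_morph (fun f : ser A => f n)). Qed.

Fact ser_cst_is_zmod_morphism : zmod_morphism ser_cst.
Proof. by move=> a b; apply/funext => -[|n] //; rewrite serD serN /= subr0. Qed.
Fact ser_cst_is_monoid_morphism : monoid_morphism ser_cst.
Proof.
split=> // a b; apply/funext => n; rewrite serM big_ord_recl /= subn0.
rewrite big1 ?addr0 => [|i _]; last by rewrite mul0r.
by case: n => [|n] //=; rewrite mulr0.
Qed.
HB.instance Definition _ :=
  GRing.isZmodMorphism.Build A (ser A) ser_cst ser_cst_is_zmod_morphism.
HB.instance Definition _ :=
  GRing.isMonoidMorphism.Build A (ser A) ser_cst ser_cst_is_monoid_morphism.

Lemma ser_cstM a f n : (ser_cst a * f) n = a * f n.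
Proof.
rewrite serM big_ord_recl /= subn0 big1 ?addr0 // => i _.
by rewrite mul0r.
Qed.

Definition ser_X : ser A := fun n => (n == 1%N)%:R.

Lemma ser_XM f n : (ser_X * f) n = if n is n'.+1 then f n' else 0.
Proof.
rewrite serM big_ord_recl /ser_X mul0r add0r; case: n => [|n]; first by rewrite big_ord0.
rewrite big_ord_recl mul1r subSS subn0 big1 ?addr0 // => i _.
by rewrite mul0r.
Qed.

Definition ser_deriv f : ser A := fun n => f n.+1 *+ n.+1.

Fact ser_deriv_is_zmod_morphism : zmod_morphism ser_deriv.
Proof. by move=> f g; apply/funext => n; rewrite serD serN /ser_deriv -mulrnBl. Qed.
HB.instance Definition _ := GRing.isZmodMorphism.Build (ser A) (ser A) ser_deriv
  ser_deriv_is_zmod_morphism.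

Lemma ser_derivM f g :
  ser_deriv (f * g) = ser_deriv f * g + f * ser_deriv g.
Proof.
apply/funext => n; pose T := trunc n.+2.
have tr := @coef_trunc n.+2.
have trd h i : (i < n.+1)%N -> ((T h)^`())`_i = ser_deriv h i.
  by move=> lti; rewrite coef_deriv tr.
have tr' h i : (i < n.+1)%N -> (T h)`_i = h i by move=> lti; rewrite tr // ltnW.
have -> : ser_deriv (f * g) n = (T f * T g)`_n.+1 *+ n.+1.
  by rewrite coef_truncM.
rewrite -coef_deriv derivM coefD.
rewrite (ser_mul_trunc (ltnSn n) (trd f) (tr' g)).
by rewrite (ser_mul_trunc (ltnSn n) (tr' f) (trd g)).
Qed.

Lemma ser_deriv_cst a : ser_deriv (ser_cst a) = 0.
Proof. by apply/funext => n; rewrite /ser_deriv mul0rn. Qed.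

(** Up to the factor [u], the inverse is the geometric series of [1 - u f], whose
    powers have increasing order. *)
Lemma ser_inv (f : ser A) (u : A) : f 0%N * u = 1 -> exists g, f * g = 1.
Proof.
move=> fu1; pose t := 1 - ser_cst u * f.
have t0 : t 0%N = 0 by rewrite /t serD serN ser_cstM /= mulrC fu1 subrr.
have tX k n : (n < k)%N -> (t ^+ k) n = 0.
  elim: k n => // k IHk n ltnk; rewrite exprS serM big1 // => -[[|i] ltin] _ /=.
    by rewrite t0 mul0r.
  by rewrite IHk ?mulr0 //; lia.
pose G n := \sum_(k < n.+1) t ^+ k.
have GE m n : (m <= n)%N -> G n m = G m m.
  move=> lemn; rewrite /G -(subnKC lemn); elim: (n - m)%N => [|d IHd].
    by rewrite addn0.
  by rewrite addnS big_ord_recr /= serD tX ?addr0 //; lia.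
have fGn n : (ser_cst u * f) * G n = 1 - t ^+ n.+1.
  by rewrite -[ser_cst u * f](subKr 1) -/t -opprB mulNr -subrX1 opprB.
exists (ser_cst u * fun n => G n n); apply/funext => n.
have -> : (f * (ser_cst u * fun n => G n n)) n = ((ser_cst u * f) * G n) n.
  rewrite mulrCA mulrA !serM; apply: eq_bigr => k _; congr (_ * _).
  by rewrite GE //; lia.
by rewrite fGn serD serN tX ?subr0.
Qed.

End SeriesRing.

Section SeriesMap.
Variables (A B : comNzRingType) (phi : {rmorphism A -> B}).

Definition ser_map (f : ser A) : ser B := fun n => phi (f n).

Fact ser_map_is_zmod_morphism : zmod_morphism ser_map.
Proof. by move=> f g; apply/funext => n; rewrite /ser_map rmorphB. Qed.
Fact ser_map_is_monoid_morphism : monoid_morphism ser_map.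
Proof.
split=> [|f g]; apply/funext => n; rewrite /ser_map.
  by rewrite !ser1 rmorph_nat.
by rewrite !serM rmorph_sum; apply: eq_bigr => k _; rewrite rmorphM.
Qed.
HB.instance Definition _ :=
  GRing.isZmodMorphism.Build (ser A) (ser B) ser_map ser_map_is_zmod_morphism.
HB.instance Definition _ := GRing.isMonoidMorphism.Build (ser A) (ser B) ser_map
  ser_map_is_monoid_morphism.

Lemma ser_map_cst a : ser_map (ser_cst a) = ser_cst (phi a).
Proof. by apply/funext => -[|n] //; rewrite /ser_map rmorph0. Qed.

Lemma ser_map_deriv f : ser_map (ser_deriv f) = ser_deriv (ser_map f).
Proof. by apply/funext => n; rewrite /ser_map /ser_deriv rmorphMn. Qed.

Lemma ser_map_X : ser_map (ser_X A) = ser_X B.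
Proof. by apply/funext => n; rewrite /ser_map rmorph_nat. Qed.
End SeriesMap.

(** * Series in two variables and their derivations *)

Section BiSeries.
Variable A : comNzRingType.

(** The outer variable is x and the inner one is y, so that [series2 A] is
    convertible to [bips A]. *)
Definition series2 := ser (ser A).
HB.instance Definition _ := GRing.ComNzRing.on series2.
Implicit Types F G : series2.

Definition cst (a : A) : series2 := ser_cst (ser_cst a).
Definition xx : series2 := ser_X (ser A).
Definition yy : series2 := ser_cst (ser_X A).

HB.instance Definition _ := GRing.RMorphism.copy cst
  (@ser_cst (ser A) \o @ser_cst A).

Lemma s2D F G i j : (F + G) i j = F i j + G i j. Proof. by []. Qed.
Lemma s2N F i j : (- F) i j = - F i j. Proof. by []. Qed.
Lemma s2B F G i j : (F - G) i j = F i j - G i j. Proof. by []. Qed.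

Lemma bips_mulE F G : bips_mul F G = F * G.
Proof.
apply/funext => i; apply/funext => j; rewrite /bips_mul serM ser_sum.
by apply: eq_bigr.
Qed.

Lemma s2M F G i j :
  (F * G) i j = \sum_(k < i.+1) \sum_(l < j.+1) F k l * G (i - k)%N (j - l)%N.
Proof. by rewrite -bips_mulE. Qed.

Lemma cst_0 : cst 0 = 0. Proof. exact: rmorph0. Qed.
Lemma cst_M a b : cst (a * b) = cst a * cst b. Proof. exact: rmorphM. Qed.
Lemma cst_N a : cst (- a) = - cst a. Proof. exact: rmorphN. Qed.
Lemma cst_D a b : cst (a + b) = cst a + cst b. Proof. exact: rmorphD. Qed.
Lemma cst_nat n : cst n%:R = n%:R. Proof. exact: rmorph_nat. Qed.
Lemma cst_Xn a n : cst (a ^+ n) = cst a ^+ n. Proof. exact: rmorphXn. Qed.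
Definition cstE := (cst_M, cst_N, cst_D, cst_nat, cst_Xn).
Lemma cstM a F i j : (cst a * F) i j = a * F i j.
Proof. by rewrite ser_cstM ser_cstM. Qed.

Lemma xxM F i j : (xx * F) i j = if i is i'.+1 then F i' j else 0.
Proof. by rewrite /xx ser_XM; case: i. Qed.
Lemma yyM F i j : (yy * F) i j = if j is j'.+1 then F i j' else 0.
Proof. by rewrite ser_cstM ser_XM. Qed.

Definition ddx : series2 -> series2 := @ser_deriv (ser A).
Definition ddy : series2 -> series2 := fun F i => ser_deriv (F i).

Lemma ddxE F i j : ddx F i j = F i.+1 j *+ i.+1.
Proof. by rewrite /ddx /ser_deriv serMn. Qed.
Lemma ddyE F i j : ddy F i j = F i j.+1 *+ j.+1. Proof. by []. Qed.

HB.instance Definition _ := GRing.Additive.on ddx.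
Fact ddy_is_zmod_morphism : zmod_morphism ddy.
Proof.
by move=> F G; apply/funext => i; exact: (raddfB (@ser_deriv A) (F i) (G i)).
Qed.
HB.instance Definition _ :=
  GRing.isZmodMorphism.Build series2 series2 ddy ddy_is_zmod_morphism.

Lemma ddxM F G : ddx (F * G) = ddx F * G + F * ddx G.
Proof. exact: ser_derivM. Qed.
Lemma ddyM F G : ddy (F * G) = ddy F * G + F * ddy G.
Proof.
apply/funext => i; rewrite /ddy serM raddf_sum serD !serM -big_split.
by apply: eq_bigr => k _; apply: ser_derivM.
Qed.
Lemma ddxD F G : ddx (F + G) = ddx F + ddx G. Proof. exact: raddfD. Qed.
Lemma ddxN F : ddx (- F) = - ddx F. Proof. exact: raddfN. Qed.
Lemma ddyD F G : ddy (F + G) = ddy F + ddy G. Proof. exact: raddfD. Qed.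
Lemma ddyN F : ddy (- F) = - ddy F. Proof. exact: raddfN. Qed.

Lemma ddx_cst a : ddx (cst a) = 0. Proof. exact: ser_deriv_cst. Qed.
Lemma ddy_cst a : ddy (cst a) = 0.
Proof. by apply/funext => -[|i]; rewrite /ddy /= ?ser_deriv_cst ?raddf0. Qed.
Lemma ddx_xx : ddx xx = 1.
Proof.
apply/funext => i; apply/funext => j; rewrite ddxE /xx /ser_X ser1.
by case: i => //= i; rewrite mul0rn.
Qed.
Lemma ddy_xx : ddy xx = 0.
Proof.
apply/funext => i; apply/funext => j; rewrite ddyE /xx /ser_X.
by case: (i == 1%N); rewrite ?mul0rn // ser1 mul0rn.
Qed.
Lemma ddx_yy : ddx yy = 0. Proof. exact: ser_deriv_cst. Qed.
Lemma ddy_yy : ddy yy = 1.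
Proof.
apply/funext => -[|i]; apply/funext => j; rewrite ddyE /yy /= ?mul0rn //.
by rewrite /ser_X; case: j => //= j; rewrite mul0rn.
Qed.

Definition ddE := (ddxD, ddxN, ddyD, ddyN, ddxM, ddyM, ddx_cst, ddy_cst,
  ddx_xx, ddy_xx, ddx_yy, ddy_yy).

Lemma s2_inv F (u : A) : F 0%N 0%N * u = 1 -> exists G, F * G = 1.
Proof. by move=> /ser_inv[g]; apply: ser_inv. Qed.

Definition coef00 F : A := F 0%N 0%N.
Lemma coef00D F G : coef00 (F + G) = coef00 F + coef00 G. Proof. by []. Qed.
Lemma coef00N F : coef00 (- F) = - coef00 F. Proof. by []. Qed.
Lemma coef00M F G : coef00 (F * G) = coef00 F * coef00 G.
Proof. by rewrite /coef00 s2M !big_ord_recl !big_ord0 !addr0 subnn. Qed.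
Lemma coef00_cst a : coef00 (cst a) = a. Proof. by []. Qed.
Lemma coef00_nat n : coef00 n%:R = n%:R.
Proof. by rewrite -cst_nat coef00_cst. Qed.
Lemma coef00_1 : coef00 1 = 1. Proof. exact: (coef00_nat 1). Qed.
Lemma coef00X F n : coef00 (F ^+ n) = coef00 F ^+ n.
Proof. by elim: n => [|n IHn]; rewrite ?coef00_1 // !exprS coef00M IHn. Qed.
Lemma coef00_xx : coef00 xx = 0. Proof. by []. Qed.
Lemma coef00_yy : coef00 yy = 0. Proof. by []. Qed.
Definition coef00E := (coef00D, coef00N, coef00M, coef00X, coef00_cst,
  coef00_nat, coef00_1, coef00_xx, coef00_yy).

Section Derivation.
Variables P Q : series2.
Definition lie F := ddx F * P + ddy F * Q.

Fact lie_is_zmod_morphism : zmod_morphism lie.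
Proof. by move=> F G; rewrite /lie !raddfB /=; ring. Qed.
HB.instance Definition _ :=
  GRing.isZmodMorphism.Build series2 series2 lie lie_is_zmod_morphism.

Lemma lieM F G : lie (F * G) = lie F * G + F * lie G.
Proof. by rewrite /lie ddxM ddyM; ring. Qed.
Lemma lieD F G : lie (F + G) = lie F + lie G. Proof. exact: raddfD. Qed.
Lemma lieN F : lie (- F) = - lie F. Proof. exact: raddfN. Qed.
Lemma lie_cst a : lie (cst a) = 0.
Proof. by rewrite /lie ddx_cst ddy_cst !mul0r addr0. Qed.
Lemma lie_cstM a F : lie (cst a * F) = cst a * lie F.
Proof. by rewrite lieM lie_cst mul0r add0r. Qed.
Lemma lie_xx : lie xx = P.
Proof. by rewrite /lie ddx_xx ddy_xx mul0r mul1r addr0. Qed.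
Lemma lie_yy : lie yy = Q.
Proof. by rewrite /lie ddx_yy ddy_yy mul0r mul1r add0r. Qed.
Lemma lie1 : lie 1 = 0. Proof. by rewrite -(rmorph1 cst) lie_cst. Qed.
Lemma lieX F n : lie (F ^+ n.+1) = (F ^+ n * lie F) *+ n.+1.
Proof.
elim: n => [|n IHn]; first by rewrite mul1r.
by rewrite exprS lieM IHn mulrnAr mulrA -exprS [in RHS]mulrS mulrC.
Qed.
Lemma lie_nat n : lie n%:R = 0. Proof. by rewrite -cst_nat lie_cst. Qed.
Definition lieE := (lieD, lieN, lieM, lieX, lie_cst, lie_nat, lie1, lie_xx, lie_yy).
End Derivation.
End BiSeries.

Section BiSeriesMap.
Variables (A B : comNzRingType) (phi : {rmorphism A -> B}).

Definition s2map : series2 A -> series2 B := ser_map (ser_map phi).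
HB.instance Definition _ := GRing.RMorphism.on s2map.

Lemma s2mapE F i j : s2map F i j = phi (F i j). Proof. by []. Qed.
Lemma s2map_cst a : s2map (cst a) = cst (phi a).
Proof.
rewrite /s2map /cst ser_map_cst; congr ser_cst; exact: ser_map_cst.
Qed.
Lemma s2map_xx : s2map (xx A) = xx B.
Proof. exact: ser_map_X. Qed.
Lemma s2map_yy : s2map (yy A) = yy B.
Proof.
rewrite /s2map /yy ser_map_cst; congr ser_cst; exact: ser_map_X.
Qed.
Lemma s2map_ddx F : s2map (ddx F) = ddx (s2map F).
Proof. exact: ser_map_deriv. Qed.
Lemma s2map_ddy F : s2map (ddy F) = ddy (s2map F).
Proof. by apply/funext => i; apply: ser_map_deriv. Qed.
Lemma s2map_lie P Q F : s2map (lie P Q F) = lie (s2map P) (s2map Q) (s2map F).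
Proof. by rewrite /lie -s2map_ddx -s2map_ddy -!rmorphM -rmorphD. Qed.
End BiSeriesMap.

Section BiSeriesOfPoly.
Variable A : comNzRingType.

Definition s2poly (p : {poly {poly A}}) : series2 A := bips_of_poly p.

Fact s2poly_is_zmod_morphism :
  zmod_morphism s2poly.
Proof.
by move=> p q; apply/funext => i; apply/funext => j; rewrite /s2poly /bips_of_poly !coefB.
Qed.
Fact s2poly_is_monoid_morphism :
  monoid_morphism s2poly.
Proof.
split=> [|p q]; apply/funext => i; apply/funext => j.
  by rewrite /s2poly /bips_of_poly coef1 ser1; case: eqP => _;
    rewrite ?mulr1n ?mulr0n ?coef1 ?ser1 ?coef0.
rewrite s2M /s2poly /bips_of_poly coefM coef_sum; apply: eq_bigr => k _.
by rewrite coefM.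
Qed.
HB.instance Definition _ := GRing.isZmodMorphism.Build {poly {poly A}}
  (series2 A) s2poly s2poly_is_zmod_morphism.
HB.instance Definition _ := GRing.isMonoidMorphism.Build {poly {poly A}}
  (series2 A) s2poly s2poly_is_monoid_morphism.

Lemma s2polyC (a : A) : s2poly a%:P%:P = cst a.
Proof.
by apply/funext => -[|i]; apply/funext => -[|j]; rewrite /s2poly /bips_of_poly !coefC //= coefC.
Qed.
Lemma s2polyX : s2poly ('X : {poly {poly A}}) = xx A.
Proof.
apply/funext => i; apply/funext => j; rewrite /s2poly /bips_of_poly coefX /xx /ser_X.
by case: eqP => _; rewrite ?mulr1n ?mulr0n ?coef1 ?ser1 ?coef0.
Qed.
Lemma s2polyY : s2poly ('Y : {poly {poly A}}) = yy A.
Proof.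
apply/funext => -[|i]; apply/funext => j; rewrite /s2poly /bips_of_poly coefC /= ?coef0 //.
by rewrite coefX.
Qed.
Lemma s2polyN p : s2poly (- p) = - s2poly p. Proof. exact: rmorphN. Qed.
Lemma s2polyB p q : s2poly (p - q) = s2poly p - s2poly q.
Proof. exact: rmorphB. Qed.
Lemma s2polyM p q : s2poly (p * q) = s2poly p * s2poly q.
Proof. exact: rmorphM. Qed.
Lemma s2polyXn p n : s2poly (p ^+ n) = s2poly p ^+ n.
Proof. exact: rmorphXn. Qed.
Definition s2polyE :=
  (s2polyN, s2polyB, s2polyM, s2polyXn, s2polyC, s2polyX, s2polyY).
End BiSeriesOfPoly.

(** * Ideals and orders of vanishing *)

Record is_ideal (A : comNzRingType) (I : A -> Prop) : Prop := IsIdeal {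
  ideal0 : I 0;
  idealD : forall a b, I a -> I b -> I (a + b);
  idealM : forall c a, I a -> I (c * a) }.

Section Ideals.
Variables (A : comNzRingType) (I : A -> Prop).
Hypothesis idI : is_ideal I.

Lemma idealN a : I a -> I (- a).
Proof. by move=> Ia; rewrite -mulN1r; apply: idealM. Qed.
Lemma idealB a b : I a -> I b -> I (a - b).
Proof. by move=> Ia Ib; apply: idealD => //; apply: idealN. Qed.
Lemma idealMr a c : I a -> I (a * c).
Proof. by move=> Ia; rewrite mulrC; apply: idealM. Qed.
Lemma idealMn a n : I a -> I (a *+ n).
Proof. by move=> Ia; rewrite -mulr_natl; apply: idealM. Qed.
Lemma ideal_sum (T : Type) (r : seq T) (P : pred T) (F : T -> A) :
  (forall i, P i -> I (F i)) -> I (\sum_(i <- r | P i) F i).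
Proof. by move=> IF; apply: big_ind => //; [apply: ideal0|apply: idealD]. Qed.
End Ideals.

Lemma zero_ideal (A : comNzRingType) : is_ideal (fun a : A => a = 0).
Proof. by split=> [|a b -> ->|c a ->] //; rewrite ?addr0 ?mulr0. Qed.

(** This says that [A] is a Q-algebra. *)
Definition rational (A : comNzRingType) : Prop :=
  exists q : nat -> A, forall n, q n * n.+1%:R = 1.

Lemma rational_ideal (A : comNzRingType) (I : A -> Prop) n (a : A) :
  rational A -> is_ideal I -> I (a *+ n.+1) -> I a.
Proof.
move=> [q qE] idI /(idealM idI (q n)).
by rewrite -mulr_natl mulrA qE mul1r.
Qed.

Lemma rational_eq0 (A : comNzRingType) n (a : A) :
  rational A -> a *+ n.+1 = 0 -> a = 0.
Proof. by move=> ratA; apply: rational_ideal (@zero_ideal A). Qed.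

Section Order.
Variable A : comNzRingType.
Implicit Types (I : A -> Prop) (F G : series2 A).

(** Order of vanishing modulo [I]; with the zero ideal this is the usual order. *)
Definition ord_ge I s F := forall i j, (i + j < s)%N -> I (F i j).
Notation ord0_ge := (ord_ge (fun a => a = 0)).

Lemma ord_geW I s t F : (s <= t)%N -> ord_ge I t F -> ord_ge I s F.
Proof. by move=> lest oF i j ltij; apply: oF; lia. Qed.

Section Ideal.
Variable I : A -> Prop.
Hypothesis idI : is_ideal I.

Lemma ord_geD s F G : ord_ge I s F -> ord_ge I s G -> ord_ge I s (F + G).
Proof. by move=> oF oG i j ltij; apply: idealD => //; [apply: oF|apply: oG]. Qed.

Lemma ord_geM s t F G : ord_ge I s F -> ord0_ge t G -> ord_ge I (s + t) (F * G).
Proof.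
move=> oF oG i j ltij; rewrite s2M; apply: ideal_sum => // k _.
apply: ideal_sum => // l _; have [ltkl | lekl] := ltnP (k + l) s.
  by apply: idealMr => //; apply: oF.
rewrite oG ?mulr0; first exact: ideal0.
by have := ltn_ord k; have := ltn_ord l; lia.
Qed.

Lemma ord_ge_ddx s F : ord_ge I s F -> ord_ge I s.-1 (ddx F).
Proof. by move=> oF i j ltij; rewrite ddxE; apply: idealMn => //; apply: oF; lia. Qed.
Lemma ord_ge_ddy s F : ord_ge I s F -> ord_ge I s.-1 (ddy F).
Proof. by move=> oF i j ltij; rewrite ddyE; apply: idealMn => //; apply: oF; lia. Qed.
End Ideal.

Lemma xyX_coef m i j :
  ((xx A * yy A) ^+ m) i j = ((i == m) && (j == m))%:R.
Proof.
elim: m i j => [|m IHm] i j.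
  by rewrite expr0 ser1; case: eqP => _; rewrite ?mulr1n ?ser1.
rewrite exprS -mulrA xxM; case: i => // i; rewrite yyM; case: j => [|j].
  by rewrite andbF.
by rewrite IHm !eqSS.
Qed.

(** In [F = x y + O(3)] only the power of [x y] contributes to [F ^+ m] in degree
    at most [2 m]; this is the only information on the powers of the normalized
    series that the uniqueness proof uses. *)
Lemma starts_with_xy_pow F m i j : starts_with_xy F -> (i + j <= m.*2)%N ->
  (F ^+ m) i j = ((i == m) && (j == m))%:R.
Proof.
move=> xyF lij; have id0 := @zero_ideal A.
pose w := xx A * yy A.
have ow k : ord0_ge k.*2 (w ^+ k).
  move=> a b ltab; rewrite xyX_coef; case: eqP => //= ea; case: eqP => //= eb; lia.
have o1 : ord0_ge 3 (F - w).
  move=> a b ltab; rewrite s2B xyF // -[w]expr1 xyX_coef.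
  by rewrite subrr.
suff om : ord0_ge m.*2.+1 (F ^+ m - w ^+ m).
  have /eqP : (F ^+ m - w ^+ m) i j = 0 by apply: om; lia.
  by rewrite s2B subr_eq0 xyX_coef => /eqP.
elim: (m) => [|k IHk]; first by rewrite subrr => a b _.
have -> : F ^+ k.+1 - w ^+ k.+1 =
    ((F ^+ k - w ^+ k) * (F - w) + (F ^+ k - w ^+ k) * w) + (F - w) * w ^+ k.
  by rewrite !exprS; ring.
have ow1 : ord0_ge 2 w by rewrite -[w]expr1; apply: (ow 1%N).
apply: ord_geD => //; first apply: ord_geD => //.
- by apply: ord_geW (ord_geM id0 IHk o1); lia.
- by apply: ord_geW (ord_geM id0 IHk ow1); lia.
- by apply: ord_geW (ord_geM id0 o1 (ow k)); lia.
Qed.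

End Order.
Notation ord0_ge := (ord_ge (fun a => a = 0)).

(** * Uniqueness of the focus quantities modulo the preceding ones *)

Section Focus.
Variable A : comNzRingType.
Implicit Types (P Q F V Psi : series2 A) (g : nat -> A).

Definition is_focus P Q Psi g : Prop :=
  starts_with_xy Psi /\ lie P Q Psi = focus_series g.

Lemma is_focus_quantitiesE (P Q : {poly {poly A}}) Psi g :
  is_focus_quantities P Q Psi g ->
  is_focus (s2poly P) (s2poly Q) Psi g.
Proof.
move=> [xyPsi psiE]; split=> //; apply/funext => i; apply/funext => j.
have dxE : bips_dx Psi = ddx Psi.
  by apply/funext => k; apply/funext => l; rewrite ddxE.
by rewrite -psiE /bips_add !bips_mulE dxE.
Qed.

(** The linear part at the origin is diagonal with eigenvalues [1] and [-1]. *)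
Definition saddle P Q := ord0_ge 2 (P - xx A) /\ ord0_ge 2 (Q + yy A).

(** The quadratic and higher terms of the vector field raise the order, and its
    linear part multiplies [x^i y^j] by [i - j]. *)
Lemma lie_lead I P Q s F i j : is_ideal I -> saddle P Q -> ord_ge I s F ->
  (i + j <= s)%N -> I (lie P Q F i j - (F i j *+ i - F i j *+ j)).
Proof.
move=> idI [oP oQ] oF lij.
have -> : lie P Q F =
    (ddx F * (P - xx A) + ddy F * (Q + yy A)) + (xx A * ddx F - yy A * ddy F).
  by rewrite /lie; ring.
rewrite s2D s2B xxM yyM.
have -> : (if i is i'.+1 then ddx F i' j else 0) = F i j *+ i.
  by case: i lij => // i _; rewrite ddxE.
have -> : (if j is j'.+1 then ddy F i j' else 0) = F i j *+ j.
  by case: j lij => // j _; rewrite ddyE.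
rewrite addrK.
suff o : ord_ge I s.+1 (ddx F * (P - xx A) + ddy F * (Q + yy A)) by apply: o; lia.
apply: ord_geD => //.
  by apply: ord_geW (ord_geM idI (ord_ge_ddx idI oF) oP); lia.
by apply: ord_geW (ord_geM idI (ord_ge_ddy idI oF) oQ); lia.
Qed.

(** Let [U] start as [Psi' - Psi].  Its lowest homogeneous part is killed degree by
    degree, modulo [I]: the derivative multiplies the coefficient of [x^i y^j] by
    [i - j], so the coefficients with [i <> j] lie in [I], while the one of
    [(x y)^m] is removed by subtracting a multiple of [Psi ^+ m].  That
    subtraction does not affect the derivative in degree at most [2 k + 2],
    because the derivative of [Psi ^+ m] is [m Psi^(m-1)] times a series which
    modulo [I] begins with [g_kk (x y)^(k+1)].  Once [U] has order [2 k + 2], the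
    factor [i - j] vanishes at [(x y)^(k+1)], which leaves [g'_k - g_k] in [I].
    Only finitely many coefficients of the derivative of [Psi'] are prescribed,
    so that [Psi'] may be a polynomial known up to the degree in question. *)
Lemma focus_unique I P Q Psi g Psi' g' k :
  rational A -> saddle P Q -> is_ideal I -> (0 < k)%N ->
  is_focus P Q Psi g -> starts_with_xy Psi' ->
  (forall i j, (i + j <= k.*2.+2)%N -> lie P Q Psi' i j = focus_series g' i j) ->
  (forall j, (0 < j < k)%N -> I (g j)) ->
  I (g' k - g k).
Proof.
move=> ratA sPQ idI k_gt0 [xyPsi psiE] xyPsi' psiE' Ig.
pose dg i j := focus_series g' i j - focus_series g i j.
suff [U oU dU] : exists2 U, ord_ge I k.*2.+2 U &
    forall i j, (i + j <= k.*2.+2)%N -> I (lie P Q U i j - dg i j).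
  have lk : (k.+1 + k.+1 <= k.*2.+2)%N by lia.
  have := idealB idI (lie_lead idI sPQ oU lk) (dU _ _ lk).
  rewrite subrr subr0 opprB addrC subrK /dg /focus_series eqxx /=.
  by rewrite ltnS k_gt0.
have Ifs : ord_ge I k.*2.+2 (focus_series g).
  move=> i j ltij; rewrite /focus_series; case: eqP => [eij|_] /=; last exact: ideal0.
  by case: ifP => lei; [apply: Ig; lia | apply: ideal0].
have rec s : (3 <= s <= k.*2.+2)%N -> exists2 U, ord_ge I s U &
    forall i j, (i + j <= k.*2.+2)%N -> I (lie P Q U i j - dg i j).
  elim: s => // s IHs /andP[les sk].
  have [lts|] := leqP 3 s; last first.
    move=> lts; exists (Psi' - Psi).
      move=> i j ltij; rewrite s2B xyPsi ?xyPsi' ?subrr; try lia.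
      exact: ideal0.
    move=> i j lij; rewrite raddfB /= s2B psiE psiE' // subrr; exact: ideal0.
  have [|U oU dU] := IHs; first by rewrite lts ltnW.
  have offdiag i j : (i + j)%N = s -> i != j -> I (U i j).
    move=> eij neij; have lij : (i + j <= k.*2.+2)%N by lia.
    have := idealB idI (dU _ _ lij) (lie_lead idI sPQ oU (eq_leq eij)).
    have -> : dg i j = 0 by rewrite /dg /focus_series (negPf neij) subrr.
    rewrite subr0 opprB addrC subrK.
    have [ltij|ltij|eq_ij] := ltngtP i j; last by rewrite eq_ij eqxx in neij.
      rewrite -opprB -mulrnBr ?(ltnW ltij) // => /(idealN idI); rewrite opprK.
      have -> : (j - i = (j - i).-1.+1)%N by lia.
      exact: rational_ideal.
    rewrite -mulrnBr ?(ltnW ltij) //; have -> : (i - j = (i - j).-1.+1)%N by lia.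
    exact: rational_ideal.
  have [odds|evs] := boolP (odd s).
    exists U => // i j; rewrite ltnS leq_eqVlt => /orP[/eqP eij|]; last exact: oU.
    apply: offdiag => //; apply/eqP => e.
    by move: odds; rewrite -eij e addnn odd_double.
  pose m := s./2; exists (U - cst (U m m) * Psi ^+ m); last first.
    move=> i j lij; rewrite raddfB /= s2B lie_cstM cstM addrAC.
    apply: idealB => //; first exact: dU.
    apply: idealM => //; have -> : m = m.-2.+2 by rewrite /m; lia.
    rewrite lieX psiE.
    have -> : (Psi ^+ m.-2.+1 * (focus_series g : series2 A)) *+ m.-2.+2 =
        (focus_series g : series2 A) * (Psi ^+ m.-2.+1 * m.-2.+2%:R).
      by rewrite mulr_natr mulrnAr [Psi ^+ _ * _]mulrC.
    suff o : ord_ge I k.*2.+3 ((focus_series g : series2 A) * (Psi ^+ m.-2.+1 * m.-2.+2%:R)).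
      by apply: o; lia.
    rewrite -addn1; apply: ord_geM => // -[|[]] [|[]] // _.
    rewrite -[m.-2.+2%:R](rmorph_nat (cst (A:=A))) mulrC cstM.
    by rewrite starts_with_xy_pow //= mulr0.
  move=> i j; rewrite ltnS leq_eqVlt => /orP[/eqP eij|ltij]; last first.
    rewrite s2B cstM starts_with_xy_pow //; last by rewrite /m; lia.
    apply: idealB => //; first exact: oU.
    apply: idealM => //; case: eqP => [ei|_] /=; last exact: ideal0.
    by case: eqP => [ej|_]; [lia | apply: ideal0].
  rewrite s2B cstM starts_with_xy_pow //; last by rewrite /m; lia.
  have [ij|neij] := eqVneq i j.
    have -> : i = m by rewrite /m; lia.
    have -> : j = m by rewrite /m; lia.
    by rewrite eqxx mulr1 subrr; apply: ideal0.
  have -> : (i == m) && (j == m) = false.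
    by apply/andP => -[/eqP ei /eqP ej]; rewrite ei ej eqxx in neij.
  by rewrite mulr0 subr0; apply: offdiag.
by apply: rec; lia.
Qed.

(** * Sufficient conditions for a center *)

(** The reciprocal [M] of [V], normalized at the origin, is an integrating factor:
    [(M P, M Q)] is divergence free, hence is the Hamiltonian field of some [H],
    which begins with [x y].  As [H] is a first integral, comparing it with [Psi]
    gives the vanishing of all focus quantities by induction. *)
Lemma center_of_inverse_integrating_factor P Q V Psi g (u : A) k :
  rational A -> saddle P Q -> is_focus P Q Psi g ->
  coef00 V * u = 1 -> lie P Q V = (ddx P + ddy Q) * V ->
  (0 < k)%N -> g k = 0.
Proof.
move=> ratA sPQ fPsi Vu divV k_gt0; have [q qE] := ratA.
have [M0 VM0] := s2_inv Vu; pose M := cst (V 0%N 0%N) * M0.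
have VM : V * M = cst (V 0%N 0%N) by rewrite mulrCA VM0 mulr1.
have M1 : M 0%N 0%N = 1.
  have : (V * M) 0%N 0%N = V 0%N 0%N by rewrite VM.
  rewrite s2M !big_ord_recl !big_ord0 !addr0 subnn => e.
  by rewrite -[RHS]Vu /coef00 -{1}e mulrAC [_ * u]Vu mul1r.
have lieM0 : lie P Q M + (ddx P + ddy Q) * M = 0.
  have := congr1 (fun F => lie P Q F * M) VM.
  rewrite lie_cst mul0r lieM divV.
  have -> : ((ddx P + ddy Q) * V * M + V * lie P Q M) * M =
    (V * M) * (lie P Q M + (ddx P + ddy Q) * M) by ring.
  rewrite VM => /(congr1 ( *%R (cst u))); rewrite mulr0 mulrA -rmorphM mulrC.
  by rewrite [u * _]mulrC Vu rmorph1 mulr1.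
have curl : ddy (M * Q) = - ddx (M * P).
  apply/eqP; rewrite -addr_eq0 -lieM0 ddyM ddxM /lie; apply/eqP; ring.
have [P00 P01 P10] : [/\ P 0%N 0%N = 0, P 0%N 1%N = 0 & P 1%N 0%N = 1].
  have [oP _] := sPQ; have c i j (lt : (i + j < 2)%N) := subr0_eq (oP i j lt).
  by rewrite !c /xx /ser_X //= ser1.
have [Q00 Q01 Q10] : [/\ Q 0%N 0%N = 0, Q 0%N 1%N = -1 & Q 1%N 0%N = 0].
  have [_ oQ] := sPQ; have c i j (lt : (i + j < 2)%N) := addr0_eq (oQ i j lt).
  by split; apply: oppr_inj; rewrite c // ?opprK /yy /= ?oppr0.
(* The primitive of - M Q dx + M P dy, integrated along the y-axis and then
   parallel to the x-axis. *)
pose H : series2 A := fun i j =>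
  if i is i'.+1 then - q i' * (M * Q) i' j
  else if j is j'.+1 then q j' * (M * P) 0%N j' else 0.
have HQ : ddx H = - (M * Q).
  apply/funext => i; apply/funext => j; rewrite ddxE /= s2N.
  by rewrite -mulr_natr mulNr mulNr mulrAC qE mul1r.
have HP : ddy H = M * P.
  apply/funext => -[|i]; apply/funext => j; rewrite ddyE /=.
    by rewrite -mulr_natr mulrAC qE mul1r.
  have := congr1 (fun F : series2 A => q i * F i j) curl.
  rewrite s2N ddyE ddxE -[_ *+ i.+1]mulr_natl mulrN mulrA qE mul1r => /eqP.
  by rewrite -eqr_oppLR => /eqP <-; rewrite mulNr mulrnAr mulNrn.
have MP0 : (M * P) 0%N 0%N = 0 by rewrite s2M !big_ord_recl !big_ord0 /= P00 mulr0 !addr0.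
have MQ0 : (M * Q) 0%N 0%N = 0 by rewrite s2M !big_ord_recl !big_ord0 /= Q00 mulr0 !addr0.
have MP1 : (M * P) 0%N 1%N = 0.
  by rewrite s2M !big_ord_recl !big_ord0 /= P00 P01 !mulr0 !addr0.
have MQ1 : (M * Q) 0%N 1%N = -1.
  by rewrite s2M !big_ord_recl !big_ord0 /= Q00 Q01 M1 mul1r !mulr0 !addr0.
have MQ2 : (M * Q) 1%N 0%N = 0.
  by rewrite s2M !big_ord_recl !big_ord0 /= Q00 Q10 !mulr0 !addr0.
have q0 : q 0%N = 1 by have := qE 0%N; rewrite mulr1.
have xyH : starts_with_xy H.
  by move=> [|[|[|i]]] [|[|[|j]]] //= _; rewrite ?MP0 ?MQ0 ?MP1 ?MQ1 ?MQ2 ?mulr0 //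
    q0 mulN1r opprK.
have lieH : lie P Q H = 0 by rewrite /lie HQ HP; ring.
elim/ltn_ind: k k_gt0 => k IHk k_gt0.
have lieH0 i j : (i + j <= k.*2.+2)%N -> lie P Q H i j = focus_series (fun=> 0) i j.
  by rewrite lieH /focus_series if_same.
have /eqP := focus_unique ratA sPQ (@zero_ideal A) k_gt0 fPsi xyH lieH0
  (fun j lt => IHk j (proj2 (andP lt)) (proj1 (andP lt))).
by rewrite sub0r oppr_eq0 => /eqP.
Qed.
End Focus.

Section Reversible.
Variables (A : comNzRingType) (gam del : A).
Hypothesis gam_del : gam * del = 1.

(** The substitution [x -> gam y, y -> del x]. *)
Definition s2swap (F : series2 A) : series2 A :=
  fun i j => F j i * (gam ^+ j * del ^+ i).

Fact s2swap_is_zmod_morphism : zmod_morphism s2swap.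
Proof.
by move=> F G; apply/funext => i; apply/funext => j; rewrite /s2swap !s2B mulrBl.
Qed.
Fact s2swap_is_monoid_morphism : monoid_morphism s2swap.
Proof.
split=> [|F G]; apply/funext => i; apply/funext => j.
  rewrite /s2swap !ser1.
  case: i j => [|i] [|j]; rewrite ?ser1 ?mul0r ?mul1r ?expr0 ?mulr1 ?mulr1n ?ser1 //.
rewrite /s2swap !s2M exchange_big /= mulr_suml; apply: eq_bigr => k _.
rewrite mulr_suml; apply: eq_bigr => l _.
have -> : gam ^+ j = gam ^+ l * gam ^+ (j - l) by rewrite -exprD subnKC //; have := ltn_ord l; lia.
have -> : del ^+ i = del ^+ k * del ^+ (i - k) by rewrite -exprD subnKC //; have := ltn_ord k; lia.
by ring.
Qed.
HB.instance Definition _ :=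
  GRing.isZmodMorphism.Build (series2 A) (series2 A) s2swap s2swap_is_zmod_morphism.
HB.instance Definition _ := GRing.isMonoidMorphism.Build (series2 A) (series2 A)
  s2swap s2swap_is_monoid_morphism.

Lemma s2swapN F : s2swap (- F) = - s2swap F. Proof. exact: rmorphN. Qed.
Lemma s2swapD F G : s2swap (F + G) = s2swap F + s2swap G.
Proof. exact: rmorphD. Qed.
Lemma s2swapM F G : s2swap (F * G) = s2swap F * s2swap G.
Proof. exact: rmorphM. Qed.
Lemma s2swapXn F n : s2swap (F ^+ n) = s2swap F ^+ n.
Proof. exact: rmorphXn. Qed.
Lemma s2swap_cst a : s2swap (cst a) = cst a.
Proof.
apply/funext => i; apply/funext => j; rewrite /s2swap /cst.
by case: i j => [|i] [|j]; rewrite /= ?mul0r ?mulr1.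
Qed.
Lemma s2swap_xx : s2swap (xx A) = cst gam * yy A.
Proof.
apply/funext => i; apply/funext => j; rewrite /s2swap cstM /xx /yy /= /ser_X.
by case: i j => [|i] [|[|j]]; rewrite /= ?ser1 ?mul0r ?mulr0 ?mul1r ?mulr1.
Qed.
Lemma s2swap_yy : s2swap (yy A) = cst del * xx A.
Proof.
apply/funext => i; apply/funext => j; rewrite /s2swap cstM /xx /yy /= /ser_X.
by case: j i => [|j] [|[|i]]; rewrite /= ?ser1 ?mul0r ?mulr0 ?mul1r ?mulr1.
Qed.
Definition s2swapE := (s2swapN, s2swapD, s2swapM, s2swapXn, s2swap_cst,
  s2swap_xx, s2swap_yy).
Lemma ddx_s2swap F : ddx (s2swap F) = cst del * s2swap (ddy F).
Proof.
apply/funext => i; apply/funext => j; rewrite cstM ddxE /s2swap ddyE.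
by rewrite mulrnAl mulrnAr exprS; congr (_ *+ _); ring.
Qed.
Lemma ddy_s2swap F : ddy (s2swap F) = cst gam * s2swap (ddx F).
Proof.
apply/funext => i; apply/funext => j; rewrite cstM ddyE /s2swap ddxE.
by rewrite mulrnAl mulrnAr exprS; congr (_ *+ _); ring.
Qed.

(** The hypotheses say that the involution [x -> gam y, y -> del x] reverses time.
    The image of [Psi] under it is again normalized, and its derivative is the
    focus series of [- g]; so by uniqueness [2 g_k] vanishes when the preceding
    focus quantities do. *)
Lemma center_of_reversible P Q Psi g k : rational A -> saddle P Q ->
  is_focus P Q Psi g -> s2swap P = - cst gam * Q -> s2swap Q = - cst del * P ->
  (0 < k)%N -> g k = 0.
Proof.
move=> ratA sPQ fPsi swP swQ; have [xyPsi psiE] := fPsi.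
have xyS : starts_with_xy (s2swap Psi).
  move=> i j ltij; rewrite /s2swap xyPsi 1?addnC // andbC.
  by case: eqP => [->|_]; case: eqP => [->|_]; rewrite /= ?mul0r // mul1r gam_del.
have lieS : lie P Q (s2swap Psi) = focus_series (fun k => - g k).
  have -> : lie P Q (s2swap Psi) = - s2swap (lie P Q Psi).
    by rewrite /lie ddx_s2swap ddy_s2swap rmorphD !rmorphM /= swP swQ; ring.
  apply/funext => i; apply/funext => j; rewrite psiE s2N /s2swap /focus_series.
  rewrite eq_sym; case: eqP => [->|_] /=; last by rewrite mul0r oppr0.
  by rewrite -exprMn gam_del expr1n mulr1; case: ifP => // _; rewrite oppr0.
elim/ltn_ind: k => k IHk k_gt0.
have lieS0 i j : (i + j <= k.*2.+2)%N ->
    lie P Q (s2swap Psi) i j = focus_series (fun k => - g k) i j by rewrite lieS.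
have /eqP := focus_unique ratA sPQ (@zero_ideal A) k_gt0 fPsi xyS lieS0
  (fun j lt => IHk j (proj2 (andP lt)) (proj1 (andP lt))).
rewrite -opprD oppr_eq0 -mulr2n => /eqP.
exact: rational_eq0.
Qed.
End Reversible.

Opaque ser_add ser_opp ser_mul ser_cst cst xx yy ddx ddy coef00.

(** * The quadratic and cubic systems *)

Section Systems.
Variable A : comNzRingType.
Notation x := (xx A).
Notation y := (yy A).

Definition quadP (a10 a01 am12 : A) : series2 A :=
  x - cst a10 * x ^+ 2 - cst a01 * x * y - cst am12 * y ^+ 2.
Definition quadQ (b2m1 b10 b01 : A) : series2 A :=
  - (y - cst b10 * x * y - cst b01 * y ^+ 2 - cst b2m1 * x ^+ 2).
Definition cubP (a20 a11 a02 am13 : A) : series2 A :=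
  x - cst a20 * x ^+ 3 - cst a11 * x ^+ 2 * y - cst a02 * x * y ^+ 2
  - cst am13 * y ^+ 3.
Definition cubQ (b3m1 b20 b11 b02 : A) : series2 A :=
  - (y - cst b02 * y ^+ 3 - cst b11 * x * y ^+ 2 - cst b20 * x ^+ 2 * y
     - cst b3m1 * x ^+ 3).

Lemma s2poly_quad_x a10 a01 am12 :
  s2poly (quad_x a10 a01 am12) = quadP a10 a01 am12.
Proof. by rewrite /quad_x !s2polyE. Qed.
Lemma s2poly_quad_y b2m1 b10 b01 :
  s2poly (quad_y b2m1 b10 b01) = quadQ b2m1 b10 b01.
Proof. by rewrite /quad_y !s2polyE. Qed.
Lemma s2poly_cub_x a20 a11 a02 am13 :
  s2poly (cub_x a20 a11 a02 am13) = cubP a20 a11 a02 am13.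
Proof. by rewrite /cub_x !s2polyE. Qed.
Lemma s2poly_cub_y b3m1 b20 b11 b02 :
  s2poly (cub_y b3m1 b20 b11 b02) = cubQ b3m1 b20 b11 b02.
Proof. by rewrite /cub_y !s2polyE. Qed.

Lemma saddle_of_rest (P Q P1 P2 P3 Q1 Q2 Q3 : series2 A) :
  P = x + (x * x * P1 + x * y * P2 + y * y * P3) ->
  Q = - y + (x * x * Q1 + x * y * Q2 + y * y * Q3) -> saddle P Q.
Proof.
move=> -> ->; rewrite /saddle [x + _]addrC addrK [- y + _]addrC subrK.
have o F G H : ord0_ge 2 (x * x * F + x * y * G + y * y * H).
  move=> i j ltij; rewrite !s2D -!mulrA !xxM !yyM.
  by case: i j ltij => [|[|i]] [|[|j]] ltij; rewrite ?xxM ?yyM ?addr0 //; lia.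
by [].
Qed.

Lemma saddle_quad a10 a01 am12 b2m1 b10 b01 :
  saddle (quadP a10 a01 am12) (quadQ b2m1 b10 b01).
Proof.
apply: (@saddle_of_rest _ _ (- cst a10) (- cst a01) (- cst am12)
  (cst b2m1) (cst b10) (cst b01)); rewrite /quadP /quadQ; ring.
Qed.
Lemma saddle_cub a20 a11 a02 am13 b3m1 b20 b11 b02 :
  saddle (cubP a20 a11 a02 am13) (cubQ b3m1 b20 b11 b02).
Proof.
apply: (@saddle_of_rest _ _ (- cst a20 * x) (- cst a11 * x - cst a02 * y)
  (- cst am13 * y) (cst b3m1 * x) (cst b20 * x + cst b11 * y) (cst b02 * y));
  rewrite /cubP /cubQ; ring.
Qed.
End Systems.

Section Centers.
Variable A : comNzRingType.
Hypothesis ratA : rational A.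
Notation x := (xx A).
Notation y := (yy A).
Variables (Psi : series2 A) (g : nat -> A) (k : nat).
Hypothesis k_gt0 : (0 < k)%N.

Lemma quad_reversible_center a10 a01 am12 gam del : gam * del = 1 ->
  is_focus (quadP a10 a01 am12)
    (quadQ (am12 * del ^+ 3) (a01 * del) (a10 * gam)) Psi g ->
  g k = 0.
Proof.
move=> gd fPsi; have gd' : cst gam * cst del = 1 by rewrite -rmorphM gd rmorph1.
apply: (center_of_reversible gd ratA (saddle_quad _ _ _ _ _ _) fPsi) => //;
  rewrite /quadP /quadQ !s2swapE !cstE.
all: ring: gd'.
Qed.

Lemma cub_reversible_center a20 a11 a02 am13 gam del : gam * del = 1 ->
  is_focus (cubP a20 a11 a02 am13)
    (cubQ (am13 * del ^+ 4) (a02 * del ^+ 2) a11 (a20 * gam ^+ 2)) Psi g ->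
  g k = 0.
Proof.
move=> gd fPsi; have gd' : cst gam * cst del = 1 by rewrite -rmorphM gd rmorph1.
apply: (center_of_reversible gd ratA (saddle_cub _ _ _ _ _ _ _ _) fPsi) => //;
  rewrite /cubP /cubQ !s2swapE !cstE.
all: ring: gd'.
Qed.

Lemma quad_div a10 a01 am12 b2m1 b10 b01 :
  ddx (quadP a10 a01 am12) + ddy (quadQ b2m1 b10 b01) =
  (cst b10 - 2%:R * cst a10) * x + (2%:R * cst b01 - cst a01) * y.
Proof. rewrite /quadP /quadQ !expr2 !ddE; ring. Qed.

Lemma cub_div a20 a11 a02 am13 b3m1 b20 b11 b02 :
  ddx (cubP a20 a11 a02 am13) + ddy (cubQ b3m1 b20 b11 b02) =
  (cst b20 - 3%:R * cst a20) * x ^+ 2 + 2%:R * (cst b11 - cst a11) * x * y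
  + (3%:R * cst b02 - cst a02) * y ^+ 2.
Proof. rewrite /cubP /cubQ !exprS !expr0 !mulr1 !ddE; ring. Qed.

(** The divergence is zero, and [V = 1] is an inverse integrating factor. *)
Lemma quad_hamiltonian_center a10 b01 X Y :
  is_focus (quadP a10 (2%:R * b01) X) (quadQ Y (2%:R * a10) b01) Psi g -> g k = 0.
Proof.
move=> fPsi.
apply: (center_of_inverse_integrating_factor (V := 1) (u := 1)
  ratA (saddle_quad _ _ _ _ _ _) fPsi) => //; first by rewrite mulr1 coef00_1.
rewrite lie1 mulr1 quad_div !cstE; ring.
Qed.

Lemma cub_hamiltonian_center a20 b02 c X Y :
  is_focus (cubP a20 c (3%:R * b02) X) (cubQ Y (3%:R * a20) c b02) Psi g -> g k = 0.
Proof.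
move=> fPsi.
apply: (center_of_inverse_integrating_factor (V := 1) (u := 1)
  ratA (saddle_cub _ _ _ _ _ _ _ _) fPsi) => //; first by rewrite mulr1 coef00_1.
rewrite lie1 mulr1 cub_div !cstE; ring.
Qed.

Section PlaneCurves.
Variables p q X Y : series2 A.

(** Five invariant algebraic curves of the families of centers below.  They
    solve, in the given degree, the linear equations expressing that the cofactor is a given multiple of the linear form [p x - q y] (of
    [p x^2 - q y^2] for the last two), the multiples being such that the cofactors
    of a family add up to the divergence.  For [X = Y = 0] the cubic
    [lotka_cubic] is the product of the lines [1 - p x], [1 - q y] and
    [1 - p x - q y]. *)
Definition lotka_cubic : series2 A :=
  1 - 2%:R * q * y - 2%:R * p * x
  + (q ^+ 2 + p * X) * y ^+ 2 + 3%:R * (p * q - X * Y) * x * y + (q * Y + p ^+ 2) * x ^+ 2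
  + (X ^+ 2 * Y - p * q * X) * y ^+ 3 + (q * X * Y - p * q ^+ 2) * x * y ^+ 2
  + (p * X * Y - p ^+ 2 * q) * x ^+ 2 * y
  + (X * Y ^+ 2 - p * q * Y) * x ^+ 3.
Definition zariski_conic : series2 A :=
  1 + 2%:R * q * y + 2%:R * p * x
  - p * X * y ^+ 2 + 2%:R * p * q * x * y - q * Y * x ^+ 2.
Definition zariski_cubic : series2 A :=
  - (2%:R * p * q) - 6%:R * p * q ^+ 2 * y - 6%:R * p ^+ 2 * q * x
  + 3%:R * (p ^+ 2 * q * X - p * q ^+ 3) * y ^+ 2
  + 3%:R * (q ^+ 3 * Y - 2%:R * p ^+ 2 * q ^+ 2 + p ^+ 3 * X) * x * y
  + 3%:R * (p * q ^+ 2 * Y - p ^+ 3 * q) * x ^+ 2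
  + (p ^+ 2 * q ^+ 2 * X - p ^+ 3 * X ^+ 2) * y ^+ 3
  + 3%:R * (p ^+ 3 * q * X - p ^+ 2 * q ^+ 3) * x * y ^+ 2
  + 3%:R * (p * q ^+ 3 * Y - p ^+ 3 * q ^+ 2) * x ^+ 2 * y
  + (p ^+ 2 * q ^+ 2 * Y - q ^+ 3 * Y ^+ 2) * x ^+ 3.
Definition darboux_quartic : series2 A :=
  4%:R * p * q + 8%:R * p * q ^+ 2 * y ^+ 2 - 4%:R * (p ^+ 2 * X + q ^+ 2 * Y) * x * y
  + 8%:R * p ^+ 2 * q * x ^+ 2 + p ^+ 2 * X ^+ 2 * y ^+ 4
  - 8%:R * p ^+ 2 * q * X * x * y ^+ 3
  + 24%:R * p ^+ 2 * q ^+ 2 * x ^+ 2 * y ^+ 2 - 8%:R * p * q ^+ 2 * Y * x ^+ 3 * y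
  + q ^+ 2 * Y ^+ 2 * x ^+ 4.
Definition darboux_sextic : series2 A :=
  2%:R * (q ^+ 2 * Y + p ^+ 2 * X)
  + 6%:R * (q ^+ 3 * Y + p ^+ 2 * q * X) * y ^+ 2
  - 48%:R * p ^+ 2 * q ^+ 2 * x * y
  + 6%:R * (p * q ^+ 2 * Y + p ^+ 3 * X) * x ^+ 2
  + 12%:R * p ^+ 2 * q ^+ 2 * X * y ^+ 4
  - 6%:R * (p ^+ 3 * X ^+ 2 + 12%:R * p ^+ 2 * q ^+ 3) * x * y ^+ 3
  + 36%:R * (p * q ^+ 3 * Y + p ^+ 3 * q * X) * x ^+ 2 * y ^+ 2
  - 6%:R * (12%:R * p ^+ 3 * q ^+ 2 + q ^+ 3 * Y ^+ 2) * x ^+ 3 * y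
  + 12%:R * p ^+ 2 * q ^+ 2 * Y * x ^+ 4
  + p ^+ 3 * X ^+ 3 * y ^+ 6 - 12%:R * p ^+ 3 * q * X ^+ 2 * x * y ^+ 5
  + 60%:R * p ^+ 3 * q ^+ 2 * X * x ^+ 2 * y ^+ 4
  - 160%:R * p ^+ 3 * q ^+ 3 * x ^+ 3 * y ^+ 3
  + 60%:R * p ^+ 2 * q ^+ 3 * Y * x ^+ 4 * y ^+ 2
  - 12%:R * p * q ^+ 3 * Y ^+ 2 * x ^+ 5 * y
  + q ^+ 3 * Y ^+ 3 * x ^+ 6.
End PlaneCurves.

Section InvariantCurves.
Variables p q X Y : A.
Notation of_coefs V := (V (cst p) (cst q) (cst X) (cst Y)).

Lemma lotka_cubic00 : coef00 (of_coefs lotka_cubic) = 1.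
Proof. by rewrite /lotka_cubic !coef00E; ring. Qed.
Lemma zariski_conic00 : coef00 (of_coefs zariski_conic) = 1.
Proof. by rewrite /zariski_conic !coef00E; ring. Qed.
Lemma zariski_cubic00 : coef00 (of_coefs zariski_cubic) = - 2%:R * p * q.
Proof. by rewrite /zariski_cubic !coef00E; ring. Qed.
Lemma darboux_quartic00 : coef00 (of_coefs darboux_quartic) = 4%:R * p * q.
Proof. by rewrite /darboux_quartic !coef00E; ring. Qed.
Lemma darboux_sextic00 :
  coef00 (of_coefs darboux_sextic) = 2%:R * (p ^+ 2 * X + q ^+ 2 * Y).
Proof. by rewrite /darboux_sextic !coef00E; ring. Qed.

Lemma lie_lotka_cubic : lie (quadP p 0 X) (quadQ Y 0 q) (of_coefs lotka_cubic) =
  (2%:R * cst q * y - 2%:R * cst p * x) * of_coefs lotka_cubic.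
Proof. by rewrite /lotka_cubic !lieE /quadP /quadQ !cst_0; ring. Qed.

Lemma lie_zariski_conic : X * Y = p * q ->
  lie (quadP (- 2%:R * p) q X) (quadQ Y p (- 2%:R * q)) (of_coefs zariski_conic) =
  2%:R * (cst p * x - cst q * y) * of_coefs zariski_conic.
Proof.
move=> XY; have XY' : cst X * cst Y = cst p * cst q by rewrite -!cst_M XY.
rewrite /zariski_conic !lieE /quadP /quadQ !cstE; ring: XY'.
Qed.

Lemma lie_zariski_cubic : X * Y = p * q ->
  lie (quadP (- 2%:R * p) q X) (quadQ Y p (- 2%:R * q)) (of_coefs zariski_cubic) =
  3%:R * (cst p * x - cst q * y) * of_coefs zariski_cubic.
Proof.
move=> XY; have XY' : cst X * cst Y = cst p * cst q by rewrite -!cst_M XY.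
rewrite /zariski_cubic !lieE /quadP /quadQ !cstE; ring: XY'.
Qed.

Lemma lie_darboux_quartic : X * Y = 4%:R * p * q ->
  lie (cubP (- 3%:R * p) 0 q X) (cubQ Y p 0 (- 3%:R * q)) (of_coefs darboux_quartic) =
  4%:R * (cst p * x ^+ 2 - cst q * y ^+ 2) * of_coefs darboux_quartic.
Proof.
move=> XY; have XY' : cst X * cst Y = 4%:R * cst p * cst q by rewrite -!cstE XY.
rewrite /darboux_quartic !lieE /cubP /cubQ !cstE !cst_0; ring: XY'.
Qed.

Lemma lie_darboux_sextic : X * Y = 4%:R * p * q ->
  lie (cubP (- 3%:R * p) 0 q X) (cubQ Y p 0 (- 3%:R * q)) (of_coefs darboux_sextic) =
  6%:R * (cst p * x ^+ 2 - cst q * y ^+ 2) * of_coefs darboux_sextic.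
Proof.
move=> XY; have XY' : cst X * cst Y = 4%:R * cst p * cst q by rewrite -!cstE XY.
rewrite /darboux_sextic !lieE /cubP /cubQ !cstE !cst_0; ring: XY'.
Qed.
End InvariantCurves.
Opaque lotka_cubic zariski_conic zariski_cubic darboux_quartic darboux_sextic.

Lemma quad_lotka_volterra_center p q X Y :
  is_focus (quadP p 0 X) (quadQ Y 0 q) Psi g -> g k = 0.
Proof.
move=> fPsi; apply: (center_of_inverse_integrating_factor
  (V := lotka_cubic (cst p) (cst q) (cst X) (cst Y)) (u := 1)
  ratA (saddle_quad _ _ _ _ _ _) fPsi) => //.
  by rewrite mulr1 lotka_cubic00.
by rewrite quad_div lie_lotka_cubic !cst_0; ring.
Qed.

(** The conic and the cubic have cofactors [2 t] and [3 t] with [t = p x - q y],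
    and the divergence is [5 t].  The hypothesis on [u] ensures that the product
    of the curves does not pass through the origin. *)
Lemma quad_zariski_center p q X Y u : X * Y = p * q -> - 2%:R * p * q * u = 1 ->
  is_focus (quadP (- 2%:R * p) q X) (quadQ Y p (- 2%:R * q)) Psi g -> g k = 0.
Proof.
move=> XY const fPsi; apply: (center_of_inverse_integrating_factor
  (V := zariski_conic (cst p) (cst q) (cst X) (cst Y)
        * zariski_cubic (cst p) (cst q) (cst X) (cst Y)) (u := u)
  ratA (saddle_quad _ _ _ _ _ _) fPsi) => //.
  by rewrite coef00M zariski_conic00 zariski_cubic00 mul1r const.
rewrite quad_div lieM lie_zariski_conic // lie_zariski_cubic // !cstE; ring.
Qed.

(** The quartic and the sextic have cofactors [4 t] and [6 t] with
    [t = p x^2 - q y^2], and the divergence is [10 t]. *)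
Lemma cub_darboux_center p q X Y u : X * Y = 4%:R * p * q ->
  4%:R * p * q * (2%:R * (p ^+ 2 * X + q ^+ 2 * Y)) * u = 1 ->
  is_focus (cubP (- 3%:R * p) 0 q X) (cubQ Y p 0 (- 3%:R * q)) Psi g -> g k = 0.
Proof.
move=> XY const fPsi; apply: (center_of_inverse_integrating_factor
  (V := darboux_quartic (cst p) (cst q) (cst X) (cst Y)
        * darboux_sextic (cst p) (cst q) (cst X) (cst Y)) (u := u)
  ratA (saddle_cub _ _ _ _ _ _ _ _) fPsi) => //.
  by rewrite coef00M darboux_quartic00 darboux_sextic00 const.
rewrite cub_div lieM lie_darboux_quartic // lie_darboux_sextic // !cstE !cst_0; ring.
Qed.
End Centers.

(** * Monomial maps *)

Section Substitution.
Variables (F : fieldType).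

Definition psub n k (v : 'I_n -> {mpoly F[k]}) (p : {mpoly F[n]}) : {mpoly F[k]} :=
  mmap (@mpolyC k F) v p.
Fact psub_is_zmod_morphism n k v : zmod_morphism (@psub n k v).
Proof. exact: mmap_is_additive. Qed.
Fact psub_is_multiplicative n k v : multiplicative (@psub n k v).
Proof. exact: mmap_is_multiplicative. Qed.
HB.instance Definition _ n k v := GRing.isZmodMorphism.Build _ _ (@psub n k v)
  (@psub_is_zmod_morphism n k v).
HB.instance Definition _ n k v := GRing.isMultiplicative.Build _ _ (@psub n k v)
  (@psub_is_multiplicative n k v).

Lemma psubXU n k (v : 'I_n -> {mpoly F[k]}) i : psub v 'X_i = v i.
Proof. by rewrite /psub mmapX mmap1U. Qed.
Lemma psubC n k (v : 'I_n -> {mpoly F[k]}) c : psub v c%:MP = c%:MP.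
Proof. by rewrite /psub mmapC. Qed.
Lemma psubZ n k (v : 'I_n -> {mpoly F[k]}) c p : psub v (c *: p) = c *: psub v p.
Proof. by rewrite /psub mmapZ mul_mpolyC. Qed.
Lemma psubD n k (v : 'I_n -> {mpoly F[k]}) p q : psub v (p + q) = psub v p + psub v q.
Proof. exact: rmorphD. Qed.
Lemma psubN n k (v : 'I_n -> {mpoly F[k]}) p : psub v (- p) = - psub v p.
Proof. exact: rmorphN. Qed.
Lemma psubM n k (v : 'I_n -> {mpoly F[k]}) p q : psub v (p * q) = psub v p * psub v q.
Proof. exact: rmorphM. Qed.
Lemma psubXn n k (v : 'I_n -> {mpoly F[k]}) p d : psub v (p ^+ d) = psub v p ^+ d.
Proof. exact: rmorphXn. Qed.
Lemma psub0 n k (v : 'I_n -> {mpoly F[k]}) : psub v 0 = 0.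
Proof. exact: rmorph0. Qed.
Lemma psub1 n k (v : 'I_n -> {mpoly F[k]}) : psub v 1 = 1.
Proof. exact: rmorph1. Qed.
Lemma psub_nat n k (v : 'I_n -> {mpoly F[k]}) d : psub v d%:R = d%:R.
Proof. exact: rmorph_nat. Qed.
Definition psubE := (psubXU, psubC, psubD, psubN, psubM, psubXn, psub0, psub1, psub_nat).

Lemma psubX n k (v : 'I_n -> {mpoly F[k]}) m :
  psub v 'X_[m] = \prod_(i < n) v i ^+ m i.
Proof. by rewrite /psub mmapX. Qed.

(** Substitution is polynomial, so it is compatible with congruence modulo an
    ideal. *)
Lemma psub_congr n k (I : {mpoly F[k]} -> Prop) (v w : 'I_n -> {mpoly F[k]}) p :
  is_ideal I -> (forall i, I (v i - w i)) -> I (psub v p - psub w p).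
Proof.
move=> idI vw.
have congM a b c d : I (a - b) -> I (c - d) -> I (a * c - b * d).
  move=> Iab Icd; have -> : a * c - b * d = c * (a - b) + b * (c - d) by ring.
  by apply: idealD => //; apply: idealM.
have congX a b d : I (a - b) -> I (a ^+ d - b ^+ d).
  move=> Iab; elim: d => [|d IHd]; first by rewrite subrr; apply: ideal0.
  by rewrite !exprS; apply: congM.
have congm m : I (psub v 'X_[m] - psub w 'X_[m]).
  rewrite !psubX; elim/big_rec2: _ => [|i a b _ Iab].
    by rewrite subrr; apply: ideal0.
  by apply: congM => //; apply: congX.
elim/mpolyind: p => [|c m p _ _ Ip]; first by rewrite !psub0 subrr; apply: ideal0.
rewrite -mul_mpolyC !psubD !psubM !psubC opprD addrACA -mulrBr.
by apply: (idealD idI) Ip; apply: (idealM idI).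
Qed.

Lemma eq_psub n k (v w : 'I_n -> {mpoly F[k]}) p : v =1 w -> psub v p = psub w p.
Proof.
move=> vw; apply/subr0_eq; apply: (psub_congr p (@zero_ideal _)) => i.
by rewrite vw subrr.
Qed.

Lemma psub_comp n k l (v : 'I_n -> {mpoly F[k]}) (w : 'I_k -> {mpoly F[l]})
    (u : 'I_n -> {mpoly F[l]}) p :
  (forall i, psub w (v i) = u i) -> psub w (psub v p) = psub u p.
Proof.
move=> vwu; elim/mpolyind: p => [|c m p _ _ IHp]; first by rewrite !psub0.
rewrite !psubD !psubZ IHp; congr (_ *: _ + _); rewrite !psubX rmorph_prod /=.
by apply: eq_bigr => i _; rewrite psubXn vwu.
Qed.

Lemma psub_id n (p : {mpoly F[n]}) : psub (fun i => 'X_i) p = p.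
Proof.
elim/mpolyind: p => [|c m p _ _ IHp]; first by rewrite psub0.
by rewrite psubD psubZ IHp psubX -mpolyXE_id.
Qed.

Lemma principal_ideal (S : comNzRingType) (d : S) : is_ideal (fun a => exists q, a = d * q).
Proof.
split=> [|a b [q ->] [r ->]|c a [q ->]].
- by exists 0; rewrite mulr0.
- by exists (q + r); rewrite mulrDr.
- by exists (c * q); rewrite mulrCA.
Qed.

(** A factor theorem: if the substitution changes every variable by a multiple of
    [d], it changes every polynomial by a multiple of [d]. *)
Lemma psub_factor n (v : 'I_n -> {mpoly F[n]}) d p :
  (forall i, exists q, 'X_i - v i = d * q) -> exists q, p = psub v p + d * q.
Proof.
move=> vd; have [|q e] := psub_congr (v := fun i => 'X_i) (w := v) p (principal_ideal d).
  exact: vd.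
by exists q; rewrite -e psub_id addrC subrK.
Qed.

End Substitution.

Section Toric.
Variables (F : fieldType) (n k : nat) (T : 'I_n -> 'X_{1..k}).
Variable I : {mpoly F[n]} -> Prop.
Hypothesis idI : is_ideal I.

Definition toric_exp (m : 'X_{1..n}) : 'X_{1..k} :=
  (\big[mnm_add/0%MM]_(i < n) (T i *+ m i))%MM.

Definition toric : {mpoly F[n]} -> {mpoly F[k]} := psub (fun i => 'X_[T i]).
Lemma toric0 : toric 0 = 0. Proof. exact: psub0. Qed.
Lemma toricD p q : toric (p + q) = toric p + toric q. Proof. exact: psubD. Qed.

Hypothesis toric_congr : forall m m', toric_exp m = toric_exp m' ->
  I ('X_[m] - 'X_[m']).

Lemma toric_expE m j : toric_exp m j = (\sum_(i < n) T i j * m i)%N.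
Proof.
by rewrite /toric_exp mnm_sumE; apply: eq_bigr => i _; rewrite mulmnE.
Qed.

Lemma toricX m : toric 'X_[m] = 'X_[toric_exp m].
Proof. by rewrite /toric /psub mmapX /mmap1 mprodXnE. Qed.

Lemma toricZX c m : toric (c *: 'X_[m]) = c *: 'X_[toric_exp m].
Proof. by rewrite -toricX /toric psubZ. Qed.

Lemma toric_expD m m' : toric_exp (m + m')%MM = (toric_exp m + toric_exp m')%MM.
Proof.
apply/mnmP => j; rewrite mnmDE !toric_expE -big_split; apply: eq_bigr => i _ /=.
by rewrite mnmDE mulnDr.
Qed.

(** A linear section of [toric]: it sends a monomial of the image to a chosen
    monomial above it, and the other monomials to [0]. *)
Definition toric_lift_mon (M : 'X_{1..k}) : {mpoly F[n]} :=
  if pselect (exists m, toric_exp m = M) is left e then 'X_[sval (cid e)] else 0.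

Definition toric_lift (p : {mpoly F[k]}) : {mpoly F[n]} :=
  \sum_(M <- msupp p) p@_M *: toric_lift_mon M.

Lemma toric_liftwE w p : (msize p <= w)%N ->
  toric_lift p = \sum_(M : 'X_{1..k < w}) p@_M *: toric_lift_mon M.
Proof.
move=> le_pw; pose J : subFinType _ := 'X_{1..k < w}.
rewrite /toric_lift (big_mksub J) ?msupp_uniq //=; first last.
  by move=> M /msize_mdeg_lt /leq_trans /(_ le_pw) ->.
by rewrite big_rmcond //= => M /memN_msupp_eq0 ->; rewrite scale0r.
Qed.

Fact toric_lift_is_zmod_morphism : zmod_morphism toric_lift.
Proof.
move=> p q; pose w := maxn (msize (p - q)) (maxn (msize p) (msize q)).
rewrite !(@toric_liftwE w) /w ?leq_max ?leqnn ?orbT //.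
rewrite -sumrB; apply: eq_bigr => M _; by rewrite mcoeffB scalerBl.
Qed.
HB.instance Definition _ := GRing.isZmodMorphism.Build _ _ toric_lift
  toric_lift_is_zmod_morphism.

Lemma toric_lift0 : toric_lift 0 = 0. Proof. exact: raddf0. Qed.
Lemma toric_liftD p q : toric_lift (p + q) = toric_lift p + toric_lift q.
Proof. exact: raddfD. Qed.
Lemma toric_liftZX c M : toric_lift (c *: 'X_[M]) = c *: toric_lift_mon M.
Proof.
have [->|c0] := eqVneq c 0; first by rewrite !scale0r toric_lift0.
by rewrite /toric_lift (perm_big _ (msuppZ _ c0)) msuppX big_seq1 mcoeffZ mcoeffX
  eqxx mulr1.
Qed.

Lemma toric_lift_monE m : I (toric_lift_mon (toric_exp m) - 'X_[m]).
Proof.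
rewrite /toric_lift_mon; case: pselect => [e|[]]; last by exists m.
by apply: toric_congr; case: cid.
Qed.

Lemma toricK p : I (toric_lift (toric p) - p).
Proof.
elim/mpolyind: p => [|c m p _ _ Ip]; first by rewrite toric0 toric_lift0 subrr; apply: ideal0.
rewrite toricD toric_liftD.
rewrite toricZX toric_liftZX.
rewrite opprD addrACA -scalerBr -mul_mpolyC.
by apply: (idealD idI) Ip; apply: (idealM idI); apply: toric_lift_monE.
Qed.

(** By linearity it suffices that [I] contains the differences of monomials with
    the same image, which is [toric_congr]. *)
Lemma toric_ker p : toric p = 0 -> I p.
Proof.
move=> p0; have := idealN idI (toricK p).
by rewrite p0 toric_lift0 sub0r opprK.
Qed.

Hypothesis toric_sat : forall m M,
  (exists m', toric_exp m' = (toric_exp m + M)%MM) -> exists m', toric_exp m' = M.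

(** Under [toric_sat] (the exponents of the image are the nonnegative points of
    the lattice they span) multiplication by a monomial of the image preserves
    the monomials outside the image.  The section is then linear over the image,
    that is, the image is a direct summand of the target as a module. *)
Lemma toric_lift_linear a b : I (toric_lift (toric a * b) - a * toric_lift b).
Proof.
have mono m M : I (toric_lift_mon (toric_exp m + M)%MM - 'X_[m] * toric_lift_mon M).
  rewrite {2}/toric_lift_mon; case: pselect => [e|ne].
    case: cid => m' /= <-; rewrite -toric_expD -mpolyXD.
    exact: toric_lift_monE.
  rewrite /toric_lift_mon mulr0 subr0; case: pselect => [e|_]; last exact: ideal0.
  by case: ne; apply: toric_sat e.
elim/mpolyind: a => [|c m a _ _ Ia].
  by rewrite toric0 !mul0r toric_lift0 subrr; apply: ideal0.
rewrite toricD !mulrDl toric_liftD opprD addrACA; apply: idealD => //.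
elim/mpolyind: b {Ia} => [|d M b _ _ Ib].
  by rewrite !mulr0 toric_lift0 mulr0 subrr; apply: ideal0.
rewrite mulrDr !toric_liftD mulrDr opprD addrACA; apply: idealD => //.
have -> : toric (c *: 'X_[m]) * (d *: 'X_[M]) = (c * d) *: 'X_[toric_exp m + M].
  by rewrite toricZX mpolyXD -scalerAl -scalerAr scalerA.
rewrite !toric_liftZX -scalerAl -scalerAr scalerA -scalerBr -mul_mpolyC.
exact: (idealM idI).
Qed.

(** An ideal of the image extended to the target contracts back to itself, since
    the section [toric_lift] maps the coefficients [f i] back. *)
Lemma toric_descent (r : nat) (G : 'I_r -> {mpoly F[n]}) (f : 'I_r -> {mpoly F[k]}) h :
  toric h = \sum_i toric (G i) * f i ->
  exists c : 'I_r -> {mpoly F[n]}, I (h - \sum_i c i * G i).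
Proof.
move=> hE; exists (fun i => toric_lift (f i)).
have := toricK h; rewrite hE raddf_sum => Ih.
have : I (\sum_i (toric_lift (toric (G i) * f i) - G i * toric_lift (f i))).
  by apply: ideal_sum => // i _; apply: toric_lift_linear.
move/(idealB idI)/(_ Ih); rewrite sumrB.
set s := \sum_i _; set t := \sum_i _ => /=.
have -> : s - t - (s - h) = h - t by ring.
by congr (I (_ - _)); apply: eq_bigr => i _; rewrite mulrC.
Qed.
End Toric.

(** * Kernels of monomial maps *)

Section Explicit.
Variable F : fieldType.

Definition xvar n k (lt : (k < n)%N) : {mpoly F[n]} := 'X_(Ordinal lt).
Definition vec n k (s : seq {mpoly F[k]}) : 'I_n -> {mpoly F[k]} :=
  fun i => nth 0 s i.

Lemma psub_xvar n k s i (lt : (i < n)%N) : psub (@vec n k s) (xvar lt) = nth 0 s i.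
Proof. by rewrite psubXU. Qed.

Definition mon n (s : seq nat) : 'X_{1..n} := [multinom nth 0%N s i | i < n].

Lemma monE n s i : mon n s i = nth 0%N s i. Proof. by rewrite mnmE. Qed.

Lemma val_mon n s : size s = n -> (mon n s : seq nat) = s.
Proof.
move=> ss; apply: (@eq_from_nth _ 0%N); first by rewrite size_tuple ss.
move=> i; rewrite size_tuple => ltin.
by rewrite -(monE s (Ordinal ltin)) /fun_of_multinom (tnth_nth 0%N).
Qed.

(** Entry [j] of the vector [s] times the matrix [TT] of rows of exponents. *)
Fixpoint dotcol (TT : seq (seq nat)) (s : seq nat) (j : nat) : nat :=
  match TT, s with
  | r :: TT', a :: s' => (nth 0 r j * a + dotcol TT' s' j)%N
  | _, _ => 0%N
  end.

Lemma toric_exp_dotcol n k TT (m : 'X_{1..n}) j : size TT = n ->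
  toric_exp (fun i : 'I_n => mon k (nth [::] TT i)) m j = dotcol TT (m : seq nat) j.
Proof.
move=> sTT; rewrite toric_expE.
have sm : size (m : seq nat) = n by rewrite size_tuple.
have -> : (\sum_(i < n) mon k (nth [::] TT i) j * m i =
           \sum_(i < n) nth 0 (nth [::] TT i) j * nth 0 (m : seq nat) i)%N.
  by apply: eq_bigr => i _; rewrite monE /fun_of_multinom (tnth_nth 0%N).
move: (m : seq nat) sm => s sm {m}; elim: TT n s sTT sm => [|r TT IH] [|n] // [|a s] //.
  by rewrite big_ord0.
by move=> [sTT] [ss]; rewrite big_ord_recl /=; congr (_ + _)%N; apply: IH.
Qed.

Lemma binomial_congr n (I : {mpoly F[n]} -> Prop) (u v w m m' : seq nat) t :
  is_ideal I -> I ('X_[mon n u] - 'X_[mon n v]) ->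
  (forall i, (i < n)%N -> nth 0%N m i = (nth 0%N w i + nth 0%N u i * t)%N) ->
  (forall i, (i < n)%N -> nth 0%N m' i = (nth 0%N w i + nth 0%N v i * t)%N) ->
  I ('X_[mon n m] - 'X_[mon n m']).
Proof.
move=> idI Iuv mE m'E.
have -> : mon n m = (mon n w + mon n u *+ t)%MM.
  by apply/mnmP => i; rewrite mnmDE mulmnE !monE mE.
have -> : mon n m' = (mon n w + mon n v *+ t)%MM.
  by apply/mnmP => i; rewrite mnmDE mulmnE !monE m'E.
rewrite !mpolyXD -!mpolyXn -mulrBr; apply: (idealM idI).
rewrite subrXX; apply: (idealMr idI) => //.
Qed.

Lemma mon_val n (m : 'X_{1..n}) : m = mon n (m : seq nat).
Proof. by apply/mnmP => i; rewrite monE /fun_of_multinom (tnth_nth 0%N). Qed.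

(** The monomial of exponents [s'] arises from that of [s] by replacing a factor
    [u ^ t] by [v ^ t]; [w] is the common cofactor.  Exponents are kept as
    sequences, so that each equation between them is linear arithmetic. *)
Definition binomial_step (u v s s' : seq nat) := exists w t, forall i,
  nth 0%N s i = (nth 0%N w i + nth 0%N u i * t)%N /\
  nth 0%N s' i = (nth 0%N w i + nth 0%N v i * t)%N.

Lemma binomial_step_congr n (I : {mpoly F[n]} -> Prop) u v s s' :
  is_ideal I -> I ('X_[mon n u] - 'X_[mon n v]) ->
  binomial_step u v s s' \/ binomial_step u v s' s ->
  I ('X_[mon n s] - 'X_[mon n s']).
Proof.
move=> idI Iuv [] [w [t st]]; last rewrite -opprB; last apply: (idealN idI).
  by apply: (binomial_congr (w := w) (t := t) idI Iuv) => i _; have [] := st i.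
by apply: (binomial_congr (w := w) (t := t) idI Iuv) => i _; have [] := st i.
Qed.

Lemma toric_congr_seq n k TT (I : {mpoly F[n]} -> Prop) : size TT = n ->
  (forall s s' : seq nat, size s = n -> size s' = n ->
    (forall j, (j < k)%N -> dotcol TT s j = dotcol TT s' j) ->
    I ('X_[mon n s] - 'X_[mon n s'])) ->
  forall m m' : 'X_{1..n},
    toric_exp (fun i : 'I_n => mon k (nth [::] TT i)) m =
    toric_exp (fun i : 'I_n => mon k (nth [::] TT i)) m' ->
    I ('X_[m] - 'X_[m']).
Proof.
move=> sTT IT m m' eq_mm'; rewrite (mon_val m) (mon_val m').
apply: IT; rewrite ?size_tuple // => j ltj.
by have := congr1 (fun M : 'X_{1..k} => M (Ordinal ltj)) eq_mm'; rewrite !toric_exp_dotcol.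
Qed.

Notation B := {mpoly F[7]}.
Notation al := (@xvar 7 0 isT).
Notation be := (@xvar 7 1 isT).
Notation mm := (@xvar 7 2 isT).
Notation nn := (@xvar 7 3 isT).
Notation XX := (@xvar 7 4 isT).
Notation YY := (@xvar 7 5 isT).
Notation cc := (@xvar 7 6 isT).

Lemma X_mon7 s : 'X_[mon 7 s] =
  al ^+ nth 0%N s 0 * be ^+ nth 0%N s 1 * mm ^+ nth 0%N s 2 * nn ^+ nth 0%N s 3
  * XX ^+ nth 0%N s 4 * YY ^+ nth 0%N s 5 * cc ^+ nth 0%N s 6 :> B.
Proof.
rewrite mpolyXE_id !big_ord_recl big_ord0 mulr1 !mulrA /xvar.
by do ![congr (_ * _)]; rewrite monE; congr ('X_(_) ^+ _); apply: val_inj.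
Qed.

Lemma ord7P (P : 'I_7 -> Prop) :
  P (@Ordinal 7 0 isT) -> P (@Ordinal 7 1 isT) -> P (@Ordinal 7 2 isT) ->
  P (@Ordinal 7 3 isT) -> P (@Ordinal 7 4 isT) -> P (@Ordinal 7 5 isT) ->
  P (@Ordinal 7 6 isT) -> forall i, P i.
Proof.
move=> ? ? ? ? ? ? ?; case=> -[|[|[|[|[|[|[|//]]]]]]] lt;
  by rewrite (bool_irrelevance lt isT).
Qed.

Lemma seq7 (s : seq nat) : size s = 7%N -> exists a0 a1 a2 a3 a4 a5 a6,
  s = [:: a0; a1; a2; a3; a4; a5; a6].
Proof.
case: s => [|a0 [|a1 [|a2 [|a3 [|a4 [|a5 [|a6 [|]]]]]]]] // _.
by exists a0, a1, a2, a3, a4, a5, a6.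
Qed.

Definition sub7 (s : seq B) : B -> B := psub (vec s).

Lemma toric_sub7 TT s p : size TT = 7%N ->
  (forall i : 'I_7, 'X_[mon 7 (nth [::] TT i)] = nth 0 s i) ->
  toric (fun i : 'I_7 => mon 7 (nth [::] TT i)) p = sub7 s p.
Proof. by move=> _ Ts; apply: eq_psub. Qed.

(** A parametrization of [X m^e = Y n^e] by a monomial map.  The powers [d] give
    [m / n] a [d]-th root, which the time reversal of the system requires. *)
Definition rev_sub (d e : nat) : B -> B :=
  sub7 [:: al; be; mm ^+ d; nn ^+ d; XX * nn ^+ (e * d); XX * mm ^+ (e * d); cc].

(** The equation of the time-reversible systems. *)
Definition Wpol e : B := XX * mm ^+ e - YY * nn ^+ e.

(** Two monomials with the same image have [a2 + e a5 = b2 + e b5] and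
    [a3 + e a4 = b3 + e b4], so they differ by a power of [X m^e] over [Y n^e]. *)
Lemma rev_sub_ker d e p : (0 < d)%N -> rev_sub d e p = 0 -> exists q, p = Wpol e * q.
Proof.
move=> d_gt0 p0.
pose TT := [:: [:: 1]; [:: 0; 1]; [:: 0; 0; d]; [:: 0; 0; 0; d];
  [:: 0; 0; 0; e * d; 1]; [:: 0; 0; e * d; 0; 1]; [:: 0; 0; 0; 0; 0; 0; 1]]%N.
have idW := principal_ideal (Wpol e).
refine (@toric_ker F 7 7 (fun i => mon 7 (nth [::] TT i)) _ idW _ p _); last first.
  rewrite (toric_sub7 (s := [:: al; be; mm ^+ d; nn ^+ d; XX * nn ^+ (e * d);
    XX * mm ^+ (e * d); cc])) //.
  by apply: ord7P; rewrite /= X_mon7 /= !expr0 ?expr1 ?mul1r ?mulr1 //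
    mulrC.
apply: (toric_congr_seq (TT := TT)
  (I := fun a => exists q, a = Wpol e * q)) => // s s' /seq7[a0 [a1 [a2 [a3 [a4 [a5 [a6 ->]]]]]]].
move=> /seq7[b0 [b1 [b2 [b3 [b4 [b5 [b6 ->]]]]]]] eqT.
apply: (binomial_step_congr (u := [:: 0; 0; e; 0; 1]%N) (v := [:: 0; 0; 0; e; 0; 1]%N)
  idW).
  exists 1; rewrite mulr1.
  by rewrite !X_mon7 /= !expr0 !expr1 !mul1r !mulr1 mulrC [nn ^+ e * _]mulrC.
have := eqT 0%N isT; have := eqT 1%N isT; have := eqT 2%N isT.
have := eqT 3%N isT; have := eqT 4%N isT; have := eqT 6%N isT.
rewrite /= !mul0n !mul1n !addn0 !add0n => e6 e4 e3 e2 e1 e0.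
have e2' : (a2 + e * a5 = b2 + e * b5)%N.
  by apply/eqP; rewrite -(eqn_pmul2l d_gt0); apply/eqP; move: e2; nia.
have e3' : (a3 + e * a4 = b3 + e * b4)%N.
  by apply/eqP; rewrite -(eqn_pmul2l d_gt0); apply/eqP; move: e3; nia.
have [le45|/ltnW le45] := leqP b4 a4.
  have [t et] : exists t, a4 = (b4 + t)%N by exists (a4 - b4)%N; lia.
  left; exists [:: a0; a1; b2; a3; b4; a5; a6], t.
  do 7! [case; first by split=> /=; nia]; by case.
have [t et] : exists t, b4 = (a4 + t)%N by exists (b4 - a4)%N; lia.
right; exists [:: a0; a1; a2; b3; a4; b5; a6], t.
do 7! [case; first by split=> /=; nia]; by case.
Qed.

End Explicit.

(** * Decomposition along the families of centers *)
Lemma third_scaling (R : comNzRingType) (x y b m n k i : R) : k * i = 1 ->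
  i * x * (i * y) - b ^+ 2 * m * n = (x * y - k ^+ 2 * b ^+ 2 * m * n) * i ^+ 2.
Proof. by move=> ki; ring: ki. Qed.

Lemma third_regroup (R : comNzRingType) (b d c q r s t u : R) :
  b * (d * s + c * t + q * r) + d * u = d * (u + b * s) + b * c * t + b * q * r.
Proof. by ring. Qed.

Section Decompose.
Variable F : numFieldType.
Notation B := {mpoly F[7]}.
Notation al := (@xvar F 7 0 isT).
Notation be := (@xvar F 7 1 isT).
Notation mm := (@xvar F 7 2 isT).
Notation nn := (@xvar F 7 3 isT).
Notation XX := (@xvar F 7 4 isT).
Notation YY := (@xvar F 7 5 isT).
Notation cc := (@xvar F 7 6 isT).
Implicit Types p q f H : B.

Local Ltac subE := rewrite ?(psubE, psub_xvar) /=.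

Lemma sub7_comp s t u p :
  (forall i : 'I_7, sub7 t (nth 0 s i) = nth 0 u i) ->
  sub7 t (sub7 s p) = sub7 u p.
Proof. exact: psub_comp. Qed.

Lemma sub7_id p : sub7 [:: al; be; mm; nn; XX; YY; cc] p = p.
Proof.
rewrite -[RHS]psub_id; apply: eq_psub; exact: ord7P.
Qed.

Lemma sub7_congr s t I p : is_ideal I ->
  (forall i : 'I_7, I (nth 0 s i - nth 0 t i)) -> I (sub7 s p - sub7 t p).
Proof. exact: psub_congr. Qed.

Lemma sub7_factor s d p :
  (forall i : 'I_7, exists q, 'X_i - nth 0 s i = d * q) ->
  exists q, p = sub7 s p + d * q.
Proof. exact: psub_factor. Qed.

Lemma xvar_neq0 n k (lt : (k < n)%N) : @xvar F n k lt != 0.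
Proof.
apply/eqP => /(congr1 (meval (fun=> 1))); rewrite mevalXU meval0.
by apply/eqP/oner_neq0.
Qed.

Lemma natr_mpoly_neq0 n k : k.+1%:R != 0 :> {mpoly F[n]}.
Proof.
by rewrite -mpolyC_nat mpolyC_eq0 pnatr_eq0.
Qed.

(** A parametrization of the Darboux family [al = - l be], [c = 0],
    [X Y = k^2 be^2 m n], monomial up to the constants. *)
Definition third (l k : nat) : B -> B :=
  sub7 [:: - (l%:R * (XX * YY)); XX * YY; mm; nn; k%:R * (XX ^+ 2 * mm);
    k%:R * (YY ^+ 2 * nn); 0].

(** The kernel of the monomial part of [third], before the scaling of [X] and [Y]
    by [k] and the linear conditions on [al] and [c]. *)
Lemma third_toric_ker p :
  sub7 [:: al; XX * YY; mm; nn; XX ^+ 2 * mm; YY ^+ 2 * nn; cc] p = 0 ->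
  exists q, p = (XX * YY - be ^+ 2 * mm * nn) * q.
Proof.
move=> p0.
pose TT := [:: [:: 1]; [:: 0; 0; 0; 0; 1; 1]; [:: 0; 0; 1]; [:: 0; 0; 0; 1];
  [:: 0; 0; 1; 0; 2]; [:: 0; 0; 0; 1; 0; 2]; [:: 0; 0; 0; 0; 0; 0; 1]]%N.
have idW := principal_ideal (XX * YY - be ^+ 2 * mm * nn).
refine (@toric_ker F 7 7 (fun i => mon 7 (nth [::] TT i)) _ idW _ p _); last first.
  rewrite (toric_sub7 (s := [:: al; XX * YY; mm; nn; XX ^+ 2 * mm;
    YY ^+ 2 * nn; cc])) //.
  by apply: ord7P; rewrite /= X_mon7 /= !expr0 ?expr1 ?mul1r ?mulr1 //
    mulrC.
apply: (toric_congr_seq (TT := TT)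
  (I := fun a => exists q, a = (XX * YY - be ^+ 2 * mm * nn) * q)) => // s s'.
move=> /seq7[a0 [a1 [a2 [a3 [a4 [a5 [a6 ->]]]]]]].
move=> /seq7[b0 [b1 [b2 [b3 [b4 [b5 [b6 ->]]]]]]] eqT.
apply: (binomial_step_congr (u := [:: 0; 0; 0; 0; 1; 1]%N) (v := [:: 0; 2; 1; 1]%N)
  idW).
  exists 1; rewrite mulr1 !X_mon7 /=.
  by rewrite !expr0 !expr1 !mul1r !mulr1.
have := eqT 0%N isT; have := eqT 2%N isT; have := eqT 3%N isT.
have := eqT 4%N isT; have := eqT 5%N isT; have := eqT 6%N isT.
rewrite /= !mul0n !mul1n !addn0 !add0n => e6 e5 e4 e3 e2 e0.
have [le45|/ltnW le45] := leqP b4 a4.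
  left; exists [:: a0; a1; a2; a3; b4; b5; a6], (a4 - b4)%N.
  do 7! [case; first by split=> /=; lia]; by case.
right; exists [:: a0; b1; b2; b3; a4; a5; a6], (b4 - a4)%N.
do 7! [case; first by split=> /=; lia]; by case.
Qed.

(** By the first hypothesis [f] lies in [(al + l be, be)], and the cofactor of [be]
    vanishes on the Darboux family together with [f], since [be] does not vanish
    identically there.  So that cofactor lies in the ideal of the family. *)
Lemma third_decompose l k f :
  sub7 [:: 0; 0; mm; nn; XX; YY; cc] f = 0 -> third l k.+1 f = 0 ->
  exists f1 f2 f3, f = (al + l%:R * be) * f1 + be * cc * f2 +
    be * (XX * YY - k.+1%:R ^+ 2 * be ^+ 2 * mm * nn) * f3.
Proof.
move=> f00 f3.
(* First make al = - l be, then split off a multiple of be. *)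
have [q1 fE] : exists q, f = sub7 [:: - (l%:R * be); be; mm; nn; XX; YY; cc] f +
    (al + l%:R * be) * q.
  apply: sub7_factor; apply: ord7P => /=; rewrite -/(xvar _);
    try by exists 0; rewrite mulr0 subrr.
  by exists 1; rewrite opprK mulr1.
set g1 := sub7 _ f in fE.
have [q2 g1E] : exists q, g1 = sub7 [:: al; 0; mm; nn; XX; YY; cc] g1 + be * q.
  apply: sub7_factor; apply: ord7P => /=; rewrite -/(xvar _);
    try by exists 0; rewrite mulr0 subrr.
  by exists 1; rewrite subr0 mulr1.
have g10 : sub7 [:: al; 0; mm; nn; XX; YY; cc] g1 = 0.
  rewrite -[RHS]f00; apply: sub7_comp.
  by apply: ord7P; rewrite /sub7 /=; subE; rewrite ?mulr0 ?oppr0.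
rewrite {}g10 add0r in g1E.
have tg1 : third l k.+1 g1 = third l k.+1 f.
  by apply: sub7_comp; apply: ord7P; rewrite /sub7 /=; subE.
have tq2 : third l k.+1 q2 = 0.
  have : third l k.+1 (be * q2) = 0 by rewrite -g1E tg1.
  rewrite /third /sub7 psubM psub_xvar /= => /eqP; rewrite mulf_eq0.
  by rewrite mulf_eq0 !(negPf (xvar_neq0 _)) => /eqP.
have [q3 [q4 q2E]] : exists a b,
    q2 - sub7 [:: - (l%:R * be); be; mm; nn; XX; YY; 0] q2 =
    (al + l%:R * be) * a + cc * b.
  rewrite -{1}(sub7_id q2).
  apply: (@sub7_congr _ _ (fun p => exists a b, p = (al + l%:R * be) * a + cc * b)).
    split=> [|_ _ [a [b ->]] [a' [b' ->]]|e _ [a [b ->]]].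
    - by exists 0, 0; rewrite !mulr0 addr0.
    - by exists (a + a'), (b + b'); rewrite !mulrDr addrACA.
    - by exists (e * a), (e * b); rewrite mulrDr !(mulrCA e).
  apply: ord7P => /=; try by exists 0, 0; rewrite !mulr0 subrr addr0.
    by exists 1, 0; rewrite mulr0 addr0 mulr1 opprK.
  by exists 0, 1; rewrite mulr0 add0r mulr1 subr0.
set r := sub7 _ q2 in q2E.
(* Scaling X and Y by k turns the equation of the family into a binomial. *)
pose r4 := sub7 [:: al; be; mm; nn; k.+1%:R * XX; k.+1%:R * YY; cc] r.
have [q5 r4E] : exists q, r4 = (XX * YY - be ^+ 2 * mm * nn) * q.
  apply: third_toric_ker; rewrite -[RHS]tq2 /r4 /r.
  rewrite (@sub7_comp [:: - (l%:R * be); be; mm; nn; XX; YY; 0]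
    [:: al; be; mm; nn; k.+1%:R * XX; k.+1%:R * YY; cc]
    [:: - (l%:R * be); be; mm; nn; k.+1%:R * XX; k.+1%:R * YY; 0]).
    apply: sub7_comp.
    by apply: ord7P; rewrite /sub7 /=; subE.
  by apply: ord7P; rewrite /sub7 /=; subE.
pose i : B := (k.+1%:R^-1)%:MP.
have iK : k.+1%:R * i = 1.
  rewrite /i -mpolyC_nat -mpolyCM mulfV ?pnatr_eq0 //.
have rE : r = sub7 [:: al; be; mm; nn; i * XX; i * YY; cc] r4.
  rewrite -[LHS]sub7_id; symmetry; apply: sub7_comp.
  by apply: ord7P; rewrite /sub7 /=; subE; rewrite // mulrA iK mul1r.
pose q6 := sub7 [:: al; be; mm; nn; i * XX; i * YY; cc] q5.
exists (q1 + be * q3), q4, (i ^+ 2 * q6).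
rewrite {1}fE g1E -(subrK r q2) q2E.
have -> : r = (XX * YY - k.+1%:R ^+ 2 * be ^+ 2 * mm * nn) * (i ^+ 2 * q6).
  rewrite {1}rE r4E /sub7 !psubE -/(sub7 _ _) -/q6 /vec /= [RHS]mulrA.
  congr (_ * q6).
  exact: third_scaling.
exact: third_regroup.
Qed.

Lemma linear_factor k p : sub7 [:: al; k%:R * al; mm; nn; XX; YY; cc] p = 0 ->
  exists q, p = (be - k%:R * al) * q.
Proof.
move=> p0; have [q pE] : exists q,
    p = sub7 [:: al; k%:R * al; mm; nn; XX; YY; cc] p + (be - k%:R * al) * q.
  apply: sub7_factor; apply: ord7P => /=; rewrite -/(xvar _);
    try by exists 0; rewrite mulr0 subrr.
  by exists 1; rewrite mulr1.
by exists q; rewrite pE p0 add0r.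
Qed.

Notation xvar8 k := (@xvar F 8 k isT).

(** The eighth variable is a scaling factor.  An image of the monomial substitution
    has equal degrees in [(al, be)] and in [(m, n)], because [al] and [be] only
    occur there multiplied by [m] or [n]; that is, scaling either pair gives the
    same result. *)
Definition scale_ab : B -> {mpoly F[8]} :=
  psub (vec [:: xvar8 7 * xvar8 0; xvar8 7 * xvar8 1; xvar8 2; xvar8 3; xvar8 4;
    xvar8 5; xvar8 6]).
Definition scale_mn : B -> {mpoly F[8]} :=
  psub (vec [:: xvar8 0; xvar8 1; xvar8 7 * xvar8 2; xvar8 7 * xvar8 3; xvar8 4;
    xvar8 5; xvar8 6]).

(** If [d] has one degree more in [(m, n)] than in [(al, be)] and [d f] has equal
    degrees, then each term of [f] has a factor [al] or [be]. *)
Lemma balanced_vanish d f : scale_ab (d * f) = scale_mn (d * f) ->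
  scale_mn d = xvar8 7 * scale_ab d -> scale_ab d != 0 ->
  sub7 [:: 0; 0; mm; nn; XX; YY; cc] f = 0.
Proof.
rewrite /scale_ab /scale_mn !psubM -/scale_ab -/scale_mn => + dE d0.
rewrite dE -mulrA mulrCA => /(mulfI d0) fE.
have := congr1 (psub (vec [:: al; be; mm; nn; XX; YY; cc; 0])) fE.
rewrite psubM psub_xvar mul0r => fE0; rewrite -[RHS]fE0; symmetry; apply: psub_comp.
by apply: ord7P; rewrite /vec /= !psubE /vec /= ?mul0r.
Qed.

Lemma mpoly_neq0 n (v : 'I_n -> F) (p : {mpoly F[n]}) a :
  p.@[v] = a -> a != 0 -> p != 0.
Proof. by move=> <-; apply: contraNneq => ->; rewrite meval0. Qed.

Definition point n (s : seq nat) : 'I_n -> F := fun i => (nth 0%N s i)%:R.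
Lemma meval_xvar n k (lt : (k < n)%N) (v : 'I_n -> F) :
  (xvar F lt).@[v] = v (Ordinal lt).
Proof. exact: mevalXU. Qed.
Lemma meval_nat n (v : 'I_n -> F) k : k%:R.@[v] = k%:R :> F.
Proof. by rewrite -mpolyC_nat mevalC. Qed.

Lemma meval_exp n (v : 'I_n -> F) (p : {mpoly F[n]}) k : (p ^+ k).@[v] = p.@[v] ^+ k.
Proof. exact: rmorphXn. Qed.

Definition mevalE := (@mevalD, @mevalN, @mevalM, @meval_exp, @meval_xvar, @meval_nat).

Lemma psub_cancel n k (v : 'I_n -> {mpoly F[k]}) (d p : {mpoly F[n]}) :
  psub v (d * p) = 0 -> psub v d != 0 -> psub v p = 0.
Proof.
move=> + d0; rewrite psubM => /eqP; rewrite mulf_eq0 (negPf d0) => /eqP //.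
Qed.

(** Divide by the equations of the reversible and the Hamiltonian systems; the
    quotient satisfies the hypotheses of [third_decompose].  The auxiliary
    evaluations show that the divisors do not vanish identically on the families
    met afterwards. *)
Lemma cub_decompose H : scale_ab H = scale_mn H -> rev_sub 2 2 H = 0 ->
  sub7 [:: al; 3%:R * al; mm; nn; XX; YY; cc] H = 0 -> third 3 2 H = 0 ->
  exists f1 f2 f3, H = Wpol F 2 * (be - 3%:R * al) *
    ((al + 3%:R * be) * f1 + be * cc * f2 +
     be * (XX * YY - 2%:R ^+ 2 * be ^+ 2 * mm * nn) * f3).
Proof.
move=> balH revH hamH thirdH.
have [q HE] := rev_sub_ker (isT : 0 < 2)%N revH.
have [f qE] : exists f, q = (be - 3%:R * al) * f.
  apply: linear_factor; rewrite HE in hamH; apply: psub_cancel hamH _.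
  rewrite /Wpol !psubE /vec /=.
  apply: (@mpoly_neq0 _ (point [:: 0; 0; 1; 0; 1]%N) _ 1); last by rewrite ?oppr_eq0 ?pnatr_eq0 ?oner_neq0.
  by rewrite !mevalE /point /=; ring.
move: HE; rewrite qE mulrA => HE.
set d := Wpol F 2 * _ in HE *.
have f0 : sub7 [:: 0; 0; mm; nn; XX; YY; cc] f = 0.
  apply: (@balanced_vanish d); rewrite -?HE //.
    rewrite /d /scale_mn /scale_ab /Wpol !psubE /vec /=; ring.
  rewrite /d /scale_ab /Wpol !psubE /vec /=.
  apply: (@mpoly_neq0 _ (point [:: 0; 1; 1; 0; 1; 0; 0; 1]%N) _ 1); last by rewrite ?oppr_eq0 ?pnatr_eq0 ?oner_neq0.
  by rewrite !mevalE /point /=; ring.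
have t0 : third 3 2 f = 0.
  rewrite HE in thirdH; apply: psub_cancel thirdH _.
  rewrite /d /Wpol !psubE /vec /=.
  apply: (@mpoly_neq0 _ (point [:: 0; 0; 1; 0; 1; 1; 0]%N) _ 20%:R); last by rewrite ?oppr_eq0 ?pnatr_eq0 ?oner_neq0.
  by rewrite !mevalE /point /=; ring.
have [f1 [f2 [f3 fE]]] := third_decompose f0 t0.
by exists f1, f2, f3; rewrite HE {1}fE.
Qed.

(** As in [cub_decompose], with the additional divisor [be] of the Lotka-Volterra
    systems.  The quadratic substitution does not involve the variable [c], which
    is set to [0] at the end to remove the corresponding term. *)
Lemma quad_decompose H : scale_ab H = scale_mn H -> rev_sub 1 3 H = 0 ->
  sub7 [:: al; 2%:R * al; mm; nn; XX; YY; cc] H = 0 ->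
  sub7 [:: al; 0%:R * al; mm; nn; XX; YY; cc] H = 0 -> third 2 1 H = 0 ->
  sub7 [:: al; be; mm; nn; XX; YY; 0] H = H ->
  exists f1 f2, H = Wpol F 3 * (be - 2%:R * al) * be *
    ((al + 2%:R * be) * f1 + be * (XX * YY - 1%:R ^+ 2 * be ^+ 2 * mm * nn) * f2).
Proof.
move=> balH revH hamH lvH thirdH cH.
have [q HE] := rev_sub_ker (isT : 0 < 1)%N revH.
have [q' qE] : exists q', q = (be - 2%:R * al) * q'.
  apply: linear_factor; rewrite HE in hamH; apply: psub_cancel hamH _.
  rewrite /Wpol !psubE /vec /=.
  apply: (@mpoly_neq0 _ (point [:: 0; 0; 1; 0; 1]%N) _ 1); last by rewrite ?oppr_eq0 ?pnatr_eq0 ?oner_neq0.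
  by rewrite !mevalE /point /=; ring.
move: HE; rewrite qE mulrA => HE.
have [f q'E] : exists f, q' = (be - 0%:R * al) * f.
  apply: linear_factor; rewrite HE in lvH; apply: psub_cancel lvH _.
  rewrite /Wpol !psubE /vec /=.
  apply: (@mpoly_neq0 _ (point [:: 1; 0; 1; 0; 1]%N) _ (- 2%:R)); last by rewrite ?oppr_eq0 ?pnatr_eq0 ?oner_neq0.
  by rewrite !mevalE /point /=; ring.
move: HE; rewrite q'E mul0r subr0 mulrA => HE.
set d := Wpol F 3 * _ * _ in HE *.
have f0 : sub7 [:: 0; 0; mm; nn; XX; YY; cc] f = 0.
  apply: (@balanced_vanish d); rewrite -?HE //.
    rewrite /d /scale_mn /scale_ab /Wpol !psubE /vec /=; ring.
  rewrite /d /scale_ab /Wpol !psubE /vec /=.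
  apply: (@mpoly_neq0 _ (point [:: 0; 1; 1; 0; 1; 0; 0; 1]%N) _ 1); last by rewrite ?oppr_eq0 ?pnatr_eq0 ?oner_neq0.
  by rewrite !mevalE /point /=; ring.
have t0 : third 2 1 f = 0.
  rewrite HE in thirdH; apply: psub_cancel thirdH _.
  rewrite /d /Wpol !psubE /vec /=.
  apply: (@mpoly_neq0 _ (point [:: 0; 0; 1; 0; 1; 1; 0]%N) _ 5%:R); last by rewrite ?oppr_eq0 ?pnatr_eq0 ?oner_neq0.
  by rewrite !mevalE /point /=; ring.
have [f1 [f2 [f3 fE]]] := third_decompose f0 t0.
exists (sub7 [:: al; be; mm; nn; XX; YY; 0] f1), (sub7 [:: al; be; mm; nn; XX; YY; 0] f3).
rewrite -[LHS]cH HE {1}fE /d /Wpol /sub7 !psubE /vec /=.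
by rewrite mulr0 mul0r addr0.
Qed.
End Decompose.

(** * Quadratic focus quantities in an explicit ideal *)

Section FocusMap.
Variables (A B : comNzRingType) (phi : {rmorphism A -> B}).

Lemma starts_with_xy_map Psi :
  starts_with_xy Psi -> starts_with_xy (s2map phi Psi).
Proof. by move=> xyPsi i j ltij; rewrite s2mapE xyPsi // rmorph_nat. Qed.

Lemma is_focus_map P Q Psi g : is_focus P Q Psi g ->
  is_focus (s2map phi P) (s2map phi Q) (s2map phi Psi) (phi \o g).
Proof.
move=> [xyPsi psiE]; split; first exact: starts_with_xy_map.
rewrite -s2map_lie psiE; apply/funext => i; apply/funext => j.
by rewrite s2mapE /focus_series; case: ifP => // _; rewrite rmorph0.
Qed.

Lemma s2mapD F G : s2map phi (F + G) = s2map phi F + s2map phi G.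
Proof. exact: rmorphD. Qed.
Lemma s2mapN F : s2map phi (- F) = - s2map phi F.
Proof. exact: rmorphN. Qed.
Lemma s2mapM F G : s2map phi (F * G) = s2map phi F * s2map phi G.
Proof. exact: rmorphM. Qed.
Lemma s2mapXn F n : s2map phi (F ^+ n) = s2map phi F ^+ n.
Proof. exact: rmorphXn. Qed.
Definition s2map_E := (s2mapD, s2mapN, s2mapM, s2mapXn, s2map_cst, s2map_xx, s2map_yy).

Lemma s2map_quadP a b c : s2map phi (quadP a b c) = quadP (phi a) (phi b) (phi c).
Proof. by rewrite /quadP !s2map_E. Qed.
Lemma s2map_quadQ a b c : s2map phi (quadQ a b c) = quadQ (phi a) (phi b) (phi c).
Proof. by rewrite /quadQ !s2map_E. Qed.
Lemma s2map_cubP a b c d :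
  s2map phi (cubP a b c d) = cubP (phi a) (phi b) (phi c) (phi d).
Proof. by rewrite /cubP !s2map_E. Qed.
Lemma s2map_cubQ a b c d :
  s2map phi (cubQ a b c d) = cubQ (phi a) (phi b) (phi c) (phi d).
Proof. by rewrite /cubQ !s2map_E. Qed.
End FocusMap.

Lemma rational_field (K : fieldType) : (forall n, n.+1%:R != 0 :> K) -> rational K.
Proof. by move=> char0; exists (fun n => n.+1%:R^-1) => n; rewrite mulVf. Qed.

Lemma rational_mpoly (F : numFieldType) n : rational {mpoly F[n]}.
Proof.
exists (fun k => (k.+1%:R^-1)%:MP) => k.
by rewrite -mpolyC_nat -mpolyCM mulVf ?pnatr_eq0.
Qed.

Section Membership.
Variable F : numFieldType.
Notation B := {mpoly F[7]}.
Notation al := (@xvar F 7 0 isT).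
Notation be := (@xvar F 7 1 isT).
Notation mm := (@xvar F 7 2 isT).
Notation nn := (@xvar F 7 3 isT).
Notation XX := (@xvar F 7 4 isT).
Notation YY := (@xvar F 7 5 isT).
Notation cc := (@xvar F 7 6 isT).

Section Quadratic.
Notation A := {mpoly F[6]}.
Notation a10 := (@xvar F 6 0 isT).
Notation a01 := (@xvar F 6 1 isT).
Notation am12 := (@xvar F 6 2 isT).
Notation b2m1 := (@xvar F 6 3 isT).
Notation b10 := (@xvar F 6 4 isT).
Notation b01 := (@xvar F 6 5 isT).

(** After the substitution [quad_param] the last two become
    [W be (be - 2 al)] times [al + 2 be], respectively times
    [be (X Y - be^2 m n)], where [W = X m^3 - Y n^3]; the first one spans the
    kernel of the substitution. *)
Definition quad_gens : seq A :=
  [:: a10 * a01 - b10 * b01;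
      am12 * (2%:R * b10 ^+ 3 - 3%:R * a10 * b10 ^+ 2 - 2%:R * a10 ^+ 2 * b10)
      - b2m1 * (2%:R * a01 ^+ 3 - 3%:R * b01 * a01 ^+ 2 - 2%:R * b01 ^+ 2 * a01);
      (am12 * (b10 ^+ 3 - 2%:R * a10 * b10 ^+ 2)
       - b2m1 * (a01 ^+ 3 - 2%:R * b01 * a01 ^+ 2)) * (am12 * b2m1 - a01 * b10)].

Definition quad_param : seq B :=
  [:: al * mm; be * nn; XX; YY; be * mm; al * nn].

Lemma ord6P (P : 'I_6 -> Prop) :
  P (@Ordinal 6 0 isT) -> P (@Ordinal 6 1 isT) -> P (@Ordinal 6 2 isT) ->
  P (@Ordinal 6 3 isT) -> P (@Ordinal 6 4 isT) -> P (@Ordinal 6 5 isT) ->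
  forall i, P i.
Proof.
move=> ? ? ? ? ? ?; case=> -[|[|[|[|[|[|//]]]]]] lt;
  by rewrite (bool_irrelevance lt isT).
Qed.

Lemma X_mon6 s : 'X_[mon 6 s] = a10 ^+ nth 0%N s 0 * a01 ^+ nth 0%N s 1
  * am12 ^+ nth 0%N s 2 * b2m1 ^+ nth 0%N s 3 * b10 ^+ nth 0%N s 4
  * b01 ^+ nth 0%N s 5 :> A.
Proof.
rewrite mpolyXE_id !big_ord_recl big_ord0 mulr1 !mulrA /xvar.
by do ![congr (_ * _)]; rewrite monE; congr ('X_(_) ^+ _); apply: val_inj.
Qed.

Lemma seq6 (s : seq nat) : size s = 6%N -> exists a0 a1 a2 a3 a4 a5,
  s = [:: a0; a1; a2; a3; a4; a5].
Proof.
case: s => [|a0 [|a1 [|a2 [|a3 [|a4 [|a5 [|]]]]]]] // _.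
by exists a0, a1, a2, a3, a4, a5.
Qed.

(** An instance of [toric_descent] modulo the first generator, which spans the
    kernel of the substitution. *)
Lemma quad_descent h (f1 f2 : B) :
  psub (vec quad_param) h = psub (vec quad_param) (nth 0 quad_gens 1) * f1
    + psub (vec quad_param) (nth 0 quad_gens 2) * f2 ->
  exists c0 c1 c2, h = c0 * nth 0 quad_gens 0 + c1 * nth 0 quad_gens 1
    + c2 * nth 0 quad_gens 2.
Proof.
move=> hE.
pose TT := [:: [:: 1; 0; 1]; [:: 0; 1; 0; 1]; [:: 0; 0; 0; 0; 1];
  [:: 0; 0; 0; 0; 0; 1]; [:: 0; 1; 1]; [:: 1; 0; 0; 1]]%N.
have idH := principal_ideal (nth 0 quad_gens 0).
have tE h' : toric (fun i : 'I_6 => mon 7 (nth [::] TT i)) h' = psub (vec quad_param) h'.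
  apply: eq_psub; apply: ord6P; rewrite /vec /= X_mon7 /=;
    by rewrite !expr0 ?expr1 ?mul1r ?mulr1.
have [|||c] := @toric_descent F 6 7 (fun i => mon 7 (nth [::] TT i)) _ idH _ _ 2
  (fun i => nth 0 quad_gens i.+1) (fun i => nth 0 [:: f1; f2] i) h.
- apply: (toric_congr_seq (TT := TT)
    (I := fun a => exists q, a = nth 0 quad_gens 0 * q)) => // s s'.
  move=> /seq6[a0 [a1 [a2 [a3 [a4 [a5 ->]]]]]].
  move=> /seq6[b0 [b1 [b2 [b3 [b4 [b5 ->]]]]]] eqT.
  apply: (binomial_step_congr (u := [:: 1; 1]%N) (v := [:: 0; 0; 0; 0; 1; 1]%N) idH).
    exists 1; rewrite mulr1 !X_mon6 /=.
    by rewrite !expr0 !expr1 !mul1r !mulr1.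
  have := eqT 0%N isT; have := eqT 1%N isT; have := eqT 2%N isT.
  have := eqT 3%N isT; have := eqT 4%N isT; have := eqT 5%N isT.
  rewrite /= !mul0n !mul1n !addn0 !add0n => e5 e4 e3 e2 e1 e0.
  have [le00|/ltnW le00] := leqP b0 a0.
    left; exists [:: b0; b1; a2; a3; a4; a5], (a0 - b0)%N.
    do 6! [case; first by split=> /=; lia]; by case.
  right; exists [:: a0; a1; a2; a3; b4; b5], (b0 - a0)%N.
  do 6! [case; first by split=> /=; lia]; by case.
(* The preimage takes as many factors a10 = al m as possible; the rest of al and
   of m is then used by b01 and b10. *)
- move=> m M [m' em]; exists (mon 6 [:: minn (M (@Ordinal 7 0 isT)) (M (@Ordinal 7 2 isT));
    M (@Ordinal 7 1 isT) - (M (@Ordinal 7 2 isT) - minn (M (@Ordinal 7 0 isT)) (M (@Ordinal 7 2 isT)));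
    M (@Ordinal 7 4 isT); M (@Ordinal 7 5 isT);
    M (@Ordinal 7 2 isT) - minn (M (@Ordinal 7 0 isT)) (M (@Ordinal 7 2 isT));
    M (@Ordinal 7 0 isT) - minn (M (@Ordinal 7 0 isT)) (M (@Ordinal 7 2 isT))]%N).
  have := fun j => congr1 (fun M : 'X_{1..7} => M j) em.
  have [a0 [a1 [a2 [a3 [a4 [a5 sm]]]]]] := seq6 (size_tuple m).
  have [b0 [b1 [b2 [b3 [b4 [b5 sm']]]]]] := seq6 (size_tuple m').
  move=> eM.
  have := eM (@Ordinal 7 0 isT); have := eM (@Ordinal 7 1 isT).
  have := eM (@Ordinal 7 2 isT); have := eM (@Ordinal 7 3 isT).
  have := eM (@Ordinal 7 6 isT).
  rewrite !mnmDE !(toric_exp_dotcol (TT := TT)) // sm sm' /=.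
  move=> e6 e3 e2 e1 e0; apply/mnmP; apply: ord7P;
    rewrite (toric_exp_dotcol (TT := TT)) // val_mon //=; lia.
- by rewrite tE hE big_ord_recl big_ord1 !tE.
- rewrite big_ord_recl big_ord1 => -[q hq]; exists q, (c ord0), (c (lift ord0 ord0)).
  rewrite -addrA [q * _]mulrC -hq subrK //.
Qed.
End Quadratic.

Lemma quad_rev_identities (L : fieldType) (a b x m n : L) : m != 0 -> n != 0 ->
  [/\ x * m ^+ 3 = x * n ^+ 3 * (m / n) ^+ 3, b * m = b * n * (m / n) &
      a * n = a * m * (n / m)].
Proof. by move=> m0 n0; split; field. Qed.

Lemma divf_inv_swap (L : fieldType) (m n : L) : m != 0 -> n != 0 ->
  n / m * (m / n) = 1.
Proof. by move=> m0 n0; rewrite mulrA divfK // mulfV. Qed.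

Lemma cub_rev_identities (L : fieldType) (a b x m n : L) : m != 0 -> n != 0 ->
  [/\ x * m ^+ 4 = x * n ^+ 4 * (m / n) ^+ 4, b * m ^+ 2 = b * n ^+ 2 * (m / n) ^+ 2 &
      a * n ^+ 2 = a * m ^+ 2 * (n / m) ^+ 2].
Proof. by move=> m0 n0; split; field. Qed.

Lemma psub_vec_comp n k l s t u (p : {mpoly F[n]}) :
  (forall i : 'I_n, psub (@vec F k l t) (nth 0 s i) = nth 0 u i) ->
  psub (@vec F k l t) (psub (vec s) p) = psub (vec u) p.
Proof. exact: psub_comp. Qed.

Section Embedding.
(** Time reversal involves [m / n], and the inverse integrating factors have to be
    invertible at the origin; so the centers are considered over a field [K] that
    contains the coordinate ring [B]. *)
Variables (K : fieldType) (j : {rmorphism B -> K}).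
Hypothesis ratK : rational K.
Hypothesis j_inj : forall p, j p = 0 -> p = 0.

Definition is_center_at k (P Q : series2 K) := forall Psi g, is_focus P Q Psi g -> g k = 0.

Lemma embed_neq0 (p : B) : p != 0 -> j p != 0.
Proof. by apply: contra_neq; apply: j_inj. Qed.
Lemma embedM (p q : B) : j (p * q) = j p * j q.
Proof. exact: rmorphM. Qed.
Lemma embedXn (p : B) n : j (p ^+ n) = j p ^+ n.
Proof. exact: rmorphXn. Qed.
Lemma embedN (p : B) : j (- p) = - j p.
Proof. exact: rmorphN. Qed.
Lemma embed_nat n : j (n%:R : B) = n%:R.
Proof. exact: rmorph_nat. Qed.
Lemma embed0 : j 0 = 0. Proof. exact: rmorph0. Qed.

Section QuadraticMembership.
Notation A := {mpoly F[6]}.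
Notation a10 := (@xvar F 6 0 isT).
Notation a01 := (@xvar F 6 1 isT).
Notation am12 := (@xvar F 6 2 isT).
Notation b2m1 := (@xvar F 6 3 isT).
Notation b10 := (@xvar F 6 4 isT).
Notation b01 := (@xvar F 6 5 isT).
Variables (Psi : series2 A) (g : nat -> A) (k : nat).
Hypothesis fPsi : is_focus (quadP a10 a01 am12) (quadQ b2m1 b10 b01) Psi g.
Hypothesis k_gt0 : (0 < k)%N.

(** The substitution of the [u_i] for the parameters, followed by the embedding in
    [K], maps [Psi] and [g] to a normalized series and the focus quantities of a
    center. *)
Lemma quad_vanish (u0 u1 u2 u3 u4 u5 : B) :
  is_center_at k (quadP (j u0) (j u1) (j u2))
    (quadQ (j u3) (j u4) (j u5)) ->
  psub (vec [:: u0; u1; u2; u3; u4; u5]) (g k) = 0.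
Proof.
move=> ctr; pose f := [the {rmorphism _ -> _} of
  j \o psub (@vec F 6 7 [:: u0; u1; u2; u3; u4; u5])].
have /ctr/eqP : is_focus (quadP (j u0) (j u1) (j u2))
    (quadQ (j u3) (j u4) (j u5)) (s2map f Psi) (f \o g).
  have := is_focus_map f fPsi; rewrite s2map_quadP s2map_quadQ.
  by rewrite /f /= !psub_xvar.
by move/eqP/j_inj.
Qed.

Notation phi := (psub (vec quad_param)).

(** The hypotheses of [quad_decompose] are checked in order: degrees, reversible,
    Hamiltonian, Lotka-Volterra and Darboux families, absence of [c]. *)
Lemma quad_focus_mem : exists c0 c1 c2, g k = c0 * nth 0 quad_gens 0
  + c1 * nth 0 quad_gens 1 + c2 * nth 0 quad_gens 2.
Proof.
have mm0 := embed_neq0 (xvar_neq0 F (isT : (2 < 7)%N)).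
have nn0 := embed_neq0 (xvar_neq0 F (isT : (3 < 7)%N)).
have [||||||f1 [f2 HE]] := @quad_decompose F (phi (g k)).
- rewrite /scale_ab /scale_mn.
  pose u : seq {mpoly F[8]} := [:: xvar F (isT : (7 < 8)%N) * (xvar F (isT : (0 < 8)%N) * xvar F (isT : (2 < 8)%N));
    xvar F (isT : (7 < 8)%N) * (xvar F (isT : (1 < 8)%N) * xvar F (isT : (3 < 8)%N));
    xvar F (isT : (4 < 8)%N); xvar F (isT : (5 < 8)%N);
    xvar F (isT : (7 < 8)%N) * (xvar F (isT : (1 < 8)%N) * xvar F (isT : (2 < 8)%N));
    xvar F (isT : (7 < 8)%N) * (xvar F (isT : (0 < 8)%N) * xvar F (isT : (3 < 8)%N))].
  rewrite !(@psub_vec_comp _ _ _ _ _ u) //; apply: ord6P;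
    by rewrite /= ?psubM !psub_xvar /= ?mulrA //; congr (_ * _); apply: mulrC.
- rewrite /rev_sub /sub7 (@psub_vec_comp _ _ _ _ _ [:: al * mm; be * nn;
    XX * nn ^+ 3; XX * mm ^+ 3; be * mm; al * nn]); last first.
    by apply: ord6P; rewrite /= ?psubM !psub_xvar.
  apply: quad_vanish => Psi' g'; rewrite ![j (XX * _)]embedM !embedXn !embedM.
  have [-> -> ->] := quad_rev_identities (j al) (j be) (j XX) mm0 nn0.
  apply: (quad_reversible_center ratK k_gt0).
  exact: divf_inv_swap.
- rewrite /sub7 (@psub_vec_comp _ _ _ _ _ [:: al * mm; 2%:R * (al * nn);
    XX; YY; 2%:R * (al * mm); al * nn]); last first.
    by apply: ord6P; rewrite /= ?psubM !psub_xvar //= ?mulrA.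
  apply: quad_vanish => Psi' g'; rewrite ![j (2%:R * _)]embedM embed_nat.
  exact: (quad_hamiltonian_center ratK k_gt0).
- rewrite /sub7 (@psub_vec_comp _ _ _ _ _ [:: al * mm; 0; XX; YY; 0; al * nn]); last first.
    by apply: ord6P; rewrite /= ?psubM !psub_xvar //= !mul0r.
  apply: quad_vanish => Psi' g'; rewrite embed0.
  exact: (quad_lotka_volterra_center ratK k_gt0).
- rewrite /third /sub7 (@psub_vec_comp _ _ _ _ _ [:: - 2%:R * (XX * YY * mm);
    XX * YY * nn; XX ^+ 2 * mm; YY ^+ 2 * nn; XX * YY * mm;
    - 2%:R * (XX * YY * nn)]); last first.
    by apply: ord6P; rewrite /= ?psubM !psub_xvar //= ?mulr1n ?mul1r // !mulNr !mulrA.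
  apply: quad_vanish => Psi' g'; rewrite ![j (_ 2%:R * _)]embedM.
  rewrite embedN embed_nat; set p := j (_ * mm); set q := j (_ * nn).
  set X := j _; set Y := j _.
  have p0 : p != 0 by apply: embed_neq0; rewrite !mulf_eq0 !negb_or !xvar_neq0.
  have q0 : q != 0 by apply: embed_neq0; rewrite !mulf_eq0 !negb_or !xvar_neq0.
  apply: (quad_zariski_center ratK k_gt0 (u := (- 2%:R * p * q)^-1)).
    by rewrite /X /Y /p /q -!embedM; congr (j _); ring.
  rewrite mulfV // !mulf_neq0 // oppr_eq0 -embed_nat.
  apply: embed_neq0; exact: natr_mpoly_neq0.
- rewrite /sub7; apply: psub_vec_comp.
  by apply: ord6P; rewrite /= ?psubM !psub_xvar.
apply: (quad_descent (f1 := f1) (f2 := f2)); rewrite HE /Wpol /quad_gens /=.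
rewrite !psubE /vec /=; ring.
Qed.
End QuadraticMembership.
End Embedding.
End Membership.

(** * Cubic focus quantities in an explicit ideal *)
Section CubicMembership.
Variable F : numFieldType.
Notation B := {mpoly F[7]}.
Notation al := (@xvar F 7 0 isT).
Notation be := (@xvar F 7 1 isT).
Notation mm := (@xvar F 7 2 isT).
Notation nn := (@xvar F 7 3 isT).
Notation XX := (@xvar F 7 4 isT).
Notation YY := (@xvar F 7 5 isT).
Notation cc := (@xvar F 7 6 isT).
Notation A := {mpoly F[8]}.
Notation a20 := (@xvar F 8 0 isT).
Notation a11 := (@xvar F 8 1 isT).
Notation a02 := (@xvar F 8 2 isT).
Notation am13 := (@xvar F 8 3 isT).
Notation b3m1 := (@xvar F 8 4 isT).
Notation b20 := (@xvar F 8 5 isT).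
Notation b11 := (@xvar F 8 6 isT).
Notation b02 := (@xvar F 8 7 isT).

(** After the substitution [cub_param] the last three become
    [W (be - 3 al)] times [al + 3 be], [be c] and [be (X Y - 4 be^2 m n)], where
    [W = X m^2 - Y n^2]; the first two span the kernel of the substitution. *)
Definition cub_gens : seq A :=
  [:: a11 - b11; a20 * a02 - b20 * b02;
      am13 * (3%:R * b20 ^+ 2 - 8%:R * a20 * b20 - 3%:R * a20 ^+ 2)
      - b3m1 * (3%:R * a02 ^+ 2 - 8%:R * b02 * a02 - 3%:R * b02 ^+ 2);
      (am13 * (b20 ^+ 2 - 3%:R * a20 * b20)
       - b3m1 * (a02 ^+ 2 - 3%:R * b02 * a02)) * a11;
      (am13 * (b20 ^+ 2 - 3%:R * a20 * b20)
       - b3m1 * (a02 ^+ 2 - 3%:R * b02 * a02)) * (am13 * b3m1 - 4%:R * a02 * b20)].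

Definition cub_param : seq B :=
  [:: al * mm; cc; be * nn; XX; YY; be * mm; cc; al * nn].

Lemma ord8P (P : 'I_8 -> Prop) :
  P (@Ordinal 8 0 isT) -> P (@Ordinal 8 1 isT) -> P (@Ordinal 8 2 isT) ->
  P (@Ordinal 8 3 isT) -> P (@Ordinal 8 4 isT) -> P (@Ordinal 8 5 isT) ->
  P (@Ordinal 8 6 isT) -> P (@Ordinal 8 7 isT) -> forall i, P i.
Proof.
move=> ? ? ? ? ? ? ? ?; case=> -[|[|[|[|[|[|[|[|//]]]]]]]] lt;
  by rewrite (bool_irrelevance lt isT).
Qed.

Lemma X_mon8 s : 'X_[mon 8 s] = a20 ^+ nth 0%N s 0 * a11 ^+ nth 0%N s 1
  * a02 ^+ nth 0%N s 2 * am13 ^+ nth 0%N s 3 * b3m1 ^+ nth 0%N s 4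
  * b20 ^+ nth 0%N s 5 * b11 ^+ nth 0%N s 6 * b02 ^+ nth 0%N s 7 :> A.
Proof.
rewrite mpolyXE_id !big_ord_recl big_ord0 mulr1 !mulrA /xvar.
by do ![congr (_ * _)]; rewrite monE; congr ('X_(_) ^+ _); apply: val_inj.
Qed.

Lemma seq8 (s : seq nat) : size s = 8%N -> exists a0 a1 a2 a3 a4 a5 a6 a7,
  s = [:: a0; a1; a2; a3; a4; a5; a6; a7].
Proof.
case: s => [|a0 [|a1 [|a2 [|a3 [|a4 [|a5 [|a6 [|a7 [|]]]]]]]]] // _.
by exists a0, a1, a2, a3, a4, a5, a6, a7.
Qed.

Definition in_two (R : comNzRingType) (d e : R) (p : R) := exists a b, p = d * a + e * b.

Lemma two_ideal (R : comNzRingType) (d e : R) : is_ideal (in_two d e).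
Proof.
split=> [|_ _ [a [b ->]] [a' [b' ->]]|c _ [a [b ->]]].
- by exists 0, 0; rewrite !mulr0 addr0.
- by exists (a + a'), (b + b'); rewrite !mulrDr addrACA.
- by exists (c * a), (c * b); rewrite mulrDr !(mulrCA c).
Qed.

(** Instance of [toric_descent] modulo the first two generators. *)
Lemma cub_descent h (f1 f2 f3 : B) :
  psub (vec cub_param) h = psub (vec cub_param) (nth 0 cub_gens 2) * f1
    + psub (vec cub_param) (nth 0 cub_gens 3) * f2
    + psub (vec cub_param) (nth 0 cub_gens 4) * f3 ->
  exists c0 c1 c2 c3 c4, h = c0 * nth 0 cub_gens 0 + c1 * nth 0 cub_gens 1
    + c2 * nth 0 cub_gens 2 + c3 * nth 0 cub_gens 3 + c4 * nth 0 cub_gens 4.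
Proof.
move=> hE.
pose TT := [:: [:: 1; 0; 1]; [:: 0; 0; 0; 0; 0; 0; 1]; [:: 0; 1; 0; 1];
  [:: 0; 0; 0; 0; 1]; [:: 0; 0; 0; 0; 0; 1]; [:: 0; 1; 1];
  [:: 0; 0; 0; 0; 0; 0; 1]; [:: 1; 0; 0; 1]]%N.
have idH := two_ideal (nth 0 cub_gens 0) (nth 0 cub_gens 1).
have tE h' : toric (fun i : 'I_8 => mon 7 (nth [::] TT i)) h' = psub (vec cub_param) h'.
  apply: eq_psub; apply: ord8P; rewrite /vec /= X_mon7 /=;
    by rewrite !expr0 ?expr1 ?mul1r ?mulr1.
have [|||c] := @toric_descent F 8 7 (fun i => mon 7 (nth [::] TT i)) _ idH _ _ 3
  (fun i => nth 0 cub_gens i.+2) (fun i => nth 0 [:: f1; f2; f3] i) h.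
- apply: (toric_congr_seq (TT := TT)
    (I := in_two (nth 0 cub_gens 0) (nth 0 cub_gens 1))) => // s s'.
  move=> /seq8[a0 [a1 [a2 [a3 [a4 [a5 [a6 [a7 ->]]]]]]]].
  move=> /seq8[b0 [b1 [b2 [b3 [b4 [b5 [b6 [b7 ->]]]]]]]] eqT.
  (* Modulo a11 - b11 all powers of b11 may be moved to a11; the remaining
     monomials with the same image differ by a power of a20 a02 over b20 b02. *)
  have step1 d0 d1 d2 d3 d4 d5 d6 d7 : in_two (nth 0 cub_gens 0) (nth 0 cub_gens 1)
     ('X_[mon 8 [:: d0; (d1 + d6)%N; d2; d3; d4; d5; 0%N; d7]] -
      'X_[mon 8 [:: d0; d1; d2; d3; d4; d5; d6; d7]]).
    apply: (binomial_step_congr (u := [:: 0; 1]%N) (v := [:: 0; 0; 0; 0; 0; 0; 1]%N) idH).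
      exists 1, 0; rewrite mulr1 mulr0 addr0 !X_mon8 /=.
      by rewrite !expr0 !expr1 !mul1r !mulr1.
    left; exists [:: d0; d1; d2; d3; d4; d5; 0%N; d7], d6.
    do 8! [case; first by split=> /=; lia]; by case.
  have diff := idealB idH (step1 a0 a1 a2 a3 a4 a5 a6 a7) (step1 b0 b1 b2 b3 b4 b5 b6 b7).
  move: diff; set M1 := 'X_[mon 8 [:: a0, (_ + _)%N & _]]; set M2 := 'X_[mon 8 [:: a0, a1 & _]].
  set M3 := 'X_[mon 8 [:: b0, (_ + _)%N & _]]; set M4 := 'X_[mon 8 [:: b0, b1 & _]] => diff.
  suff M13 : in_two (nth 0 cub_gens 0) (nth 0 cub_gens 1) (M1 - M3).
    have := idealB idH M13 diff.
    by have -> : M1 - M3 - (M1 - M2 - (M3 - M4)) = M2 - M4 by ring.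
  rewrite /M1 /M3 {M1 M2 M3 M4 diff}.
  apply: (binomial_step_congr (u := [:: 1; 0; 1]%N) (v := [:: 0; 0; 0; 0; 0; 1; 0; 1]%N) idH).
    exists 0, 1; rewrite mulr1 mulr0 add0r !X_mon8 /=.
    by rewrite !expr0 !expr1 !mul1r !mulr1.
  have := eqT 0%N isT; have := eqT 1%N isT; have := eqT 2%N isT.
  have := eqT 3%N isT; have := eqT 4%N isT; have := eqT 5%N isT.
  have := eqT 6%N isT.
  rewrite /= !mul0n !mul1n !addn0 !add0n => e6 e5 e4 e3 e2 e1 e0.
  have [le00|/ltnW le00] := leqP b0 a0.
    left; exists [:: b0; (a1 + a6)%N; b2; a3; a4; a5; 0%N; a7], (a0 - b0)%N.
    do 8! [case; first by split=> /=; lia]; by case.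
  right; exists [:: a0; (a1 + a6)%N; a2; a3; a4; b5; 0%N; b7], (b0 - a0)%N.
  do 8! [case; first by split=> /=; lia]; by case.
(* The preimage takes as many factors a20 = al m as possible, and all of c from
   a11. *)
- move=> m M [m' em]; exists (mon 8 [:: minn (M (@Ordinal 7 0 isT)) (M (@Ordinal 7 2 isT));
    M (@Ordinal 7 6 isT);
    M (@Ordinal 7 1 isT) - (M (@Ordinal 7 2 isT) - minn (M (@Ordinal 7 0 isT)) (M (@Ordinal 7 2 isT)));
    M (@Ordinal 7 4 isT); M (@Ordinal 7 5 isT);
    M (@Ordinal 7 2 isT) - minn (M (@Ordinal 7 0 isT)) (M (@Ordinal 7 2 isT)); 0;
    M (@Ordinal 7 0 isT) - minn (M (@Ordinal 7 0 isT)) (M (@Ordinal 7 2 isT))]%N).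
  have := fun j => congr1 (fun M : 'X_{1..7} => M j) em.
  have [a0 [a1 [a2 [a3 [a4 [a5 [a6 [a7 sm]]]]]]]] := seq8 (size_tuple m).
  have [b0 [b1 [b2 [b3 [b4 [b5 [b6 [b7 sm']]]]]]]] := seq8 (size_tuple m').
  move=> eM.
  have := eM (@Ordinal 7 0 isT); have := eM (@Ordinal 7 1 isT).
  have := eM (@Ordinal 7 2 isT); have := eM (@Ordinal 7 3 isT).
  rewrite !mnmDE !(toric_exp_dotcol (TT := TT)) // sm sm' /=.
  move=> e3 e2 e1 e0; apply/mnmP; apply: ord7P;
    rewrite (toric_exp_dotcol (TT := TT)) // val_mon //=; lia.
- by rewrite tE hE !big_ord_recl big_ord0 addr0 !tE addrA.
- rewrite !big_ord_recl big_ord0 addr0 /= => -[q [q' hq]].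
  exists q, q', (c ord0), (c (lift ord0 ord0)), (c (lift ord0 (lift ord0 ord0))).
  rewrite -[LHS](subrK (c ord0 * nth 0 cub_gens 2 + (c (lift ord0 ord0) * nth 0 cub_gens 3 +
    c (lift ord0 (lift ord0 ord0)) * nth 0 cub_gens 4))).
  by rewrite [X in X + _]hq !addrA [q * _]mulrC [q' * _]mulrC.
Qed.

Section Embedding.
Variables (K : fieldType) (j : {rmorphism B -> K}).
Hypothesis ratK : rational K.
Hypothesis j_inj : forall p, j p = 0 -> p = 0.
Variables (Psi : series2 A) (g : nat -> A) (k : nat).
Hypothesis fPsi :
  is_focus (cubP a20 a11 a02 am13) (cubQ b3m1 b20 b11 b02) Psi g.
Hypothesis k_gt0 : (0 < k)%N.
Notation fM := (embedM j).
Notation fXn := (embedXn j).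

(** The cubic analogue of [quad_vanish]. *)
Lemma cub_vanish (u0 u1 u2 u3 u4 u5 u6 u7 : B) :
  is_center_at k (cubP (j u0) (j u1) (j u2) (j u3)) (cubQ (j u4) (j u5) (j u6) (j u7)) ->
  psub (vec [:: u0; u1; u2; u3; u4; u5; u6; u7]) (g k) = 0.
Proof.
move=> ctr; pose f := [the {rmorphism _ -> _} of
  j \o psub (@vec F 8 7 [:: u0; u1; u2; u3; u4; u5; u6; u7])].
have /ctr/eqP : is_focus (cubP (j u0) (j u1) (j u2) (j u3))
    (cubQ (j u4) (j u5) (j u6) (j u7)) (s2map f Psi) (f \o g).
  have := is_focus_map f fPsi; rewrite s2map_cubP s2map_cubQ.
  by rewrite /f /= !psub_xvar.
by move/eqP/j_inj.
Qed.

Notation phi := (psub (vec cub_param)).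

(** The hypotheses of [cub_decompose] in order: degrees, reversible, Hamiltonian
    and Darboux families. *)
Lemma cub_focus_mem : exists c0 c1 c2 c3 c4, g k = c0 * nth 0 cub_gens 0
  + c1 * nth 0 cub_gens 1 + c2 * nth 0 cub_gens 2 + c3 * nth 0 cub_gens 3
  + c4 * nth 0 cub_gens 4.
Proof.
have mm0 := embed_neq0 j_inj (xvar_neq0 F (isT : (2 < 7)%N)).
have nn0 := embed_neq0 j_inj (xvar_neq0 F (isT : (3 < 7)%N)).
have [||||f1 [f2 [f3 HE]]] := @cub_decompose F (phi (g k)).
- rewrite /scale_ab /scale_mn.
  pose u : seq {mpoly F[8]} := [:: xvar F (isT : (7 < 8)%N) * (xvar F (isT : (0 < 8)%N) * xvar F (isT : (2 < 8)%N));
    xvar F (isT : (6 < 8)%N);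
    xvar F (isT : (7 < 8)%N) * (xvar F (isT : (1 < 8)%N) * xvar F (isT : (3 < 8)%N));
    xvar F (isT : (4 < 8)%N); xvar F (isT : (5 < 8)%N);
    xvar F (isT : (7 < 8)%N) * (xvar F (isT : (1 < 8)%N) * xvar F (isT : (2 < 8)%N));
    xvar F (isT : (6 < 8)%N);
    xvar F (isT : (7 < 8)%N) * (xvar F (isT : (0 < 8)%N) * xvar F (isT : (3 < 8)%N))].
  rewrite !(@psub_vec_comp _ _ _ _ _ _ u) //; apply: ord8P;
    by rewrite /= ?psubM !psub_xvar /= ?mulrA //; congr (_ * _); apply: mulrC.
- rewrite /rev_sub /sub7 (@psub_vec_comp _ _ _ _ _ _ [:: al * mm ^+ 2; cc; be * nn ^+ 2;
    XX * nn ^+ 4; XX * mm ^+ 4; be * mm ^+ 2; cc; al * nn ^+ 2]); last first.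
    by apply: ord8P; rewrite /= ?psubM !psub_xvar.
  apply: cub_vanish => Psi' g'; rewrite ![j (XX * _)]fM ![j (al * _)]fM
    ![j (be * _)]fM !fXn.
  have [-> -> ->] := cub_rev_identities (j al) (j be) (j XX) mm0 nn0.
  apply: (cub_reversible_center ratK k_gt0).
  exact: divf_inv_swap.
- rewrite /sub7 (@psub_vec_comp _ _ _ _ _ _ [:: al * mm; cc; 3%:R * (al * nn);
    XX; YY; 3%:R * (al * mm); cc; al * nn]); last first.
    by apply: ord8P; rewrite /= ?psubM !psub_xvar //= ?mulrA.
  apply: cub_vanish => Psi' g'; rewrite ![j (3%:R * _)]fM (embed_nat j).
  exact: (cub_hamiltonian_center ratK k_gt0).
- rewrite /third /sub7 (@psub_vec_comp _ _ _ _ _ _ [:: - 3%:R * (XX * YY * mm); 0;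
    XX * YY * nn; 2%:R * (XX ^+ 2 * mm); 2%:R * (YY ^+ 2 * nn); XX * YY * mm; 0;
    - 3%:R * (XX * YY * nn)]); last first.
    by apply: ord8P; rewrite /= ?psubM !psub_xvar //= !mulNr !mulrA.
  apply: cub_vanish => Psi' g'; rewrite ![j (- 3%:R * _)]fM.
  rewrite (embedN j) (embed_nat j) (embed0 j).
  set p := j (_ * mm); set q := j (_ * nn); set X := j (_ * _); set Y := j (2%:R * (YY ^+ 2 * nn)).
  have c0 : 4%:R * p * q * (2%:R * (p ^+ 2 * X + q ^+ 2 * Y)) != 0.
    rewrite -!(embed_nat j) /p /q /X /Y -!fXn -!fM -(rmorphD j) -!fM.
    apply: (embed_neq0 j_inj).
    apply: (@mpoly_neq0 _ _ (point F [:: 0; 0; 1; 1; 1; 1; 0]%N) _ 32%:R); last first.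
      by rewrite pnatr_eq0.
    by rewrite !mevalE /point /=; ring.
  apply: (cub_darboux_center ratK k_gt0 (u := (4%:R * p * q * (2%:R * (p ^+ 2 * X + q ^+ 2 * Y)))^-1)).
    rewrite /X /Y /p /q -(embed_nat j) -!fM; congr (j _); ring.
  exact: mulfV.
apply: (cub_descent (f1 := f1) (f2 := f2) (f3 := f3)); rewrite HE /Wpol /cub_gens /=.
rewrite !psubE /vec /=; ring.
Qed.
End Embedding.
End CubicMembership.

(** * Homogeneous focus quantities *)
Section Homogeneous.
Variables (F : numFieldType) (n : nat).
Notation A := {mpoly F[n]}.
Notation ph := (pihomog mdeg).
Implicit Types (p c H : A).

Lemma pihomogM_homog d e c H : H \is e.-homog ->
  ph d (c * H) = if (e <= d)%N then ph (d - e) c * H else 0.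
Proof.
move=> homH; rewrite {1}(pihomog_partitionE (mf := mdeg) (leqnn (msize c))) mulr_suml raddf_sum /=.
have termE (i : nat) : ph d (ph i c * H) = if (i + e == d)%N then ph i c * H else 0.
  have homiH : ph i c * H \is (i + e).-homog by rewrite dhomogM ?pihomogP.
  have [<-|ne] := eqVneq (i + e)%N d; first by rewrite pihomog_dE.
  by rewrite (pihomog_ne0 _ homiH).
under eq_bigr => i _ do rewrite termE.
rewrite -big_mkcond /=; case: leqP => [le_ed|lt_de]; last first.
  by rewrite big_pred0 // => i; apply/eqP; lia.
have [lts|ges] := ltnP (d - e) (msize c).
  rewrite (big_pred1 (Ordinal lts)) // => i /=.
  by apply/eqP/eqP => [ei|->] /=; [apply: val_inj => /= | ]; lia.
rewrite big_pred0 => [|i]; last by apply/eqP; have := ltn_ord i; lia.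
have -> : ph (d - e) c = 0; last by rewrite mul0r.
rewrite pihomogE big_seq_cond big1 // => m /andP[/msize_mdeg_lt ltm /eqP em].
by move: ltm; rewrite em ltnNge ges.
Qed.

Lemma homog0_const p : p \is 0.-homog -> p = (p@_0)%:MP.
Proof.
move=> homp; apply/mpolyP => m; rewrite mcoeffC.
have [->|nem] := eqVneq m 0%MM; first by rewrite mulr1.
by rewrite mulr0 (dhomog_nemf_coeff homp) // mdeg_eq0.
Qed.

(** Comparing homogeneous parts of degree [d k], and using that the degrees increase,
    gives [G k = gam H k + (combination of the H i, i < k)] with a constant
    [gam].  At the point [f] all [H i] and hence all [G i] with [i < k] vanish, and
    [G k] does not; so [gam] is not zero and the system can be solved for [H k]. *)
Lemma triangular r (H G : nat -> A) (d : nat -> nat) (I : A -> Prop) :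
  is_ideal I -> {homo d : i k / (i < k)%N} ->
  (forall k, (k < r)%N -> H k \is (d k).-homog) ->
  (forall k, (k < r)%N -> G k \is (d k).-homog) ->
  (forall k, (k < r)%N -> exists c : nat -> A, G k = \sum_(i < r) c i * H i) ->
  (forall k, (k < r)%N -> exists f : {rmorphism A -> F},
    (forall i, (i < k)%N -> f (H i) = 0) /\
    ((forall i, (i < k)%N -> f (G i) = 0) -> f (G k) != 0)) ->
  (forall k, (k < r)%N -> I (G k)) -> forall k, (k < r)%N -> I (H k).
Proof.
move=> idI d_inc homH homG GH sep IG.
have stepA k : (k < r)%N -> exists (c : nat -> A) (gam : F),
    G k = \sum_(i < k) c i * H i + gam%:MP * H k.
  move=> ltkr; have [c Gk] := GH k ltkr.
  pose c' i := if (d i <= d k)%N then ph (d k - d i) (c i) else 0.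
  have termE i : (i < r)%N -> ph (d k) (c i * H i) = c' i * H i.
    move=> ltir; rewrite (pihomogM_homog _ _ (homH _ ltir)) /c'.
    by case: ifP => // _; rewrite mul0r.
  exists c', (c' k)@_0.
  rewrite -homog0_const; last by rewrite /c' leqnn subnn pihomogP.
  rewrite -[LHS](pihomog_dE (homG k ltkr)) Gk raddf_sum /=.
  rewrite (eq_bigr (fun i : 'I_r => c' i * H i)) => [|i _]; last by rewrite termE.
  rewrite -(big_mkord xpredT (fun i => c' i * H i)).
  rewrite (big_cat_nat (n := k.+1)) //= big_nat_recr //= big_mkord.
  rewrite [X in _ + X = _]big_nat_cond [X in _ + X = _]big1 ?addr0 // => i.
  rewrite andbT => /andP[ltki _]; rewrite /c'.
  by rewrite leqNgt d_inc // mul0r.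
elim/ltn_ind => k IH ltkr; have [f [fH fG]] := sep k ltkr.
have [c [gam Gk]] := stepA k ltkr.
have gam0 : gam != 0.
  apply: contraNneq (fG _) => [|i ltik].
    rewrite Gk => ->; rewrite mul0r addr0 rmorph_sum big1 // => i _.
    by rewrite rmorphM /= fH ?mulr0.
  have [c' [gam' ->]] := stepA i (ltn_trans ltik ltkr).
  rewrite rmorphD rmorphM /= fH // mulr0 addr0 rmorph_sum big1 // => l _.
  by rewrite rmorphM /= fH ?mulr0 // (ltn_trans (ltn_ord l)).
have -> : H k = (gam^-1)%:MP * (G k - \sum_(i < k) c i * H i).
  by rewrite Gk addrC addKr mulrA -mpolyCM mulVf // mul1r.
apply: (idealM idI); apply: (idealB idI); first exact: IG.
apply: (ideal_sum idI) => i _; apply: (idealM idI).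
by apply: IH => //; apply: ltn_trans (ltn_ord i) ltkr.
Qed.

(** The component of weight [- e], when the coefficients of the system have weight
    [r] and [x], [y] have weight [-1].  The systems of degree [r + 1] are invariant
    under this scaling, so the component of weight [-2] of a normalized series is
    again one. *)
Definition hcomp (r e : nat) (S : series2 A) : series2 A := fun i j =>
  if (e <= i + j)%N && (r %| i + j - e)%N then ph ((i + j - e) %/ r) (S i j) else 0.

Lemma hcompD r e S T : hcomp r e (S + T) = hcomp r e S + hcomp r e T.
Proof.
apply/funext => i; apply/funext => j; rewrite s2D /hcomp s2D.
by case: ifP => _; rewrite ?addr0 // raddfD.
Qed.
Lemma hcompN r e S : hcomp r e (- S) = - hcomp r e S.
Proof.
apply/funext => i; apply/funext => j; rewrite s2N /hcomp s2N.
by case: ifP => _; rewrite ?oppr0 // raddfN.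
Qed.
Lemma hcomp_xx r e S : hcomp r e.+1 (xx A * S) = xx A * hcomp r e S.
Proof.
apply/funext => i; apply/funext => j; rewrite xxM /hcomp xxM.
by case: i => [|i]; [rewrite raddf0 if_same | rewrite addSn ltnS subSS].
Qed.
Lemma hcomp_yy r e S : hcomp r e.+1 (yy A * S) = yy A * hcomp r e S.
Proof.
apply/funext => i; apply/funext => j; rewrite yyM /hcomp yyM.
by case: j => [|j]; [rewrite raddf0 if_same | rewrite addnS ltnS subSS].
Qed.
Lemma hcomp_ddx r e S : hcomp r e (ddx S) = ddx (hcomp r e.+1 S).
Proof.
apply/funext => i; apply/funext => j; rewrite ddxE /hcomp ddxE addSn ltnS subSS.
by case: ifP => _; rewrite ?mul0rn // raddfMn.
Qed.
Lemma hcomp_ddy r e S : hcomp r e (ddy S) = ddy (hcomp r e.+1 S).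
Proof.
apply/funext => i; apply/funext => j; rewrite ddyE /hcomp ddyE addnS ltnS subSS.
by case: ifP => _; rewrite ?mul0rn // raddfMn.
Qed.
Lemma hcomp_cst r e a S : (0 < r)%N -> a \is 1.-homog ->
  hcomp r e (cst a * S) = cst a * hcomp r (e + r) S.
Proof.
move=> r_gt0 homa; apply/funext => i; apply/funext => j; rewrite cstM /hcomp cstM.
have [le_e|lt_e] /= := leqP e (i + j); last first.
  by rewrite leqNgt (leq_trans lt_e) ?leq_addr // mulr0.
rewrite mulrC (pihomogM_homog _ _ homa) divn_gt0 //.
have [le_er|lt_er] := leqP (e + r) (i + j); last first.
  rewrite leqNgt (_ : (i + j - e < r)%N) /=; last lia.
  by rewrite mulr0 if_same.
rewrite (_ : (r <= i + j - e)%N) /=; last lia.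
have -> : (i + j - e = (i + j - (e + r)) + r)%N by lia.
by rewrite dvdn_addl // divnDr // divnn r_gt0 addnK mulrC; case: ifP => _; rewrite ?mulr0.
Qed.

Lemma starts_with_xy_hcomp r Psi : starts_with_xy Psi -> (0 < r)%N ->
  starts_with_xy (hcomp r 2 Psi).
Proof.
move=> xyPsi r_gt0 i j ltij; rewrite /hcomp xyPsi //.
have [/eqP e2|ne2] := boolP (i + j == 2)%N.
  rewrite e2 subnn dvdn0 div0n /=.
  by rewrite pihomog_dE // -mpolyC_nat; apply/dhomogP => m;
     rewrite msuppC; case: ifP => // _; rewrite inE => /eqP ->; apply: mdeg0.
rewrite (_ : (2 <= i + j)%N = false) /=; last by lia.
by case: i ltij ne2 => [|[|i]] //; case: j => [|[|j]].
Qed.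

Lemma focus_series_hcomp r g : (0 < r)%N -> (r %| 2)%N ->
  hcomp r 2 (focus_series g) = focus_series (fun k => ph (k.*2 %/ r) (g k)).
Proof.
move=> r_gt0 r2; apply/funext => i; apply/funext => j; rewrite /hcomp /focus_series.
have [<-|_] /= := eqVneq i j; last by rewrite raddf0 if_same.
case: i => [|[|i]] /=; rewrite ?raddf0 ?if_same //.
have -> : (i.+2 + i.+2 - 2 = i.+1.*2)%N by lia.
by rewrite -muln2 dvdn_mull.
Qed.
End Homogeneous.

Lemma quad_lieE (R : comNzRingType) (a0 a1 a2 a3 a4 a5 : R) S :
  lie (quadP a0 a1 a2) (quadQ a3 a4 a5) S =
  xx R * ddx S - yy R * ddy S - cst a0 * (xx R * (xx R * ddx S))
  - cst a1 * (xx R * (yy R * ddx S)) - cst a2 * (yy R * (yy R * ddx S))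
  + cst a3 * (xx R * (xx R * ddy S)) + cst a4 * (xx R * (yy R * ddy S))
  + cst a5 * (yy R * (yy R * ddy S)).
Proof. by rewrite /lie /quadP /quadQ; ring. Qed.

Lemma cub_lieE (R : comNzRingType) (a0 a1 a2 a3 a4 a5 a6 a7 : R) S :
  lie (cubP a0 a1 a2 a3) (cubQ a4 a5 a6 a7) S =
  xx R * ddx S - yy R * ddy S - cst a0 * (xx R * (xx R * (xx R * ddx S)))
  - cst a1 * (xx R * (xx R * (yy R * ddx S)))
  - cst a2 * (xx R * (yy R * (yy R * ddx S)))
  - cst a3 * (yy R * (yy R * (yy R * ddx S)))
  + cst a4 * (xx R * (xx R * (xx R * ddy S)))
  + cst a5 * (xx R * (xx R * (yy R * ddy S)))
  + cst a6 * (xx R * (yy R * (yy R * ddy S)))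
  + cst a7 * (yy R * (yy R * (yy R * ddy S))).
Proof. by rewrite /lie /cubP /cubQ; ring. Qed.

Section HomogeneousSystems.
Variable F : numFieldType.

Lemma xvar_homog n k (lt : (k < n)%N) : @xvar F n k lt \is 1.-homog.
Proof. by rewrite dhomogX /= mdeg1. Qed.

Lemma quad_homog_focus (a0 a1 a2 a3 a4 a5 : {mpoly F[6]}) Psi g :
  all (fun a => a \is 1.-homog) [:: a0; a1; a2; a3; a4; a5] ->
  is_focus (quadP a0 a1 a2) (quadQ a3 a4 a5) Psi g ->
  is_focus (quadP a0 a1 a2) (quadQ a3 a4 a5) (hcomp 1 2 Psi)
    (fun k => pihomog mdeg k.*2 (g k)).
Proof.
move=> /= /and5P[h0 h1 h2 h3 /and3P[h4 h5 _]] [xyPsi psiE].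
split; first exact: starts_with_xy_hcomp.
have := congr1 (hcomp 1 2) psiE; rewrite focus_series_hcomp //.
have -> : (fun k => pihomog mdeg (k.*2 %/ 1) (g k)) = (fun k => pihomog mdeg k.*2 (g k)).
  by apply/funext => k; rewrite divn1.
move=> <-; rewrite !quad_lieE !(hcompD, hcompN) !hcomp_cst //.
by rewrite !(hcomp_xx, hcomp_yy) !hcomp_ddx !hcomp_ddy.
Qed.

Lemma cub_homog_focus (a0 a1 a2 a3 a4 a5 a6 a7 : {mpoly F[8]}) Psi g :
  all (fun a => a \is 1.-homog) [:: a0; a1; a2; a3; a4; a5; a6; a7] ->
  is_focus (cubP a0 a1 a2 a3) (cubQ a4 a5 a6 a7) Psi g ->
  is_focus (cubP a0 a1 a2 a3) (cubQ a4 a5 a6 a7) (hcomp 2 2 Psi)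
    (fun k => pihomog mdeg k (g k)).
Proof.
move=> /= /and5P[h0 h1 h2 h3 /and5P[h4 h5 h6 h7 _]] [xyPsi psiE].
split; first exact: starts_with_xy_hcomp.
have := congr1 (hcomp 2 2) psiE; rewrite focus_series_hcomp //.
have -> : (fun k => pihomog mdeg (k.*2 %/ 2) (g k)) = (fun k => pihomog mdeg k (g k)).
  by apply/funext => k; rewrite -muln2 mulnK.
move=> <-; rewrite !cub_lieE !(hcompD, hcompN) !hcomp_cst //.
by rewrite !(hcomp_xx, hcomp_yy) !hcomp_ddx !hcomp_ddy.
Qed.
End HomogeneousSystems.

(** * Focus quantities at integral points *)
Section Evaluation.
Variable R : comNzRingType.
Implicit Types S : nat -> nat -> R.

(** The operations on series as plain functions of the coefficients, so that
    [quad_lie_coef] and [cub_lie_coef] evaluate on integers. *)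
Definition mulx S i j := if i is i'.+1 then S i' j else 0.
Definition muly S i j := if j is j'.+1 then S i j' else 0.
Definition dx S i j := S i.+1 j *+ i.+1.
Definition dy S i j := S i j.+1 *+ j.+1.

Lemma mulxE S : xx R * (S : series2 R) = mulx S.
Proof. by apply/funext => i; apply/funext => j; rewrite xxM. Qed.
Lemma mulyE S : yy R * (S : series2 R) = muly S.
Proof. by apply/funext => i; apply/funext => j; rewrite yyM. Qed.
Lemma dxE S : ddx (S : series2 R) = dx S.
Proof. by apply/funext => i; apply/funext => j; rewrite ddxE. Qed.
Lemma dyE S : ddy (S : series2 R) = dy S.
Proof. by apply/funext => i; apply/funext => j; rewrite ddyE. Qed.

Definition quad_lie_coef (a0 a1 a2 a3 a4 a5 : R) S i j : R :=
  mulx (dx S) i j - muly (dy S) i j - a0 * mulx (mulx (dx S)) i j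
  - a1 * mulx (muly (dx S)) i j - a2 * muly (muly (dx S)) i j
  + a3 * mulx (mulx (dy S)) i j + a4 * mulx (muly (dy S)) i j
  + a5 * muly (muly (dy S)) i j.

Definition cub_lie_coef (a0 a1 a2 a3 a4 a5 a6 a7 : R) S i j : R :=
  mulx (dx S) i j - muly (dy S) i j - a0 * mulx (mulx (mulx (dx S))) i j
  - a1 * mulx (mulx (muly (dx S))) i j - a2 * mulx (muly (muly (dx S))) i j
  - a3 * muly (muly (muly (dx S))) i j + a4 * mulx (mulx (mulx (dy S))) i j
  + a5 * mulx (mulx (muly (dy S))) i j + a6 * mulx (muly (muly (dy S))) i j
  + a7 * muly (muly (muly (dy S))) i j.

Lemma quad_lie_coefE a0 a1 a2 a3 a4 a5 S i j :
  lie (quadP a0 a1 a2) (quadQ a3 a4 a5) (S : series2 R) i j =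
  quad_lie_coef a0 a1 a2 a3 a4 a5 S i j.
Proof. by rewrite quad_lieE !s2D !s2N !cstM !(dxE, dyE) !(mulxE, mulyE). Qed.

Lemma cub_lie_coefE a0 a1 a2 a3 a4 a5 a6 a7 S i j :
  lie (cubP a0 a1 a2 a3) (cubQ a4 a5 a6 a7) (S : series2 R) i j =
  cub_lie_coef a0 a1 a2 a3 a4 a5 a6 a7 S i j.
Proof. by rewrite cub_lieE !s2D !s2N !cstM !(dxE, dyE) !(mulxE, mulyE). Qed.
End Evaluation.

Section Numeric.
Variable F : numFieldType.

Definition zF : {rmorphism Z -> F} :=
  [the {rmorphism _ -> _} of (intr : int -> F) \o int_of_Z].

Lemma zF_eq0 z : (zF z == 0) = (z == 0).
Proof.
rewrite /zF /= intr_eq0; apply/eqP/eqP => [e|-> //].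
by rewrite -(int_of_ZK z) e.
Qed.

(** Row [i] and column [j] of a table hold a coefficient of [x^i y^j]. *)
Definition table_series (tab : seq (seq Z)) i j : Z := nth 0 (nth [::] tab i) j.

Definition below (N : nat) (p : nat -> nat -> bool) :=
  all (fun i => all (p i) (iota 0 (N - i).+1)) (iota 0 N.+1).

Lemma belowP N p i j : below N p -> (i + j <= N)%N -> p i j.
Proof.
move=> /allP pN lij; have := pN i; rewrite mem_iota leq0n add0n ltnS.
move=> /(_ _)/allP; apply; first by lia.
by rewrite mem_iota; lia.
Qed.

(** The table describes [L Psi], where [L] is a common denominator of the
    coefficients of a normalized series [Psi]. *)
Definition start_check (L : Z) (tab : seq (seq Z)) :=
  below 2 (fun i j => table_series tab i j == if (i == 1%N) && (j == 1%N) then L else 0).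

(** The table gives a truncated normalized series whose [k]-th focus quantity is
    [v / L] and whose preceding ones vanish; by uniqueness this is also the value
    of [g k]. *)
Lemma focus_nonzero (P Q : series2 F) (lieZ : (nat -> nat -> Z) -> nat -> nat -> Z)
    Psi g k (L v : Z) tab :
  saddle P Q -> is_focus P Q Psi g -> (0 < k)%N ->
  (forall S i j, lie P Q (fun i j => zF (S i j)) i j = zF (lieZ S i j)) ->
  [&& L != 0, v != 0, start_check L tab &
    below k.*2.+2 (fun i j => lieZ (table_series tab) i j ==
      if (i == k.+1) && (j == k.+1) then v else 0)] ->
  (forall j, (0 < j < k)%N -> g j = 0) -> g k != 0.
Proof.
move=> sPQ fPsi k_gt0 lieE /and4P[L0 v0 startL lieL] gj.
pose S : series2 F := fun i j => zF (table_series tab i j).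
have zL0 : zF L != 0 by rewrite zF_eq0.
have xyS : starts_with_xy (cst (zF L)^-1 * S).
  move=> i j ltij; rewrite cstM /S.
  have /eqP -> := belowP startL (ltij : i + j <= 2)%N.
  by case: ifP => _; rewrite ?rmorph0 ?mulr0 // mulVf.
pose g' j := if j == k then zF v / zF L else 0.
have lieS i j : (i + j <= k.*2.+2)%N ->
    lie P Q (cst (zF L)^-1 * S) i j = focus_series g' i j.
  move=> lij; rewrite lie_cstM cstM lieE /=.
  have /eqP -> := belowP lieL lij; rewrite /focus_series /g'.
  have [ei|nei] := eqVneq i k.+1; have [ej|nej] := eqVneq j k.+1 => /=.
  - by rewrite ei ej eqxx ltnS k_gt0 /= eqxx mulrC.
  - by rewrite ei (eq_sym k.+1) (negPf nej) rmorph0 mulr0.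
  - by rewrite ej (negPf nei) rmorph0 mulr0.
  rewrite rmorph0 mulr0; case: ifP => // /andP[_ i2].
  by case: i i2 nei {lij} => // i _; rewrite eqSS => /negPf ->.
have ratF : rational F by apply: rational_field => n; rewrite pnatr_eq0.
have := focus_unique ratF sPQ (@zero_ideal F) k_gt0 fPsi xyS lieS gj.
move=> /eqP; rewrite subr_eq0 /g' eqxx => /eqP <-.
by rewrite mulf_neq0 ?invr_eq0 ?zF_eq0.
Qed.

Lemma quad_focus_nonzero (z : seq Z) Psi g k (L v : Z) tab :
  is_focus (quadP (zF (nth 0 z 0)) (zF (nth 0 z 1)) (zF (nth 0 z 2)))
    (quadQ (zF (nth 0 z 3)) (zF (nth 0 z 4)) (zF (nth 0 z 5))) Psi g -> (0 < k)%N ->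
  [&& L != 0, v != 0, start_check L tab &
    below k.*2.+2 (fun i j => quad_lie_coef (nth 0 z 0) (nth 0 z 1) (nth 0 z 2)
      (nth 0 z 3) (nth 0 z 4) (nth 0 z 5) (table_series tab) i j ==
      if (i == k.+1) && (j == k.+1) then v else 0)] ->
  (forall j, (0 < j < k)%N -> g j = 0) -> g k != 0.
Proof.
move=> fPsi k_gt0; apply: (focus_nonzero (saddle_quad _ _ _ _ _ _) fPsi k_gt0).
move=> S i j; rewrite -quad_lie_coefE -s2mapE s2map_lie s2map_quadP s2map_quadQ //.
Qed.

Lemma cub_focus_nonzero (z : seq Z) Psi g k (L v : Z) tab :
  is_focus (cubP (zF (nth 0 z 0)) (zF (nth 0 z 1)) (zF (nth 0 z 2)) (zF (nth 0 z 3)))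
    (cubQ (zF (nth 0 z 4)) (zF (nth 0 z 5)) (zF (nth 0 z 6)) (zF (nth 0 z 7)))
    Psi g -> (0 < k)%N ->
  [&& L != 0, v != 0, start_check L tab &
    below k.*2.+2 (fun i j => cub_lie_coef (nth 0 z 0) (nth 0 z 1) (nth 0 z 2)
      (nth 0 z 3) (nth 0 z 4) (nth 0 z 5) (nth 0 z 6) (nth 0 z 7)
      (table_series tab) i j == if (i == k.+1) && (j == k.+1) then v else 0)] ->
  (forall j, (0 < j < k)%N -> g j = 0) -> g k != 0.
Proof.
move=> fPsi k_gt0; apply: (focus_nonzero (saddle_cub _ _ _ _ _ _ _ _) fPsi k_gt0).
move=> S i j; rewrite -cub_lie_coefE -s2mapE s2map_lie s2map_cubP s2map_cubQ //.
Qed.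
End Numeric.

(** * The ideal of focus quantities *)
Section IdealGen.
Variable A : comNzRingType.

Lemma ideal_gen_ideal (S : classical_sets.set A) : is_ideal (ideal_gen S).
Proof.
split=> [|a b|c a].
- by exists 0%N, (fun=> 0), (fun=> 0); split=> [[]|]; rewrite ?big_ord0.
- move=> [n1 [c1 [s1 [S1 ->]]]] [n2 [c2 [s2 [S2 ->]]]].
  exists (n1 + n2)%N, (fun i => match split i with inl i => c1 i | inr i => c2 i end),
    (fun i => match split i with inl i => s1 i | inr i => s2 i end).
  split=> [i|]; first by case: split.
  rewrite big_split_ord /=; congr (_ + _); apply: eq_bigr => i _.
    by rewrite -[lshift _ _]/(unsplit (inl i)) unsplitK.
  by rewrite -[rshift _ _]/(unsplit (inr i)) unsplitK.
- move=> [n [d [s [Ss ->]]]]; exists n, (fun i => c * d i), s; split=> //.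
  by rewrite mulr_sumr; apply: eq_bigr => i _; rewrite mulrA.
Qed.

Lemma ideal_gen_mem (S : classical_sets.set A) a : S a -> ideal_gen S a.
Proof.
move=> Sa; exists 1%N, (fun=> 1), (fun=> a); split=> //.
by rewrite big_ord1 mul1r.
Qed.

(** Stated with an arbitrary ideal [I], the generation property passes to the image
    of the family under a ring morphism, by contraction of [I]. *)
Lemma first_generateP m (g : nat -> A) :
  (forall I : A -> Prop, is_ideal I -> (forall k, (0 < k <= m)%N -> I (g k)) ->
     forall k, (0 < k)%N -> I (g k)) ->
  first_generate m g.
Proof.
move=> gen; rewrite /first_generate; apply/seteqP; split=> h [n [c [s [sP ->]]]].
  exists n, c, s; split=> // i; have [k /= /andP[k_gt0 _] <-] := sP i.
  by exists k.
have idI := ideal_gen_ideal [set g k | k in [set k : nat | (1 <= k <= m)%N]]%classic.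
apply: (ideal_sum idI) => i _; apply: (idealM idI).
have [k /= k_gt0 <-] := sP i; apply: gen => // j /= mj.
by apply: ideal_gen_mem; exists j.
Qed.
End IdealGen.

Lemma preim_ideal (A B : comNzRingType) (f : {rmorphism A -> B}) (I : B -> Prop) :
  is_ideal I -> is_ideal (fun a => I (f a)).
Proof.
move=> idI; split=> [|a b Ia Ib|c a Ia].
- by rewrite rmorph0; apply: ideal0.
- by rewrite rmorphD; apply: idealD.
- by rewrite rmorphM; apply: (idealM idI).
Qed.

Section Homog.
Variables (F : numFieldType) (n : nat).
Implicit Types p q : {mpoly F[n]}.
(** Degrees of explicit products add up by unification of proof terms built from
    the lemmas below. *)
Definition homogeneous d p := p \is d.-homog.
Lemma homog_var k (lt : (k < n)%N) : homogeneous 1 (@xvar F n k lt).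
Proof. exact: xvar_homog. Qed.
Lemma homogB d p q : homogeneous d p -> homogeneous d q -> homogeneous d (p - q).
Proof. exact: rpredB. Qed.
Lemma homogM d e p q : homogeneous d p -> homogeneous e q -> homogeneous (d + e) (p * q).
Proof. exact: dhomogM. Qed.
Lemma homogX d k p : homogeneous d p -> homogeneous (d * k) (p ^+ k).
Proof. exact: dhomogMn. Qed.
Lemma homog_nat k : homogeneous 0 (k%:R : {mpoly F[n]}).
Proof.
rewrite /homogeneous -mpolyC_nat; apply/dhomogP => m; rewrite msuppC.
by case: ifP => // _; rewrite inE => /eqP ->; apply: mdeg0.
Qed.
End Homog.
Arguments homog_var {F n k lt}.
Arguments homog_nat {F n k}.

Local Delimit Scope Z_scope with ZZ.

Section Main.
Variable F : numFieldType.
Notation B := {mpoly F[7]}.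

Lemma rational_frac : rational {fraction B}.
Proof.
apply: rational_field => k; rewrite -(rmorph_nat (@tofrac B)) tofrac_eq0.
exact: natr_mpoly_neq0.
Qed.
Lemma tofrac_inj0 (p : B) : tofrac p = 0 -> p = 0.
Proof. by move/eqP; rewrite tofrac_eq0 => /eqP. Qed.

Definition zpoint n (z : seq Z) : {rmorphism {mpoly F[n]} -> F} :=
  [the {rmorphism _ -> _} of meval (fun i : 'I_n => zF F (nth 0 z i))].

Definition zeval n z (p : {mpoly F[n]}) : F := zpoint n z p.

Definition zFv (z : Z) : F := zF F z.

Lemma zevalX n z k (lt : (k < n)%N) : zeval z (@xvar F n k lt) = zFv (nth 0 z k).
Proof. exact: meval_xvar. Qed.
Lemma zevalD n z (p q : {mpoly F[n]}) : zeval z (p + q) = zeval z p + zeval z q.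
Proof. exact: mevalD. Qed.
Lemma zevalN n z (p : {mpoly F[n]}) : zeval z (- p) = - zeval z p.
Proof. exact: mevalN. Qed.
Lemma zevalM n z (p q : {mpoly F[n]}) : zeval z (p * q) = zeval z p * zeval z q.
Proof. exact: mevalM. Qed.
Lemma zevalXn n z (p : {mpoly F[n]}) k : zeval z (p ^+ k) = zeval z p ^+ k.
Proof. exact: meval_exp. Qed.
Lemma zeval_nat n z k : zeval z (k%:R : {mpoly F[n]}) = k%:R.
Proof. exact: meval_nat. Qed.
Definition zevalE := (zevalD, zevalN, zevalM, zevalXn, zeval_nat, zevalX).

Lemma zF0 : zFv 0%ZZ = 0. Proof. exact: rmorph0. Qed.
Lemma zF1 : zFv 1%ZZ = 1. Proof. exact: rmorph1. Qed.
Lemma zFm2 : zFv (-2)%ZZ = - 2%:R. Proof. by []. Qed.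
Lemma zFm3 : zFv (-3)%ZZ = - 3%:R. Proof. by []. Qed.
Definition zFE := (zF0, zF1, zFm2, zFm3).

Lemma zpoint_xvar n z k (lt : (k < n)%N) : zpoint n z (xvar F lt) = zF F (nth 0 z k).
Proof. exact: meval_xvar. Qed.

Opaque zpoint zF zeval zFv.

Section Quadratic.
Notation A := {mpoly F[6]}.
Notation a10 := (@xvar F 6 0 isT).
Notation a01 := (@xvar F 6 1 isT).
Notation am12 := (@xvar F 6 2 isT).
Notation b2m1 := (@xvar F 6 3 isT).
Notation b10 := (@xvar F 6 4 isT).
Notation b01 := (@xvar F 6 5 isT).
Notation P := (quadP a10 a01 am12).
Notation Q := (quadQ b2m1 b10 b01).
Variables (Psi : series2 A) (g : nat -> A).
Hypothesis fPsi : is_focus P Q Psi g.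
Notation gh k := (pihomog mdeg k.*2 (g k)).

Lemma quad_gh_focus : is_focus P Q (hcomp 1 2 Psi) (fun k => gh k).
Proof. by apply: quad_homog_focus fPsi; rewrite /= !xvar_homog. Qed.

Lemma quad_gens_homog k : (k < 3)%N -> nth 0 (quad_gens F) k \is (k.+1.*2).-homog.
Proof.
case: k => [|[|[|//]]] _ /=.
- exact: (homogB (homogM homog_var homog_var) (homogM homog_var homog_var)).
- exact: (homogB
    (homogM homog_var (homogB (homogB (homogM homog_nat (homogX 3 homog_var))
      (homogM (homogM homog_nat homog_var) (homogX 2 homog_var)))
      (homogM (homogM homog_nat (homogX 2 homog_var)) homog_var)))
    (homogM homog_var (homogB (homogB (homogM homog_nat (homogX 3 homog_var))
      (homogM (homogM homog_nat homog_var) (homogX 2 homog_var)))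
      (homogM (homogM homog_nat (homogX 2 homog_var)) homog_var)))).
exact: (homogM (homogB
    (homogM homog_var (homogB (homogX 3 homog_var)
      (homogM (homogM homog_nat homog_var) (homogX 2 homog_var))))
    (homogM homog_var (homogB (homogX 3 homog_var)
      (homogM (homogM homog_nat homog_var) (homogX 2 homog_var)))))
  (homogB (homogM homog_var homog_var) (homogM homog_var homog_var))).
Qed.

Lemma quad_point (z : seq Z) k (L v : Z) tab :
  [&& L != 0, v != 0, start_check L tab &
    below k.+1.*2.+2 (fun i j => quad_lie_coef (nth 0 z 0) (nth 0 z 1) (nth 0 z 2)
      (nth 0 z 3) (nth 0 z 4) (nth 0 z 5) (table_series tab) i j ==
      if (i == k.+2) && (j == k.+2) then v else 0)] ->
  (forall i, (i < k)%N -> zeval z (nth 0 (quad_gens F) i) = 0) ->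
  exists f : {rmorphism A -> F},
  (forall i, (i < k)%N -> f (nth 0 (quad_gens F) i) = 0) /\
  ((forall i, (i < k)%N -> f (gh i.+1) = 0) -> f (gh k.+1) != 0).
Proof.
move=> check fH; exists (zpoint 6 z); split=> // fG.
have := is_focus_map (zpoint 6 z) quad_gh_focus.
rewrite s2map_quadP s2map_quadQ !zpoint_xvar => fz.
have nz := quad_focus_nonzero fz (isT : (0 < k.+1)%N) check.
by apply: nz => -[|j] //= ltj; apply: fG.
Qed.

(** The points lie on the zero sets of the preceding generators.  Each table holds
    the coefficients of [L Psi] at the point, in the degrees that matter for
    [g_kk]; they solve recursively the linear equations [(i - j) v_ij = ...] that
    the normal form imposes, with [0] chosen for the undetermined [v_ii] except
    for the leading one. *)
Lemma quad_separate k : (k < 3)%N -> exists f : {rmorphism A -> F},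
  (forall i, (i < k)%N -> f (nth 0 (quad_gens F) i) = 0) /\
  ((forall i, (i < k)%N -> f (gh i.+1) = 0) -> f (gh k.+1) != 0).
Proof.
case: k => [|[|[|//]]] _.
- apply: (@quad_point [:: 1; 1; 0; 0; 0; 0]%ZZ _ 2%ZZ (-2)%ZZ
      [:: [::]; [:: 0; 2; -2; 1]; [:: 0; 2]; [:: 0; 2]]%ZZ).
    by vm_compute.
  by [].
- apply: (@quad_point [:: 0; 0; 1; 0; 1; 0]%ZZ _ 120%ZZ 80%ZZ
      [:: [:: 0; 0; 0; -40; 0; -12]; [:: 0; 120; 0; 60; 0; -15]; [:: 0; -120];
      [:: 0; 60]; [:: 0; -20]; [:: 0; 5]]%ZZ).
    by vm_compute.
  by case=> [|//] _; rewrite /= !zevalE /= !zFE; ring.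
- apply: (@quad_point [:: -2; 0; 1; 1; 1; 0]%ZZ _ 4032%ZZ 12600%ZZ
      [:: [:: 0; 0; 0; -1344; 0; -2016; 0; -2520; 504]; [:: 0; 4032; 0; 10080;
      0; 17640; -4032; -16660]; [:: 0; -12096; 0; -40320; 10080; 41160;
      57456]; [:: -1344; 30240; -10080; 0; -93240; -1384236]; [:: 5040;
      -70560; 65520; 778680]; [:: -14112; 163800; -147840; -5255964]; [::
      35280; -386568; -287280]; [:: -83880; 886844]; [:: 195111]]%ZZ).
    by vm_compute.
  by case=> [|[|//]] _; rewrite /= !zevalE /= !zFE; ring.
Qed.

(** By uniqueness the homogeneous parts of the first three focus quantities lie in
    [I]; hence so do the generators, and with them all focus quantities. *)
Lemma quad_generated (I : A -> Prop) : is_ideal I ->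
  (forall k, (0 < k <= 3)%N -> I (g k)) -> forall k, (0 < k)%N -> I (g k).
Proof.
move=> idI Ig.
have Igh k : (k < 3)%N -> I (gh k.+1).
  move=> ltk; have Igk := Ig k.+1 ltk; have [xyh lieh] := quad_gh_focus.
  rewrite -(subrK (g k.+1) (gh k.+1)); apply: (idealD idI) => //.
  apply: (focus_unique (@rational_mpoly F 6) (saddle_quad _ _ _ _ _ _) idI _ fPsi xyh
    (g' := fun k => gh k)) => // [i j _|j /andP[j_gt0 ltj]]; first by rewrite lieh.
  by apply: Ig; lia.
have IH : forall k, (k < 3)%N -> I (nth 0 (quad_gens F) k).
  apply: (triangular (G := fun k => gh k.+1) (d := fun k => k.+1.*2) idI) => //.
  - by move=> i j ltij; rewrite ltn_double.
  - exact: quad_gens_homog.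
  - by move=> k _; apply: pihomogP.
  - move=> k _; have [c0 [c1 [c2 ->]]] := quad_focus_mem rational_frac tofrac_inj0
      quad_gh_focus (isT : (0 < k.+1)%N).
    exists (nth 0 [:: c0; c1; c2]); by rewrite !big_ord_recl big_ord0 /= addr0 !addrA.
  exact: quad_separate.
move=> k k_gt0; have [c0 [c1 [c2 ->]]] := quad_focus_mem rational_frac tofrac_inj0
  fPsi k_gt0.
by do 2! [apply: (idealD idI); last by apply: (idealM idI); apply: IH];
  apply: (idealM idI); apply: IH.
Qed.
End Quadratic.

Section Cubic.
Notation A := {mpoly F[8]}.
Notation a20 := (@xvar F 8 0 isT).
Notation a11 := (@xvar F 8 1 isT).
Notation a02 := (@xvar F 8 2 isT).
Notation am13 := (@xvar F 8 3 isT).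
Notation b3m1 := (@xvar F 8 4 isT).
Notation b20 := (@xvar F 8 5 isT).
Notation b11 := (@xvar F 8 6 isT).
Notation b02 := (@xvar F 8 7 isT).
Notation P := (cubP a20 a11 a02 am13).
Notation Q := (cubQ b3m1 b20 b11 b02).
Variables (Psi : series2 A) (g : nat -> A).
Hypothesis fPsi : is_focus P Q Psi g.
Notation gh k := (pihomog mdeg k (g k)).

Lemma cub_gh_focus : is_focus P Q (hcomp 2 2 Psi) (fun k => gh k).
Proof. by apply: cub_homog_focus fPsi; rewrite /= !xvar_homog. Qed.

Lemma cub_gens_homog k : (k < 5)%N -> nth 0 (cub_gens F) k \is (k.+1).-homog.
Proof.
have hW (u v u' v' : A) : homogeneous 1 u -> homogeneous 1 v -> homogeneous 1 u' -> homogeneous 1 v' ->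
    homogeneous 3 (am13 * (u ^+ 2 - 3%:R * v * u) - b3m1 * (u' ^+ 2 - 3%:R * v' * u')).
  move=> hu hv hu' hv'.
  exact: (homogB
    (homogM homog_var (homogB (homogX 2 hu) (homogM (homogM homog_nat hv) hu)))
    (homogM homog_var (homogB (homogX 2 hu') (homogM (homogM homog_nat hv') hu')))).
case: k => [|[|[|[|[|//]]]]] _ /=.
- exact: (homogB homog_var homog_var).
- exact: (homogB (homogM homog_var homog_var) (homogM homog_var homog_var)).
- exact: (homogB
    (homogM homog_var (homogB (homogB (homogM homog_nat (homogX 2 homog_var))
      (homogM (homogM homog_nat homog_var) homog_var))
      (homogM homog_nat (homogX 2 homog_var))))
    (homogM homog_var (homogB (homogB (homogM homog_nat (homogX 2 homog_var))
      (homogM (homogM homog_nat homog_var) homog_var))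
      (homogM homog_nat (homogX 2 homog_var))))).
- exact: (homogM (hW _ _ _ _ homog_var homog_var homog_var homog_var) homog_var).
exact: (homogM (hW _ _ _ _ homog_var homog_var homog_var homog_var)
  (homogB (homogM homog_var homog_var) (homogM (homogM homog_nat homog_var) homog_var))).
Qed.

Lemma cub_point (z : seq Z) k (L v : Z) tab :
  [&& L != 0, v != 0, start_check L tab &
    below k.+1.*2.+2 (fun i j => cub_lie_coef (nth 0 z 0) (nth 0 z 1) (nth 0 z 2)
      (nth 0 z 3) (nth 0 z 4) (nth 0 z 5) (nth 0 z 6) (nth 0 z 7)
      (table_series tab) i j ==
      if (i == k.+2) && (j == k.+2) then v else 0)] ->
  (forall i, (i < k)%N -> zeval z (nth 0 (cub_gens F) i) = 0) ->
  exists f : {rmorphism A -> F},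
  (forall i, (i < k)%N -> f (nth 0 (cub_gens F) i) = 0) /\
  ((forall i, (i < k)%N -> f (gh i.+1) = 0) -> f (gh k.+1) != 0).
Proof.
move=> check fH; exists (zpoint 8 z); split=> // fG.
have := is_focus_map (zpoint 8 z) cub_gh_focus.
rewrite s2map_cubP s2map_cubQ !zpoint_xvar => fz.
have nz := cub_focus_nonzero fz (isT : (0 < k.+1)%N) check.
by apply: nz => -[|j] //= ltj; apply: fG.
Qed.

(** The points and tables are obtained as in [quad_separate]. *)
Lemma cub_separate k : (k < 5)%N -> exists f : {rmorphism A -> F},
  (forall i, (i < k)%N -> f (nth 0 (cub_gens F) i) = 0) /\
  ((forall i, (i < k)%N -> f (gh i.+1) = 0) -> f (gh k.+1) != 0).
Proof.
case: k => [|[|[|[|[|//]]]]] _.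
- apply: (@cub_point [:: 0; 1; 0; 0; 0; 0; 0; 0]%ZZ _ 1%ZZ (-1)%ZZ
      [:: [::]; [:: 0; 1]]%ZZ).
    by vm_compute.
  by [].
- apply: (@cub_point [:: 1; 0; 1; 0; 0; 0; 0; 0]%ZZ _ 8%ZZ (-8)%ZZ
      [:: [::]; [:: 0; 8; 0; -4; 0; 1]; [::]; [:: 0; 4]; [::]; [:: 0; 3]]%ZZ).
    by vm_compute.
  by case=> [|//] _; rewrite /= !zevalE /= !zFE; ring.
- apply: (@cub_point [:: 0; 0; 0; 1; 0; 1; 0; 0]%ZZ _ 48%ZZ 18%ZZ
      [:: [:: 0; 0; 0; 0; -12]; [:: 0; 48; 0; 0; 0; 0; 0; -4]; [:: 0; 0; 0; 0;
      12]; [:: 0; -24]; [::]; [:: 0; 6]; [::]; [:: 0; -1]]%ZZ).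
    by vm_compute.
  by case=> [|[|//]] _; rewrite /= !zevalE /= !zFE; ring.
- apply: (@cub_point [:: -3; 1; 0; 1; 0; 1; 1; 0]%ZZ _ 96%ZZ 480%ZZ
      [:: [:: 0; 0; 0; 0; -24; 0; 0; 0; 3; 0; 8]; [:: 0; 96; 0; 0; 0; -24; 0;
      -80; 0; 9]; [:: 0; 0; 0; 0; 240; 0; -24; 0; -340]; [:: 0; -192; 0; 0; 0;
      528; 0; -224]; [:: 0; 0; -192; 0; 0; 0; 864]; [:: 0; 480; 0; -192]; [::
      0; 0; 1152; 0; -4672]; [:: 0; -1280; 0; 2016]; [:: 0; 0; -5120]; [:: 0;
      3520]]%ZZ).
    by vm_compute.
  by case=> [|[|[|//]]] _; rewrite /= !zevalE /= !zFE; ring.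
- apply: (@cub_point [:: -3; 0; 0; 1; 1; 1; 0; 0]%ZZ _ 288%ZZ 480%ZZ
      [:: [:: 0; 0; 0; 0; -72; 0; 0; 0; 0; 0; 24]; [:: 0; 288; 0; 0; 0; 0; 0;
      -240]; [:: 0; 0; 0; 0; 720; 0; 0; 0; 0; 0; 255]; [:: 0; -576; 0; 0; 0;
      0; 0; -600; 0; -600]; [:: -72; 0; 0; 0; 0; 0; 960]; [:: 0; 1440; 0;
      -720; 0; 0; 0; 35520]; [:: 240; 0; 0; 0; -13440]; [:: 0; -3840; 0; 1800;
      0; -1440]; [:: -720; 0; 360; 0; 97680]; [:: 0; 10560; 0; 5280]; [::
      2112; 0; -1845]; [:: 0; -29640]; [:: -6160]]%ZZ).
    by vm_compute.
  by case=> [|[|[|[|//]]]] _; rewrite /= !zevalE /= !zFE; ring.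
Qed.

(** The argument of [quad_generated], with five generators. *)
Lemma cub_generated (I : A -> Prop) : is_ideal I ->
  (forall k, (0 < k <= 5)%N -> I (g k)) -> forall k, (0 < k)%N -> I (g k).
Proof.
move=> idI Ig.
have Igh k : (k < 5)%N -> I (gh k.+1).
  move=> ltk; have Igk := Ig k.+1 ltk; have [xyh lieh] := cub_gh_focus.
  rewrite -(subrK (g k.+1) (gh k.+1)); apply: (idealD idI) => //.
  apply: (focus_unique (@rational_mpoly F 8) (saddle_cub _ _ _ _ _ _ _ _) idI _ fPsi xyh
    (g' := fun k => gh k)) => // [i j _|j /andP[j_gt0 ltj]]; first by rewrite lieh.
  by apply: Ig; lia.
have IH : forall k, (k < 5)%N -> I (nth 0 (cub_gens F) k).
  apply: (triangular (G := fun k => gh k.+1) (d := fun k => k.+1) idI) => //.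
  - exact: cub_gens_homog.
  - by move=> k _; apply: pihomogP.
  - move=> k _; have [c0 [c1 [c2 [c3 [c4 ->]]]]] := cub_focus_mem rational_frac tofrac_inj0
      cub_gh_focus (isT : (0 < k.+1)%N).
    exists (nth 0 [:: c0; c1; c2; c3; c4]); by rewrite !big_ord_recl big_ord0 /= addr0 !addrA.
  exact: cub_separate.
move=> k k_gt0; have [c0 [c1 [c2 [c3 [c4 ->]]]]] := cub_focus_mem rational_frac tofrac_inj0
  fPsi k_gt0.
by do 4! [apply: (idealD idI); last by apply: (idealM idI); apply: IH];
  apply: (idealM idI); apply: IH.
Qed.
End Cubic.
End Main.

Lemma first_generate_map (A B : comNzRingType) (f : {rmorphism A -> B}) m
    (g : nat -> A) :
  (forall I : A -> Prop, is_ideal I -> (forall k, (0 < k <= m)%N -> I (g k)) ->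
     forall k, (0 < k)%N -> I (g k)) ->
  first_generate m g /\ first_generate m (fun k => f (g k)).
Proof.
move=> gen; split; apply: first_generateP => // I idI Ig.
exact: (gen (fun a => I (f a)) (preim_ideal f idI) Ig).
Qed.

Theorem proposition3 (R : realType) :
  (forall (Psi : bips (quad_ring R)) (g : nat -> quad_ring R),
     is_focus_quantities (quad_P R) (quad_Q R) Psi g ->
     first_generate 3 g /\
     first_generate 3 (fun k : nat => quad_to_real (g k)))
  /\
  (forall (Psi : bips (cub_ring R)) (g : nat -> cub_ring R),
     is_focus_quantities (cub_P R) (cub_Q R) Psi g ->
     first_generate 5 g /\
     first_generate 5 (fun k : nat => cub_to_real (g k))).
Proof.
split=> Psi g /is_focus_quantitiesE.
  rewrite s2poly_quad_x s2poly_quad_y => fPsi.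
  exact: (first_generate_map [the {rmorphism quad_ring R -> quad_real_ring R} of
    @comp_mpoly 6 R[i] 6 [tuple qr_a10 R; qr_a01 R; qr_am12 R; qr_am12c R;
      qr_a01c R; qr_a10c R]] (quad_generated (F := R[i]) fPsi)).
rewrite s2poly_cub_x s2poly_cub_y => fPsi.
exact: (first_generate_map [the {rmorphism cub_ring R -> cub_real_ring R} of
  @comp_mpoly 8 R[i] 8 [tuple cr_a20 R; cr_a11 R; cr_a02 R; cr_am13 R; cr_am13c R;
    cr_a02c R; cr_a11c R; cr_a20c R]] (cub_generated (F := R[i]) fPsi)).
Qed.
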